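(* Let $\psi\in W_0^{1,p}(\Omega)$ and $f\in L^{p'}(\Omega)$. A function $u$ is a solution of the variational inequality $$u\in K(\psi),\qquad \int_\Omega |\nabla u|^{p-2}\nabla u\cdot\nabla(v-u)\,dx\ \ge\ \int_\Omega f(v-u)\,dx\quad\text{for all } v\in K(\psi)$$ if and only if $u$ is the lowest $f$-superharmonic function greater than $\psi$, that is: $u$ is $f$-superharmonic, $u\ge\psi$ a.e. in $\Omega$, and $u\le v$ a.e. in $\Omega$ for every $f$-superharmonic function $v$ with $v\ge\psi$ a.e. in $\Omega$.
   Context: $\Omega\subset\mathbb{R}^N$, $N\ge 2$, is a bounded domain whose boundary is piecewise $\mathcal C^1$; $1<p<\infty$ and $p'$ is the conjugate exponent of $p$. For $\psi\in W_0^{1,p}(\Omega)$ (the obstacle), $K(\psi)=\{v\in W_0^{1,p}(\Omega): v\ge\psi \text{ a.e. in }\Omega\}$. A function $u$ is called $f$-superharmonic in $\Omega$ if $u\in W_0^{1,p}(\Omega)$ and $-\Delta_p u\ge f$ in the sense of distributions, i.e. $\int_\Omega|\nabla u|^{p-2}\nabla u\cdot\nabla\phi\,dx\ge\int_\Omega f\phi\,dx$ for all $\phi\in\mathcal D(\Omega)=C_c^\infty(\Omega)$ with $\phi\ge0$. *)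

(* Defs.v *)
From HB Require Import structures.
From mathcomp Require Import all_boot all_order all_algebra.
From mathcomp Require Import all_classical all_reals all_analysis.

Set Implicit Arguments.
Unset Strict Implicit.
Unset Printing Implicit Defensive.

Import Order.TTheory GRing.Theory Num.Theory.
Import numFieldNormedType.Exports.

Local Open Scope classical_set_scope.
Local Open Scope ring_scope.

Definition rV_display : measure_display. Proof. exact. Qed.

(** The sigma-algebra on R^n is the one generated by the coordinate
    projections, i.e. the Borel sigma-algebra. *)
Section measurable_rV.
Context (R : realType) (n : nat).

Let coord (i : 'I_n) (x : 'rV[R]_n) : R := x ord0 i.

Let rV_set0 : g_sigma_preimage coord set0.
Proof. exact: sigma_algebra0. Qed.

Let rV_setC A : g_sigma_preimage coord A -> g_sigma_preimage coord (~` A).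
Proof. exact: sigma_algebraC. Qed.

Let rV_bigcup (F : (set 'rV[R]_n)^nat) :
  (forall i, g_sigma_preimage coord (F i)) ->
  g_sigma_preimage coord (\bigcup_i F i).
Proof. exact: sigma_algebra_bigcup. Qed.

HB.instance Definition _ := @isMeasurable.Build rV_display
  'rV[R]_n (g_sigma_preimage coord) rV_set0 rV_setC rV_bigcup.

Lemma measurable_rV_coord (i : 'I_n) :
  measurable_fun [set: 'rV[R]_n] (fun x => x ord0 i).
Proof.
move=> _ Y mY; rewrite setTI; apply: sub_sigma_algebra => /=.
rewrite -bigcup_seq/=; exists i => /=; first by rewrite mem_index_enum.
by exists Y => //; rewrite setTI.
Qed.

Lemma measurable_fun_rVP d (T : measurableType d) (f : T -> 'rV[R]_n) :
  (forall i, measurable_fun [set: T] (fun x => f x ord0 i)) ->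
  measurable_fun [set: T] f.
Proof.
move=> mf.
have H : g_sigma_preimage (fun i => coord i \o f) `<=` measurable.
  apply: smallest_sub; first exact: sigma_algebra_measurable.
  rewrite -bigcup_seq; apply: bigcup_sub => i _.
  by move=> A [B mB <-]; exact: mf.
move: H; rewrite g_sigma_preimage_comp => H _ A mA.
by apply: H; exists A.
Qed.

End measurable_rV.

Section lebesgue_rV.
Context (R : realType).

Definition consrV n (z : R * 'rV[R]_n) : 'rV[R]_n.+1 :=
  \row_(i < n.+1) (if unlift ord0 i is Some j then z.2 ord0 j else z.1).

Definition unconsrV n (x : 'rV[R]_n.+1) : R * 'rV[R]_n :=
  (x ord0 ord0, \row_(j < n) x ord0 (lift ord0 j)).

Lemma consrVK n : cancel (@consrV n) (@unconsrV n).
Proof.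
case=> a v; congr pair; first by rewrite mxE unlift_none.
by apply/rowP => j; rewrite !mxE liftK.
Qed.

Lemma unconsrVK n : cancel (@unconsrV n) (@consrV n).
Proof.
move=> x; apply/rowP => i; rewrite mxE; case: unliftP => [j ->|->] //=.
by rewrite mxE.
Qed.

Lemma measurable_consrV n : measurable_fun [set: R * 'rV[R]_n] (@consrV n).
Proof.
apply: measurable_fun_rVP => i.
case: (unliftP ord0 i) => [j ->|->].
- rewrite (_ : (fun _ => _) = (fun x : 'rV[R]_n => x ord0 j) \o snd).
    by apply: measurableT_comp => //; exact: measurable_rV_coord.
  by apply/funext => z; rewrite mxE liftK.
- rewrite (_ : (fun _ => _) = fst)//.
  by apply/funext => z; rewrite mxE unlift_none.
Qed.

Lemma measurable_unconsrV n : measurable_fun [set: 'rV[R]_n.+1] (@unconsrV n).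
Proof.
apply: measurable_fun_pair; first exact: measurable_rV_coord.
apply: measurable_fun_rVP => i.
rewrite (_ : (fun _ => _) = (fun x : 'rV[R]_n.+1 => x ord0 (lift ord0 i))).
  exact: measurable_rV_coord.
by apply/funext => z; rewrite mxE.
Qed.

Section step.
Context (n : nat) (m : {sigma_finite_measure set 'rV[R]_n -> \bar R}).

Definition lebesgue_rV_step : set 'rV[R]_n.+1 -> \bar R :=
  pushforward (lebesgue_measure \x m)%E (@consrV n).

Let step_measure : {measure set 'rV[R]_n.+1 -> \bar R} :=
  measure_function_pushforward__canonical__measure_function_Measure
    (lebesgue_measure \x m)%E (@measurable_consrV n).

HB.instance Definition _ := isMeasure.Build _ _ _ lebesgue_rV_step
  (measure0 step_measure) (measure_ge0 step_measure)
  (@measure_semi_sigma_additive _ _ _ step_measure).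

Let sigma_finite_step : sigma_finite [set: 'rV[R]_n.+1] lebesgue_rV_step.
Proof.
have /sigma_finiteP[F [TF ndF Foo]] :=
  sigma_finiteT (lebesgue_measure : {sigma_finite_measure set _ -> \bar R}).
have /sigma_finiteP[G [TG ndG Goo]] := sigma_finiteT m.
exists (fun k => @unconsrV n @^-1` (F k `*` G k)).
  apply/esym; rewrite -subTset => x _.
  have [i _ Fi] : (\bigcup_k F k) (unconsrV x).1 by rewrite -TF.
  have [j _ Gj] : (\bigcup_k G k) (unconsrV x).2 by rewrite -TG.
  exists (maxn i j) => //; split.
  - by move: Fi; exact/subsetPset/ndF/leq_maxl.
  - by move: Gj; exact/subsetPset/ndG/leq_maxr.
move=> k; have [mF Fk] := Foo k; have [mG Gk] := Goo k; split.
  rewrite -[X in measurable X]setTI; apply: measurable_unconsrV => //.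
  exact: measurableX.
rewrite /lebesgue_rV_step /pushforward -comp_preimage.
rewrite (_ : @unconsrV n \o _ = id); last by apply/funext => z; exact: consrVK.
rewrite preimage_id product_measure1E// lte_mul_pinfty// ge0_fin_numE//.
Qed.

HB.instance Definition _ := Measure_isSigmaFinite.Build _ _ _
  lebesgue_rV_step sigma_finite_step.
End step.

(** The [n]-fold product of the Lebesgue measure of R. *)
Fixpoint lebesgue_rV (n : nat) : {sigma_finite_measure set 'rV[R]_n -> \bar R} :=
  match n with
  | 0 => \d_(0 : 'rV[R]_0)
  | n'.+1 => lebesgue_rV_step (lebesgue_rV n')
  end.

End lebesgue_rV.
Arguments lebesgue_rV {R} n.

Lemma lebesgue_rV_box (R : realType) n (A : 'I_n -> set R) :
  (forall i, measurable (A i)) ->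
  lebesgue_rV n [set x | forall i, A i (x ord0 i)] =
  (\prod_(i < n) lebesgue_measure (A i))%E.
Proof.
elim: n A => [|n IH] A mA /=.
  by rewrite big_ord0 /= diracE mem_set// => -[].
rewrite big_ord_recl -IH// /lebesgue_rV_step /pushforward.
have m1 : measurable [set x : 'rV[R]_n | forall i, A (lift ord0 i) (x ord0 i)].
  rewrite (_ : [set x : 'rV[R]_n | _] = \bigcap_(i in [set: 'I_n])
      ((fun x : 'rV[R]_n => x ord0 i) @^-1` (A (lift ord0 i)))).
    apply: fin_bigcap_measurable => // i _.
    by rewrite -[X in measurable X]setTI; exact: measurable_rV_coord.
  by apply/seteqP; split => [x h i _|x h i]; [exact: h|exact: (h i I)].
have E := @product_measure1E _ _ _ _ R lebesgue_measure (lebesgue_rV n) (A ord0) _ (mA ord0) m1.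
rewrite [RHS](esym E). congr (product_measure1 _ _ _).
apply/seteqP; split => -[a v] /=.
  move=> h; split; first by have := h ord0; rewrite mxE unlift_none.
  by move=> i; have := h (lift ord0 i); rewrite mxE liftK.
move=> [h0 h1] i; rewrite mxE.
by case: unliftP => [j ->|->] //=.
Qed.

Section euclidean.
Context {R : realType} {N : nat}.
Implicit Types x y : 'rV[R]_N.

Definition dotrV x y : R := \sum_(i < N) x ord0 i * y ord0 i.

(** The Euclidean norm: the norm [`|x|] of ['rV[R]_N] is the sup norm. *)
Definition enorm x : R := Num.sqrt (dotrV x x).

End euclidean.

Section domains.
Context {R : realType}.

Definition partial N (V : normedModType R) (i : 'I_N) (f : 'rV[R]_N -> V) :
  'rV[R]_N -> V := 'D_(delta_mx ord0 i) f.

Definition bounded_domain N (Omega : set 'rV[R]_N) : Prop :=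
  [/\ open Omega, connected Omega, Omega !=set0 & bounded_set Omega].

Definition closed_cube n : set 'rV[R]_n := [set t | forall i, 0 <= t ord0 i <= 1].
Definition open_cube n : set 'rV[R]_n := [set t | forall i, 0 < t ord0 i < 1].

Definition C1_on n N (V : set 'rV[R]_n) (X : 'rV[R]_n -> 'rV[R]_N) : Prop :=
  forall t, V t -> differentiable X t /\
    forall i, {for t, continuous (partial i X)}.

(** A parametrized C^1 patch: C^1 up to the boundary of the cube, injective and
    immersive inside; edges of the cube may be collapsed, so that, e.g., conical
    vertices are allowed. *)
Definition C1_patch n N (X : 'rV[R]_n -> 'rV[R]_N) : Prop :=
  [/\ exists V : set 'rV[R]_n, [/\ open V, @closed_cube n `<=` V & C1_on V X],
      forall s t, open_cube s -> open_cube t -> X s = X t -> s = t &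
      forall t, open_cube t -> row_free ('J X t)].

(** The boundary is a finite union of C^1 patches of dimension N - 1. *)
Definition piecewise_C1_boundary N (Omega : set 'rV[R]_N) : Prop :=
  exists (k : nat) (X : 'I_k -> 'rV[R]_N.-1 -> 'rV[R]_N),
    (forall j, C1_patch (X j)) /\
    closure Omega `\` Omega° = \bigcup_j (X j @` @closed_cube N.-1).

End domains.

Section sobolev.
Context {R : realType} {N : nat}.
Implicit Types (Omega : set 'rV[R]_N) (u v w f phi : 'rV[R]_N -> R)
  (U V G : 'rV[R]_N -> 'rV[R]_N) (p : R).

Local Notation mu := (lebesgue_rV N).

Definition iter_partial (s : seq 'I_N) phi : 'rV[R]_N -> R :=
  foldr (fun i g => partial i g) phi s.

Definition smooth phi : Prop :=
  forall s : seq 'I_N, continuous (iter_partial s phi) /\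
    forall (i : 'I_N) x, derivable (iter_partial s phi) x (delta_mx ord0 i).

Definition support phi : set 'rV[R]_N := closure [set x | phi x != 0].

Definition test_function Omega phi : Prop :=
  [/\ smooth phi, compact (support phi) & support phi `<=` Omega].

Definition grad phi (x : 'rV[R]_N) : 'rV[R]_N := \row_i partial i phi x.

Definition Lp_on Omega p u : Prop := u \_ Omega \in Lfun mu p%:E.

Definition Lp_norm Omega p u : \bar R := 'N[mu]_(p%:E)[EFin \o (u \_ Omega)].

Definition locally_integrable_on Omega u : Prop :=
  measurable_fun Omega u /\
  forall K, compact K -> K `<=` Omega -> mu.-integrable K (EFin \o u).

Definition is_weak_gradient Omega u G : Prop :=
  locally_integrable_on Omega u /\
  forall i : 'I_N, locally_integrable_on Omega (fun x => G x ord0 i) /\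
    forall phi, test_function Omega phi ->
      \int[mu]_(x in Omega) (u x * partial i phi x) =
      - \int[mu]_(x in Omega) (G x ord0 i * phi x).

(** A representative of the weak gradient of [u]; an arbitrary function if [u]
    is not weakly differentiable. *)
Definition wgrad Omega u : 'rV[R]_N -> 'rV[R]_N :=
  get [set G | is_weak_gradient Omega u G].

Definition W1p Omega p u : Prop :=
  Lp_on Omega p u /\
  exists2 G, is_weak_gradient Omega u G &
    forall i : 'I_N, Lp_on Omega p (fun x => G x ord0 i).

Definition W1p_norm Omega p u : \bar R :=
  (Lp_norm Omega p u +
   \sum_(i < N) Lp_norm Omega p (fun x => wgrad Omega u x ord0 i))%E.

Definition W01p Omega p u : Prop :=
  W1p Omega p u /\
  forall eps : R, 0 < eps -> exists2 phi, test_function Omega phi &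
    (W1p_norm Omega p (u \- phi)%R < eps%:E)%E.

Definition le_ae_on Omega u v : Prop :=
  {ae mu, forall x, Omega x -> u x <= v x}.

(** The integral over Omega of |U|^(p-2) U . V, where |0|^(p-2) 0 = 0. *)
Definition p_form Omega p U V : R :=
  \int[mu]_(x in Omega) dotrV (enorm (U x) `^ (p - 2) *: U x) (V x).

Definition superharmonic Omega p f u : Prop :=
  W01p Omega p u /\
  forall phi, test_function Omega phi -> (forall x, 0 <= phi x) ->
    \int[mu]_(x in Omega) (f x * phi x) <=
    p_form Omega p (wgrad Omega u) (grad phi).

Definition obstacle_set Omega p psi : set ('rV[R]_N -> R) :=
  [set v | W01p Omega p v /\ le_ae_on Omega psi v].

Definition solves_obstacle_problem Omega p f psi u : Prop :=
  obstacle_set Omega p psi u /\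
  forall v, obstacle_set Omega p psi v ->
    \int[mu]_(x in Omega) (f x * (v x - u x)) <=
    p_form Omega p (wgrad Omega u) (wgrad Omega (v \- u)).

Definition lowest_superharmonic_above Omega p f psi u : Prop :=
  [/\ superharmonic Omega p f u, le_ae_on Omega psi u &
      forall v, superharmonic Omega p f v -> le_ae_on Omega psi v ->
        le_ae_on Omega u v].

End sobolev.

(* Main.v *)
From HB Require Import structures.
Require Import Defs.
From mathcomp Require Import all_boot all_order all_algebra.
From mathcomp Require Import all_classical all_reals all_analysis.
From mathcomp Require Import measurable_realfun ring lra.

(** Write a(U, V) for the integral over Omega of |U|^(p-2) U . V.

    A solution u of the variational inequality is superharmonic, because
    v = u + phi is a competitor for every nonnegative test function phi.  It lies
    below every superharmonic v above the obstacle: min(u, v) = u - (u - v)^+ is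
    a competitor, which gives
    [a(grad u, grad (u - v)^+) <= int f (u - v)^+], while the superharmonicity of
    v, extended by density from nonnegative test functions to (u - v)^+, gives
    [int f (u - v)^+ <= a(grad v, grad (u - v)^+)].  The flux c |-> |c|^(p-2) c
    is strictly monotone ([pflux_monotone], [pflux_strict]), so that
    grad (u - v)^+ vanishes, and (u - v)^+ = 0 by the inequality of Poincare
    ([solution_le_superharmonic]).

    For the converse it is enough to have one solution w: by the first part w is
    lowest, two lowest functions are equal almost everywhere, and being a solution
    is invariant under modification on null sets ([solution_eq_ae]).  A solution is
    found by the direct method ([functional_minimizer], [minimizer_pairing]): the
    functional 1/p int |grad v|^p - int f v is coercive on the competitors by the
    inequalities of Young and Poincare; minimizing sequences are Cauchy by the
    uniform convexity of |.|^p ([uniform_convexity]); the limit is a minimizer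
    because |.|^p lies above its tangents ([pflux_tangent]); and the first
    variation at a minimizer is the variational inequality.

    The remaining parts build the space W_0^{1,p} in which this takes place.
    Distances are measured by the p-th power of the norm of L^p ([energy]), which
    is all that limits require.  An element of W_0^{1,p} is handled as a pair of a
    function and of a field which are limits of a test function and of its
    gradient ([Sob]); [W01pP] identifies these pairs with the given definition.
    It rests on the uniqueness of weak gradients ([weak_gradient_unique]), hence on
    the fundamental lemma of the calculus of variations, and on the integration by
    parts of test functions ([integral_by_parts]), which comes from the
    translation invariance of the measure.  The lattice operation (u - v)^+
    stays in W_0^{1,p} by composition with smooth approximations of the positive
    part ([Sob_pos]). *)

Set Implicit Arguments.
Unset Strict Implicit.
Unset Printing Implicit Defensive.

Import Order.TTheory GRing.Theory Num.Theory.
Import numFieldNormedType.Exports.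

Local Open Scope classical_set_scope.
Local Open Scope ring_scope.

(** * Integrals of real functions *)

Section real_integral.
Context d (T : measurableType d) (R : realType)
  (mu : {measure set T -> \bar R}) (D : set T) (mD : measurable D).
Implicit Types f g h : T -> R.

Local Notation Int f := (mu.-integrable D (EFin \o f)).
Local Notation I f := (\int[mu]_(x in D) f x).

Lemma integrable_measurable f : Int f -> measurable_fun D f.
Proof. by move=> /(measurable_int mu)/measurable_EFinP. Qed.

Lemma integrable_dominated f g : measurable_fun D f ->
  (forall x, D x -> `|f x| <= g x) -> Int g -> Int f.
Proof.
move=> mf fg; apply: le_integrable => //; first exact/measurable_EFinP.
by move=> x Dx /=; rewrite lee_fin (le_trans (fg _ Dx))// ler_norm.
Qed.

Lemma integrable_add f g : Int f -> Int g -> Int (fun x => f x + g x).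
Proof. by move=> fi gi; exact: (integrableD mD fi gi). Qed.

Lemma integrable_sub f g : Int f -> Int g -> Int (fun x => f x - g x).
Proof. by move=> fi gi; exact: (integrableB mD fi gi). Qed.

Lemma integrable_scale k f : Int f -> Int (fun x => k * f x).
Proof. by move=> fi; exact: (integrableZl mD k fi). Qed.

Lemma integrable_bigsum (J : Type) (s : seq J) (P : pred J) (F : J -> T -> R) :
  (forall j, P j -> Int (F j)) -> Int (fun x => \sum_(j <- s | P j) F j x).
Proof.
move=> iF.
rewrite (_ : _ \o _ = fun x => (\sum_(j <- s | P j) (EFin \o F j) x)%E).
  exact: integrable_sum.
by apply/funext => x /=; rewrite sumEFin.
Qed.

Lemma integrable_eq_ae f g : measurable_fun D g ->
  {ae mu, forall x, D x -> f x = g x} -> Int f -> Int g.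
Proof.
move=> mg fg fi; apply/integrableP; split; first exact/measurable_EFinP.
have mf := integrable_measurable fi.
case/integrableP: fi => _; congr (_ < _)%E.
apply: ge0_ae_eq_integral => //.
- by apply/measurable_EFinP; exact: measurableT_comp.
- by apply/measurable_EFinP; exact: measurableT_comp.
- by apply: filterS fg => x fg Dx /=; rewrite fg.
Qed.

Lemma Rintegral_eq_ae f g : measurable_fun D f -> measurable_fun D g ->
  {ae mu, forall x, D x -> f x = g x} -> I f = I g.
Proof.
move=> mf mg fg; congr fine; apply: ae_eq_integral => //.
- exact/measurable_EFinP.
- exact/measurable_EFinP.
- by apply: filterS fg => x fg Dx /=; rewrite fg.
Qed.

Lemma EFin_Rintegral f : Int f -> (I f)%:E = (\int[mu]_(x in D) (f x)%:E)%E.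
Proof. by move=> fi; rewrite fineK//; exact: integrable_fin_num. Qed.

Lemma integrable_ge0 f : measurable_fun D f -> (forall x, D x -> 0 <= f x) ->
  (\int[mu]_(x in D) (f x)%:E < +oo)%E -> Int f.
Proof.
move=> mf f0 foo; apply/integrableP; split; first exact/measurable_EFinP.
rewrite (eq_integral (fun x => (f x)%:E))// => x /set_mem Dx /=.
by rewrite ger0_norm// f0.
Qed.

Lemma Rintegral_dominated (F : nat -> T -> R) f g :
  (forall n, measurable_fun D (F n)) -> measurable_fun D f -> Int g ->
  (forall n x, D x -> `|F n x| <= g x) ->
  {ae mu, forall x, D x -> F n x @[n --> \oo] --> f x} ->
  I (F n) @[n --> \oo] --> I f.
Proof.
move=> mF mf gi Fg Ff.
have Ff' : \forall x \ae mu, D x -> (EFin \o F n) x @[n --> \oo] --> (EFin \o f) x.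
  apply: filterS Ff => x Ff Dx; apply: cvg_EFin; last exact: Ff.
  by near=> n.
have Fg' : \forall x \ae mu, forall n, D x -> (`|(EFin \o F n) x| <= (EFin \o g) x)%E.
  by apply: aeW => x n Dx /=; rewrite lee_fin; exact: Fg.
have [fi _ cv] := dominated_convergence mD
  (fun n => (measurable_EFinP _ _).2 (mF n)) ((measurable_EFinP _ _).2 mf)
  Ff' gi Fg'.
by apply: fine_cvg; rewrite fineK ?integrable_fin_num.
Unshelve. all: by end_near. Qed.

(** Strong limits in L^p are only identified almost everywhere along a
    subsequence; this bound transfers the distances of a Cauchy sequence to its
    pointwise limit. *)
Lemma Rintegral_fatou (F : nat -> T -> R) f c :
  (forall n, Int (F n)) -> (forall n x, D x -> 0 <= F n x) ->
  measurable_fun D f -> (forall x, D x -> 0 <= f x) ->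
  {ae mu, forall x, D x -> F n x @[n --> \oo] --> f x} ->
  (forall n, I (F n) <= c) -> Int f /\ I f <= c.
Proof.
move=> iF F0 mf f0 Ff Fc.
have mF n := integrable_measurable (iF n).
have le : (\int[mu]_(x in D) (f x)%:E <= c%:E)%E.
  have := fatou mu mD (fun n => (measurable_EFinP _ _).2 (mF n))
    (fun n x Dx => F0 n x Dx).
  rewrite (@ae_eq_integral _ T R mu D (EFin \o f)) => //; last 3 first.
  - rewrite (_ : (fun x => _) =
        -%E \o (fun x => limn_esup (fun n => - (F n x)%:E)))%E.
      apply: measurableT_comp => //; apply: measurable_fun_limn_esup => n.
      by apply: measurableT_comp => //; exact/measurable_EFinP.
    apply/funext => x /=.
    by rewrite (limn_esupN (fun n => (F n x)%:E)) oppeK.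
  - exact/measurable_EFinP.
  - apply: filterS Ff => x Ff Dx.
    rewrite /= is_cvg_limn_einfE; last first.
      apply/cvg_ex; exists (f x)%:E; apply: cvg_EFin; last exact: Ff.
      by near=> n.
    apply/cvg_lim => //; apply: cvg_EFin; last exact: Ff.
    by near=> n.
  move=> /le_trans; apply.
  rewrite limn_einf_lim; apply: lime_le; first exact: is_cvg_einfs.
  near=> n; apply: (@le_trans _ _ (\int[mu]_(x in D) (F n x)%:E)%E).
    by apply: ge_ereal_inf; exists (\int[mu]_(x in D) (F n x)%:E)%E => //; exists n => /=.
  by rewrite -EFin_Rintegral// lee_fin.
have fi : Int f by apply: integrable_ge0 => //; exact: le_lt_trans le (ltry c).
by split=> //; rewrite -lee_fin EFin_Rintegral.
Unshelve. all: by end_near. Qed.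

(** The source of all almost everywhere convergences below: the sum of the F n
    has a finite integral, hence is finite almost everywhere, and it bounds each
    of its terms. *)
Lemma Rintegral_fast_bounded (F : nat -> T -> R) :
  (forall n, Int (F n)) -> (forall n x, D x -> 0 <= F n x) ->
  (forall n, I (F n) <= 2^-1 ^+ n) ->
  {ae mu, forall x, D x -> exists c, forall n, F n x <= c}.
Proof.
move=> iF F0 Fc; have mF n := integrable_measurable (iF n).
pose S x := (\sum_(0 <= n <oo) (F n x)%:E)%E.
have mS : measurable_fun D S.
  have := @ge0_emeasurable_sum _ T R D (fun n => EFin \o F n) predT.
  apply; first by move=> k x Dx _; rewrite /= lee_fin F0.
  by move=> k _; exact/measurable_EFinP.
have S0 x : D x -> (0 <= S x)%E.
  by move=> Dx; apply: nneseries_ge0 => n _ _; rewrite lee_fin F0.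
have iS : mu.-integrable D S.
  apply/integrableP; split => //.
  rewrite (eq_integral S) => [|x /set_mem Dx]; last by rewrite gee0_abs// S0.
  rewrite integral_nneseries//=; last by move=> n; exact/measurable_EFinP.
  apply: (@le_lt_trans _ _ 2%:E); last exact: ltry.
  apply: lime_le.
    apply: is_cvg_nneseries => n _ _; apply: integral_ge0 => x Dx.
    by rewrite lee_fin F0.
  near=> n.
  rewrite (eq_bigr (fun k => (I (F k))%:E)); last first.
    by move=> k _; rewrite EFin_Rintegral.
  rewrite sumEFin lee_fin.
  have : \sum_(0 <= k < n) (2^-1 : R) ^+ k <= 2.
    have -> : \sum_(0 <= k < n) (2^-1 : R) ^+ k = 2 - 2 * 2^-1 ^+ n.
      elim: {+}n => [|m IH]; first by rewrite big_nil expr0 mulr1 subrr.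
      by rewrite big_nat_recr//= IH exprS; lra.
    by rewrite lerBlDr lerDl mulr_ge0// exprn_ge0.
  by apply: le_trans; apply: ler_sum.
have := integrable_ae mD iS; apply: filterS => x fx Dx.
exists (fine (S x)) => n.
rewrite -lee_fin fineK ?fx//.
have := @nneseries_lim_ge R (fun n => (F n x)%:E) xpredT 0 n.+1.
rewrite big_nat_recr//=.
move=> /(_ (fun n _ _ => F0 n x Dx)); apply: le_trans.
by rewrite leeDr// sume_ge0// => k _; rewrite lee_fin F0.
Unshelve. all: by end_near. Qed.

Lemma Rintegral_eq0 f : Int f -> (forall x, D x -> 0 <= f x) -> I f <= 0 ->
  {ae mu, forall x, D x -> f x = 0}.
Proof.
move=> fi f0 fle; have mf := integrable_measurable fi.
have : (\int[mu]_(x in D) `|(f x)%:E| = 0)%E.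
  rewrite (eq_integral (EFin \o f)) => [|x /set_mem Dx]; last first.
    by rewrite /= ger0_norm// f0.
  by rewrite -EFin_Rintegral//; congr EFin; apply/eqP; rewrite eq_le fle Rintegral_ge0.
move/(@ae_eq_integral_abs _ T R mu D mD (EFin \o f) ((measurable_EFinP _ _).2 mf)).
by apply: filterS => x + Dx => /(_ Dx) [].
Qed.

Lemma le_Rintegral_ae f g : Int f -> Int g ->
  {ae mu, forall x, D x -> f x <= g x} -> I f <= I g.
Proof.
move=> fi gi fg; rewrite -subr_ge0 -RintegralB//.
have mf := integrable_measurable fi; have mg := integrable_measurable gi.
rewrite (@Rintegral_eq_ae _ (fun x => Num.max 0 (g x - f x))).
- by apply: Rintegral_ge0 => x _; rewrite le_max lexx.
- exact: measurable_funB.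
- by apply: measurable_maxr => //; exact: measurable_funB.
- by apply: filterS fg => x fg Dx; rewrite max_r// subr_ge0 fg.
Qed.

End real_integral.

(** * Lebesgue spaces and powers *)

Section powR_lemmas.
Context {R : realType}.
Implicit Types a b p q s : R.

Lemma powR_le p a b : 0 <= p -> 0 <= a -> a <= b -> a `^ p <= b `^ p.
Proof. by move=> p0 a0 ab; apply: ge0_ler_powR; rewrite ?nnegrE// (le_trans a0). Qed.

(** Comparison of a + b with twice the larger of the two.  The constant is not
    sharp, but this form holds for every positive exponent and makes [energy] a
    quasi-metric. *)
Lemma powR_addle p a b : 0 < p -> 0 <= a -> 0 <= b ->
  (a + b) `^ p <= 2 `^ p * (a `^ p + b `^ p).
Proof.
move=> p0; wlog ab : a b / a <= b => [H a0 b0|a0 b0].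
  have [ab|/ltW ba] := leP a b; first exact: H.
  by rewrite addrC (addrC (a `^ p)); exact: H.
apply: (@le_trans _ _ ((2 * b) `^ p)).
  by apply: powR_le; [exact: ltW|exact: addr_ge0|lra].
by rewrite powRM// ler_wpM2l ?powR_ge0// lerDr powR_ge0.
Qed.

(** The inequality of Young applied to l a and b / l, where l is chosen so that
    the weight of a^q is s. *)
Lemma young_small p q s : 0 < p -> 0 < q -> p^-1 + q^-1 = 1 -> 0 < s ->
  exists2 c, 0 <= c & forall a b, 0 <= a -> 0 <= b ->
    a * b <= s * a `^ q + c * b `^ p.
Proof.
move=> p0 q0 pq s0; pose l := (s * q) `^ q^-1.
have l0 : 0 < l by rewrite powR_gt0// mulr_gt0.
exists (l^-1 `^ p / p) => [|a b a0 b0].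
  by rewrite divr_ge0 ?powR_ge0// ltW.
have := @conjugate_powR R (l * a) (l^-1 * b) q p.
rewrite mulrACA divff ?gt_eqF// mul1r.
move=> /(_ _ _ q0 p0) H; apply: le_trans (H _ _ _) _.
- by rewrite mulr_ge0// ltW.
- by rewrite mulr_ge0// invr_ge0 ltW.
- by rewrite addrC.
rewrite !powRM ?invr_ge0//; try exact: ltW.
rewrite lerD//; last by rewrite mulrAC.
rewrite /l -powRrM mulVf ?gt_eqF// powRr1; last by rewrite mulr_ge0 ?ltW.
by rewrite mulrAC mulfK ?gt_eqF.
Qed.

Lemma conjugate_exists p : 1 < p ->
  exists q, [/\ 0 < q, p^-1 + q^-1 = 1 & (p - 1) * q = p].
Proof.
move=> p1; have p0 : 0 < p by exact: lt_trans p1.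
have p10 : 0 < p - 1 by rewrite subr_gt0.
exists (p / (p - 1)); split; first exact: divr_gt0.
  by rewrite invf_div -[X in X + _]mul1r -mulrDl addrC subrK divff ?gt_eqF.
by rewrite mulrC divfK ?gt_eqF.
Qed.

End powR_lemmas.

Section Lp.
Context d (T : measurableType d) (R : realType)
  (mu : {measure set T -> \bar R}) (D : set T).
Implicit Types (f g h : T -> R) (p q : R).

Definition Lp p f :=
  measurable_fun D f /\ mu.-integrable D (EFin \o (fun x => `|f x| `^ p)).

(** The p-th power of the norm of L^p: it is additive with respect to the
    integrand, so that estimates on it are estimates under the integral. *)
Definition energy p f := \int[mu]_(x in D) (`|f x| `^ p).

Hypothesis mD : measurable D.

Lemma energy_ge0 p f : 0 <= energy p f.
Proof. by apply: Rintegral_ge0 => x _; exact: powR_ge0. Qed.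

Lemma measurable_powabs p f : measurable_fun D f ->
  measurable_fun D (fun x => `|f x| `^ p).
Proof.
move=> mf; have mf' : measurable_fun D (Num.norm \o f) by exact: measurableT_comp.
exact: (measurableT_comp (measurable_powR p) mf').
Qed.

Lemma Lp_dominated p f g : 0 < p -> measurable_fun D f -> Lp p g ->
  (forall x, D x -> `|f x| <= `|g x|) -> Lp p f.
Proof.
move=> p0 mf [mg ig] fg; split => //.
apply: integrable_dominated ig => //; first exact: measurable_powabs.
move=> x Dx; rewrite ger0_norm ?powR_ge0//.
by apply: powR_le => //; [exact: ltW|exact: fg].
Qed.

Lemma energy_le p f g : 0 < p -> Lp p f -> Lp p g ->
  {ae mu, forall x, D x -> `|f x| <= `|g x|} -> energy p f <= energy p g.
Proof.
move=> p0 [mf fi] [mg gi] fg; apply: le_Rintegral_ae => //.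
apply: filterS fg => x fg Dx; apply: powR_le => //; [exact: ltW|exact: fg].
Qed.

Lemma energy_eq_ae p f g : measurable_fun D f -> measurable_fun D g ->
  {ae mu, forall x, D x -> f x = g x} -> energy p f = energy p g.
Proof.
move=> mf mg fg; apply: Rintegral_eq_ae => //; try exact: measurable_powabs.
by apply: filterS fg => x fg Dx; rewrite fg.
Qed.

Lemma Lp_eq_ae p f g : measurable_fun D g ->
  {ae mu, forall x, D x -> f x = g x} -> Lp p f -> Lp p g.
Proof.
move=> mg fg [mf fi]; split => //; apply: integrable_eq_ae fi => //.
  exact: measurable_powabs.
by apply: filterS fg => x fg Dx; rewrite fg.
Qed.

Lemma LpZ p k f : 0 < p -> Lp p f -> Lp p (fun x => k * f x).
Proof.
move=> p0 [mf fi]; split; first exact: measurable_funM.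
rewrite (_ : EFin \o _ = EFin \o (fun x => `|k| `^ p * `|f x| `^ p)).
  exact: integrable_scale.
by apply/funext => x /=; rewrite normrM powRM.
Qed.

Lemma energyZ p k f : 0 < p -> Lp p f ->
  energy p (fun x => k * f x) = `|k| `^ p * energy p f.
Proof.
move=> p0 [mf fi]; rewrite /energy -RintegralZl//; apply: eq_Rintegral => x _.
by rewrite normrM powRM.
Qed.

Lemma LpN p f : 0 < p -> Lp p f -> Lp p (fun x => - f x).
Proof.
by move=> p0 /(LpZ (-1) p0); under eq_fun do rewrite mulN1r.
Qed.

Lemma powR_sum_le p f g x : 0 < p ->
  `|f x + g x| `^ p <= 2 `^ p * (`|f x| `^ p + `|g x| `^ p).
Proof.
move=> p0; apply: le_trans (powR_addle p0 _ _) => //.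
by apply: powR_le => //; [exact: ltW|exact: ler_normD].
Qed.

Lemma LpD p f g : 0 < p -> Lp p f -> Lp p g -> Lp p (fun x => f x + g x).
Proof.
move=> p0 [mf fi] [mg gi]; have mfg := measurable_funD mf mg; split => //.
have := integrable_scale mD (2 `^ p) (integrable_add mD fi gi).
apply: integrable_dominated => //; first exact: measurable_powabs.
by move=> x Dx; rewrite ger0_norm ?powR_ge0//; exact: powR_sum_le.
Qed.

Lemma LpB p f g : 0 < p -> Lp p f -> Lp p g -> Lp p (fun x => f x - g x).
Proof. by move=> p0 fp gp; apply: LpD => //; exact: LpN. Qed.

Lemma energyD p f g : 0 < p -> Lp p f -> Lp p g ->
  energy p (fun x => f x + g x) <= 2 `^ p * (energy p f + energy p g).
Proof.
move=> p0 [mf fi] [mg gi]; rewrite /energy -RintegralD// -RintegralZl//; last first.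
  exact: integrable_add.
apply: le_Rintegral => //; first exact: (LpD p0 _ _).2.
  by apply: integrable_scale => //; exact: integrable_add.
by move=> x Dx; exact: powR_sum_le.
Qed.

Lemma energyBC p f g : energy p (fun x => f x - g x) = energy p (fun x => g x - f x).
Proof. by apply: eq_Rintegral => x _; rewrite distrC. Qed.

Lemma energy_tri p f g h : 0 < p -> Lp p f -> Lp p g -> Lp p h ->
  energy p (fun x => f x - h x) <=
  2 `^ p * (energy p (fun x => f x - g x) + energy p (fun x => g x - h x)).
Proof.
move=> p0 fp gp hp; apply: le_trans (energyD p0 (LpB p0 fp gp) (LpB p0 gp hp)).
rewrite le_eqVlt; apply/orP; left; apply/eqP; apply: eq_Rintegral => x _.
by rewrite addrA subrK.
Qed.

Lemma Lp_mul p q f g : 0 < p -> 0 < q -> p^-1 + q^-1 = 1 ->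
  Lp q f -> Lp p g -> mu.-integrable D (EFin \o (fun x => f x * g x)).
Proof.
move=> p0 q0 pq [mf fi] [mg gi].
have [c c0 H] := young_small p0 q0 pq ltr01.
apply: (integrable_dominated mD (measurable_funM mf mg)) (integrable_add mD fi (integrable_scale mD c gi)).
by move=> x Dx; rewrite normrM; apply: le_trans (H _ _ _ _) _ => //; rewrite mul1r.
Qed.

(** Replaces the inequality of Hoelder: the weight s can be taken small, which
    is how boundedness, coercivity and continuity of pairings are all obtained. *)
Lemma young_Rintegral p q s : 0 < p -> 0 < q -> p^-1 + q^-1 = 1 -> 0 < s ->
  exists2 c, 0 <= c & forall f g, Lp q f -> Lp p g ->
  `|\int[mu]_(x in D) (f x * g x)| <= s * energy q f + c * energy p g.
Proof.
move=> p0 q0 pq s0; have [c c0 H] := young_small p0 q0 pq s0.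
exists c => // f g fq gp; have fgi := Lp_mul p0 q0 pq fq gp.
apply: le_trans (le_normr_Rintegral mD fgi) _.
case: fq gp => mf fi [mg gi].
rewrite /energy -!RintegralZl// -RintegralD//; try exact: integrable_scale.
apply: le_Rintegral => //.
- exact: integrable_norm.
- by apply: integrable_add => //; exact: integrable_scale.
- by move=> x Dx; rewrite normrM H.
Qed.

Lemma energy_eq0 p f : 0 < p -> Lp p f -> energy p f <= 0 ->
  {ae mu, forall x, D x -> f x = 0}.
Proof.
move=> p0 [mf fi] e0.
have := Rintegral_eq0 mD fi (fun x _ => powR_ge0 _ _) e0.
apply: filterS => x + Dx => /(_ Dx) /eqP; rewrite powR_eq0 => /andP[/eqP].
by move/normr0_eq0.
Qed.

Lemma energy0 p : p != 0 -> energy p (fun=> 0) = 0.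
Proof.
move=> p0; rewrite /energy.
under eq_Rintegral do rewrite normr0 powR0//.
by rewrite /Rintegral integral0_eq.
Qed.

Lemma energy_subrr p f : p != 0 -> energy p (fun x => f x - f x) = 0.
Proof.
move=> p0; rewrite (_ : (fun x => f x - f x) = fun=> 0) ?energy0//.
by apply/funext => x; rewrite subrr.
Qed.

Lemma energy_eq0_ae p f g : p != 0 -> measurable_fun D f -> measurable_fun D g ->
  {ae mu, forall x, D x -> f x = g x} -> energy p (fun x => f x - g x) = 0.
Proof.
move=> p0 mf mg fg; rewrite -(energy_subrr g p0); apply: energy_eq_ae.
- exact: measurable_funB.
- exact: measurable_funB.
- by apply: filterS fg => x fg Dx; rewrite fg.
Qed.

End Lp.

(** * Completeness of Lebesgue spaces *)

(** At 0 the power is not differentiable when p <= 1, and the continuity is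
    checked by hand. *)
Lemma continuous_abs_powR (R : realType) (p : R) : 0 < p ->
  continuous (fun t : R => `|t| `^ p).
Proof.
move=> p0 t; have [->|t0] := eqVneq t 0.
  rewrite /prop_for /continuous_at normr0 powR0 ?gt_eqF//.
  apply/cvgrPdist_le => e e0.
  have small : \forall x \near (0 : R), `|x| < e `^ p^-1.
    by apply: nbhs0_lt; exact: powR_gt0.
  near=> x.
  rewrite sub0r normrN ger0_norm ?powR_ge0//.
  have -> : e = (e `^ p^-1) `^ p by rewrite -powRrM mulVf ?gt_eqF// powRr1 ?ltW.
  apply: powR_le => //; first exact: ltW.
  rewrite ltW//; near: x.
  exact: small.
apply: (@continuous_cvg _ _ _ _ _ _ (fun s : R => s `^ p)); last exact: norm_continuous.
apply: differentiable_continuous; apply/derivable1_diffP.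
by apply: derivable_powR; rewrite in_itv/= andbT normr_gt0.
Unshelve. all: by end_near. Qed.

Section Lp_complete.
Context d (T : measurableType d) (R : realType)
  (mu : {measure set T -> \bar R}) (D : set T) (mD : measurable D).
Implicit Types (f g h : T -> R) (p q : R).

Local Notation Lp := (Lp mu D).
Local Notation energy := (energy mu D).

(** The increments are so small in L^p that 2^n |v (n+1) - v n| is bounded
    almost everywhere, and the telescoping series converges geometrically. *)
Lemma fast_cvg p (v : nat -> T -> R) : 0 < p -> (forall n, Lp p (v n)) ->
  (forall n, energy p (fun x => v n.+1 x - v n x) <= 2^-1 ^+ n * ((2 ^+ n) `^ p)^-1) ->
  {ae mu, forall x, D x -> cvgn (fun n => v n x)}.
Proof.
move=> p0 vp ev; pose w n x := 2 ^+ n * (v n.+1 x - v n x).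
have wp n : Lp p (w n) by apply: LpZ => //; exact: LpB.
have := @Rintegral_fast_bounded _ _ _ mu D mD (fun n x => `|w n x| `^ p).
move=> /(_ (fun n => (wp n).2) (fun n x _ => powR_ge0 _ _)).
have H n : \int[mu]_(x in D) `|w n x| `^ p <= 2^-1 ^+ n.
  have := energyZ mD (2 ^+ n) p0 (LpB mD p0 (vp n.+1) (vp n)).
  rewrite /energy => ->; rewrite ger0_norm ?exprn_ge0//.
  rewrite mulrC -ler_pdivlMr ?powR_gt0 ?exprn_gt0//; exact: ev.
move=> /(_ H); apply: filterS => x + Dx => /(_ Dx) [c wc].
pose c' := `|c| `^ p^-1.
have wc' n : `|v n.+1 x - v n x| <= c' * 2^-1 ^+ n.
  rewrite exprVn -ler_pdivrMr ?invr_gt0 ?exprn_gt0// invrK mulrC.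
  rewrite -[X in X * _](@ger0_norm _ (2 ^+ n)) ?exprn_ge0// -normrM.
  have -> : `|2 ^+ n * (v n.+1 x - v n x)| = (`|w n x| `^ p) `^ p^-1.
    by rewrite -powRrM mulfV ?gt_eqF// powRr1.
  apply: powR_le; rewrite ?invr_ge0 ?powR_ge0 ?(ltW p0)//.
  exact: le_trans (wc n) (ler_norm _).
have cs : cvgn (series (fun n => v n.+1 x - v n x)).
  apply: normed_cvg; apply: (@series_le_cvg _ _ (geometric c' 2^-1)).
  - by move=> n; exact: normr_ge0.
  - by move=> n; rewrite /geometric/= mulr_ge0 ?powR_ge0 ?exprn_ge0.
  - by move=> n; exact: wc'.
  - apply: is_cvg_geometric_series; rewrite ger0_norm//; lra.
have -> : (fun n => v n x) = (fun n => v 0%N x + series (fun n => v n.+1 x - v n x) n).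
  by apply/funext => n; rewrite /series/= telescope_sumr// addrC subrK.
by apply: is_cvgD => //; exact: is_cvg_cst.
Qed.

(** A subsequence with fast decreasing increments converges almost everywhere;
    the lemma of Fatou bounds its distance to the terms of the sequence. *)
Lemma Lp_complete p (v : nat -> T -> R) : 0 < p -> (forall n, Lp p (v n)) ->
  (forall e, 0 < e -> exists n0, forall m n, (n0 <= m)%N -> (n0 <= n)%N ->
    energy p (fun x => v m x - v n x) <= e) ->
  exists2 w, Lp p w & forall e, 0 < e -> exists n0, forall n, (n0 <= n)%N ->
    energy p (fun x => w x - v n x) <= e.
Proof.
move=> p0 vp cauchy.
pose eps n : R := 2^-1 ^+ n * ((2 ^+ n) `^ p)^-1.
have eps0 n : 0 < eps n by rewrite mulr_gt0 ?exprn_gt0// invr_gt0 powR_gt0// exprn_gt0.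
have /choice[k kP] : forall j, exists n0, forall m n, (n0 <= m)%N -> (n0 <= n)%N ->
    energy p (fun x => v m x - v n x) <= eps j by move=> j; exact: cauchy.
(* Indices beyond k 0, ..., k j that increase with j. *)
pose K j := (\sum_(i < j.+1) (k i).+1)%N.
have kK j : (k j <= K j)%N by rewrite /K big_ord_recr/= (leq_trans (leqnSn _))// leq_addl.
have KS j : (K j <= K j.+1)%N by rewrite {2}/K big_ord_recr/= leq_addr.
have jK j : (j <= K j)%N.
  elim: j => // j IH; rewrite /K big_ord_recr/= addnS ltnS.
  exact: leq_trans IH (leq_addr _ _).
have cv := @fast_cvg p (fun j => v (K j)) p0 (fun j => vp _)
  (fun j => kP j _ _ (leq_trans (kK j) (KS j)) (kK j)).
(* An upper limit is measurable, and is the limit wherever the latter exists. *)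
pose w x := fine (limn_esup (fun j => (v (K j) x)%:E)).
have mw : measurable_fun D w.
  apply: measurableT_comp => //; apply: measurable_fun_limn_esup => j.
  by apply/measurable_EFinP; case: (vp (K j)).
have vw : {ae mu, forall x, D x -> v (K n) x @[n --> \oo] --> w x}.
  apply: filterS cv => x + Dx => /(_ Dx) /cvg_ex[l vl].
  suff -> : w x = l by [].
  have E : (fun j => (v (K j) x)%:E) @ \oo --> l%:E.
    by apply: cvg_EFin => //; near=> j.
  rewrite /w is_cvg_limn_esupE; last by apply/cvg_ex; exists l%:E.
  by rewrite (cvg_lim _ E).
have fat e : 0 < e -> exists n0, forall n, (n0 <= n)%N ->
    Lp p (fun x => w x - v n x) /\ energy p (fun x => w x - v n x) <= e.
  move=> /cauchy[n0 n0P]; exists n0 => n n0n.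
  have mwn : measurable_fun D (fun x => w x - v n x).
    by apply: measurable_funB => //; case: (vp n).
  suff [] : mu.-integrable D (EFin \o (fun x => `|w x - v n x| `^ p)) /\
      energy p (fun x => w x - v n x) <= e by [].
  apply: (@Rintegral_fatou _ _ _ mu D mD
      (fun j x => `|v (K (j + n0)%N) x - v n x| `^ p)).
  - by move=> j; case: (LpB mD p0 (vp (K (j + n0)%N)) (vp n)).
  - by move=> j x _; exact: powR_ge0.
  - exact: measurable_powabs.
  - by move=> x _; exact: powR_ge0.
  - apply: filterS vw => x + Dx => /(_ Dx) vw.
    apply: (@continuous_cvg _ _ _ _ _ _ (fun t => `|t| `^ p)).
      exact: continuous_abs_powR.
    apply: cvgB; last exact: cvg_cst.
    by have := vw; rewrite -(cvg_shiftn n0).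
  - move=> j; apply: n0P => //; apply: leq_trans (jK _); exact: leq_addl.
exists w.
  have [n0 /(_ n0 (leqnn _)) [wv _]] := fat _ ltr01.
  have := LpD mD p0 wv (vp n0); apply: Lp_eq_ae => //.
  by apply: aeW => x _; rewrite subrK.
move=> e /fat[n0 H]; exists n0 => n /H[].
by [].
Unshelve. all: by end_near. Qed.

(** The negative part of g - f is dominated by |g - h| for every h above f. *)
Lemma le_ae_closed p f g : 0 < p -> Lp p f -> Lp p g ->
  (forall e, 0 < e -> exists h, [/\ Lp p h,
     {ae mu, forall x, D x -> f x <= h x} & energy p (fun x => g x - h x) <= e]) ->
  {ae mu, forall x, D x -> f x <= g x}.
Proof.
move=> p0 fp gp H; pose k x := Num.max (f x - g x) 0.
have kp : Lp p k.
  apply: Lp_dominated (LpB mD p0 fp gp) _ => //.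
    apply: measurable_maxr => //.
    by apply: measurable_funB; [case: fp|case: gp].
  move=> x _; rewrite /k; case: (leP (f x - g x) 0) => // _.
  by rewrite normr0.
suff : {ae mu, forall x, D x -> k x = 0}.
  apply: filterS => x + Dx => /(_ Dx) kx.
  by rewrite -subr_le0 -kx /k le_max lexx.
apply: (energy_eq0 mD p0 kp).
(* Otherwise half of the energy of (f - g)^+ would bound it. *)
rewrite leNgt; apply/negP => e0.
have [h [hp fh gh]] := H (energy p k / 2) (divr_gt0 e0 (ltr0Sn _ _)).
suff : energy p k <= energy p k / 2 by lra.
apply: le_trans gh; apply: energy_le => //; first exact: LpB.
apply: filterS fh => x + Dx => /(_ Dx) fh.
rewrite /k; case: (leP (f x - g x) 0) => [_|fg].
  by rewrite normr0.
rewrite gtr0_norm// distrC ger0_norm; lra.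
Qed.

End Lp_complete.

(** * The flux of the p-Laplacian *)

Section euclidean_geometry.
Context {R : realType} {N : nat}.
Implicit Types (x y z : 'rV[R]_N) (k : R).

Lemma dotrVC x y : dotrV x y = dotrV y x.
Proof. by apply: eq_bigr => i _; rewrite mulrC. Qed.

Lemma dotrVDr x y z : dotrV x (y + z) = dotrV x y + dotrV x z.
Proof. by rewrite -big_split; apply: eq_bigr => i _; rewrite /= mxE mulrDr. Qed.

Lemma dotrVZr k x y : dotrV x (k *: y) = k * dotrV x y.
Proof. by rewrite mulr_sumr; apply: eq_bigr => i _; rewrite mxE mulrCA. Qed.

Lemma dotrVDl x y z : dotrV (x + y) z = dotrV x z + dotrV y z.
Proof. by rewrite dotrVC dotrVDr !(dotrVC z). Qed.

Lemma dotrVZl k x y : dotrV (k *: x) y = k * dotrV x y.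
Proof. by rewrite dotrVC dotrVZr dotrVC. Qed.

Lemma dotrVNr x y : dotrV x (- y) = - dotrV x y.
Proof. by rewrite -scaleN1r dotrVZr mulN1r. Qed.

Lemma dotrVNl x y : dotrV (- x) y = - dotrV x y.
Proof. by rewrite dotrVC dotrVNr dotrVC. Qed.

Lemma dotrVBr x y z : dotrV x (y - z) = dotrV x y - dotrV x z.
Proof. by rewrite dotrVDr dotrVNr. Qed.

Lemma dotrVBl x y z : dotrV (x - y) z = dotrV x z - dotrV y z.
Proof. by rewrite dotrVDl dotrVNl. Qed.

Lemma dotrV0 x : dotrV x 0 = 0.
Proof. by rewrite -(scale0r 0) dotrVZr mul0r. Qed.

Lemma dotrV_ge0 x : 0 <= dotrV x x.
Proof. by apply: sumr_ge0 => i _; rewrite -expr2 sqr_ge0. Qed.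

Lemma enorm_ge0 x : 0 <= enorm x. Proof. exact: sqrtr_ge0. Qed.

Lemma enorm_sqr x : enorm x * enorm x = dotrV x x.
Proof. by rewrite -expr2 sqr_sqrtr// dotrV_ge0. Qed.

Lemma enorm_coord x i : `|x ord0 i| <= enorm x.
Proof.
rewrite -sqrtr_sqr ler_sqrt ?dotrV_ge0// /dotrV (bigD1 i)//= expr2 lerDl.
by apply: sumr_ge0 => j _; rewrite -expr2 sqr_ge0.
Qed.

Lemma enorm_eq0 x : (enorm x == 0) = (x == 0).
Proof.
apply/eqP/eqP => [x0|->].
  apply/rowP => i; rewrite mxE; apply/normr0_eq0/eqP.
  by rewrite eq_le normr_ge0 -x0 enorm_coord.
by rewrite /enorm dotrV0 sqrtr0.
Qed.

Lemma enorm0 : enorm (0 : 'rV[R]_N) = 0.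
Proof. by apply/eqP; rewrite enorm_eq0. Qed.

Lemma enorm_gt0 x : (0 < enorm x) = (x != 0).
Proof. by rewrite lt_def enorm_ge0 andbT enorm_eq0. Qed.

Lemma enormZ k x : enorm (k *: x) = `|k| * enorm x.
Proof.
by rewrite /enorm dotrVZl dotrVZr mulrA -expr2 sqrtrM ?sqr_ge0// sqrtr_sqr.
Qed.

Lemma enormN x : enorm (- x) = enorm x.
Proof. by rewrite -scaleN1r enormZ normrN1 mul1r. Qed.

(** The Cauchy-Schwarz inequality, from the nonnegativity of the square norm of
    |y| x - |x| y. *)
Lemma dotrV_le x y : dotrV x y <= enorm x * enorm y.
Proof.
have [->|x0] := eqVneq x 0; first by rewrite dotrVC dotrV0 mulr_ge0 ?enorm_ge0.
have [->|y0] := eqVneq y 0; first by rewrite dotrV0 mulr_ge0 ?enorm_ge0.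
have := dotrV_ge0 (enorm y *: x - enorm x *: y).
rewrite !(dotrVBl, dotrVBr, dotrVZl, dotrVZr) -!enorm_sqr (dotrVC y x).
have a0 : 0 < enorm x by rewrite enorm_gt0.
have b0 : 0 < enorm y by rewrite enorm_gt0.
move: (enorm x) (enorm y) (dotrV x y) a0 b0 => a b c a0 b0.
move=> H; have : 0 <= (a * b) * (2 * (a * b - c)) by lra.
by rewrite pmulr_rge0 ?mulr_gt0//; lra.
Qed.

Lemma normr_dotrV_le x y : `|dotrV x y| <= enorm x * enorm y.
Proof.
by rewrite ler_norml dotrV_le andbT lerNl -dotrVNl -(enormN x) dotrV_le.
Qed.

Lemma enormD x y : enorm (x + y) <= enorm x + enorm y.
Proof.
rewrite -(@ler_pXn2r _ 2)// ?nnegrE ?addr_ge0 ?enorm_ge0//.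
rewrite !expr2 enorm_sqr !(dotrVDl, dotrVDr) -!enorm_sqr (dotrVC y x).
have := dotrV_le x y; nra.
Qed.

Lemma enorm_le_sum x : enorm x <= \sum_(i < N) `|x ord0 i|.
Proof.
rewrite -(@ler_pXn2r _ 2)// ?nnegrE ?enorm_ge0//; last exact: sumr_ge0.
rewrite !expr2 enorm_sqr /dotrV mulr_suml; apply: ler_sum => i _.
apply: (le_trans (ler_norm _)); rewrite normrM ler_wpM2l//.
by rewrite (bigD1 i)//= lerDl sumr_ge0.
Qed.

Lemma continuous_dotrV (T : topologicalType) (f g : T -> 'rV[R]_N) :
  continuous f -> continuous g -> continuous (fun t => dotrV (f t) (g t)).
Proof.
move=> cf cg; apply: continuous_big => [|i _]; first exact: add_continuous.
move=> t; apply: cvgM.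
  apply: (@continuous_cvg _ _ _ _ _ _ (fun M : 'rV[R]_N => M ord0 i) _ _ (cf t)).
  exact: coord_continuous.
apply: (@continuous_cvg _ _ _ _ _ _ (fun M : 'rV[R]_N => M ord0 i) _ _ (cg t)).
exact: coord_continuous.
Qed.

Lemma continuous_enorm (T : topologicalType) (f : T -> 'rV[R]_N) :
  continuous f -> continuous (fun t => enorm (f t)).
Proof.
move=> cf t; apply: (@continuous_cvg _ _ _ _ _ _ Num.sqrt).
  exact: sqrt_continuous.
exact: continuous_dotrV.
Qed.

Lemma continuous_enorm_powR (T : topologicalType) (f : T -> 'rV[R]_N) p :
  0 < p -> continuous f -> continuous (fun t => enorm (f t) `^ p).
Proof.
move=> p0 cf.
rewrite (_ : (fun _ => _) = (fun t => `|enorm (f t)| `^ p)); last first.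
  by apply/funext => t; rewrite ger0_norm ?enorm_ge0.
move=> t; apply: (@continuous_cvg _ _ _ _ _ _ (fun s : R => `|s| `^ p)).
  exact: continuous_abs_powR.
exact: continuous_enorm.
Qed.

End euclidean_geometry.

Section p_flux.
Context {R : realType} {N : nat} (p : R) (p1 : 1 < p).
Implicit Types (a b c : 'rV[R]_N).

Let p0 : 0 < p. Proof. exact: lt_trans p1. Qed.

(** The nonlinearity of the p-Laplacian; it is the gradient of |c|^p / p. *)
Definition pflux c : 'rV[R]_N := enorm c `^ (p - 2) *: c.

Lemma pflux0 : pflux 0 = 0. Proof. exact: scaler0. Qed.

Lemma enorm_pflux c : enorm (pflux c) = enorm c `^ (p - 1).
Proof.
rewrite enormZ ger0_norm ?powR_ge0//.
have [->|c0] := eqVneq c 0.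
  by rewrite enorm0 mulr0 powR0// subr_eq0 gt_eqF.
rewrite -[X in _ * X]powRr1 ?enorm_ge0// -powRD; last first.
  by apply/implyP => _; rewrite enorm_eq0.
by congr powR; lra.
Qed.

Lemma dotrV_pflux_le c b : `|dotrV (pflux c) b| <= enorm c `^ (p - 1) * enorm b.
Proof. by rewrite -enorm_pflux normr_dotrV_le. Qed.

Lemma dotrV_pflux_self c : dotrV (pflux c) c = enorm c `^ p.
Proof.
rewrite dotrVZl -enorm_sqr.
have [->|c0] := eqVneq c 0.
  by rewrite enorm0 !mulr0 powR0 ?gt_eqF.
rewrite -{2 3}[enorm c]powRr1 ?enorm_ge0// -!powRD ?enorm_eq0 ?c0 ?implybT//.
by congr powR; lra.
Qed.

(** The convexity of |.|^p, in the form of the inequality of Young for the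
    pairing of a with the flux of c. *)
Lemma pflux_tangent c a :
  p * dotrV (pflux c) (a - c) <= enorm a `^ p - enorm c `^ p.
Proof.
rewrite dotrVBr dotrV_pflux_self.
have H1 := le_trans (ler_norm _) (dotrV_pflux_le c a).
have [q [q0 pq pqE]] := conjugate_exists p1.
have H2 := @conjugate_powR R (enorm a) (enorm c `^ (p - 1)) p q (enorm_ge0 _)
  (powR_ge0 _ _) p0 q0 pq.
rewrite -powRrM pqE in H2.
have qE : q^-1 = 1 - p^-1 by lra.
rewrite mulrC in H1; have := le_trans H1 H2; rewrite qE.
rewrite -(ler_pM2l p0) [leRHS]mulrDr mulrCA divff ?gt_eqF// mulr1.
rewrite [X in _ + X]mulrCA mulrBr mulr1 divff ?gt_eqF//.
move: (dotrV _ _) (enorm a `^ p) (enorm c `^ p) => u A C.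
lra.
Qed.

(** The sum of the tangent inequalities at a and at b. *)
Lemma pflux_monotone a b : 0 <= dotrV (pflux a - pflux b) (a - b).
Proof.
have := pflux_tangent a b; have := pflux_tangent b a.
rewrite dotrVBl !dotrVBr => H1 H2.
by rewrite -(@pmulr_rge0 _ p)//; lra.
Qed.

(** By Cauchy-Schwarz the gap is at least
    (|a|^(p-1) - |b|^(p-1)) (|a| - |b|), so that |a| = |b|; the two fluxes are then
    multiples of a and b by the same factor. *)
Lemma pflux_strict a b : dotrV (pflux a - pflux b) (a - b) = 0 -> a = b.
Proof.
move=> H.
have A1 := le_trans (ler_norm _) (dotrV_pflux_le a b).
have A2 := le_trans (ler_norm _) (dotrV_pflux_le b a).
have E : (enorm a `^ (p - 1) - enorm b `^ (p - 1)) * (enorm a - enorm b) <= 0.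
  rewrite -H dotrVBl !dotrVBr !dotrV_pflux_self.
  rewrite -(mulr_powRB1 (enorm_ge0 a) p0) -(mulr_powRB1 (enorm_ge0 b) p0).
  rewrite mulrBl !mulrBr; lra.
have p10 : 0 < p - 1 by rewrite subr_gt0.
have ab : enorm a = enorm b.
  have [lt|lt|//] := ltgtP (enorm a) (enorm b).
  - have := gt0_ltr_powR p10 (enorm_ge0 a) (enorm_ge0 b) lt => lt'.
    suff : 0 < (enorm a `^ (p - 1) - enorm b `^ (p - 1)) * (enorm a - enorm b) by lra.
    by rewrite -mulrNN mulr_gt0// opprB subr_gt0.
  - have := gt0_ltr_powR p10 (enorm_ge0 b) (enorm_ge0 a) lt => lt'.
    suff : 0 < (enorm a `^ (p - 1) - enorm b `^ (p - 1)) * (enorm a - enorm b) by lra.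
    by rewrite mulr_gt0// subr_gt0.
move: H; rewrite /pflux -ab -scalerBr dotrVZl => /eqP.
rewrite mulf_eq0 powR_eq0 -enorm_sqr mulf_eq0 orbb !enorm_eq0.
case/orP => [/andP[/eqP a0 _]|/eqP/subr0_eq//].
by move: ab; rewrite a0 enorm0 => /esym/eqP; rewrite enorm_eq0 => /eqP.
Qed.

(** At a zero of f the factor |f t|^(p-2) may blow up, and the continuity comes
    from the bound by |f t|^(p-1) instead. *)
Lemma continuous_pflux (T : topologicalType) (f : T -> 'rV[R]_N) b :
  continuous f -> continuous (fun t => dotrV (pflux (f t)) b).
Proof.
move=> cf t; have [ft0|ft0] := eqVneq (f t) 0.
  rewrite /prop_for /continuous_at ft0 pflux0 dotrVC dotrV0.
  apply: (@squeeze_cvgr _ _ _ _ (fun t => - (enorm (f t) `^ (p - 1) * enorm b))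
    (fun t => enorm (f t) `^ (p - 1) * enorm b)).
  - by near=> s; rewrite -ler_norml dotrV_pflux_le.
  - rewrite -oppr0; apply: cvgN; rewrite -(mul0r (enorm b)); apply: cvgMr_tmp.
    rewrite (_ : 0 = enorm (f t) `^ (p - 1)); first by apply: continuous_enorm_powR; rewrite ?subr_gt0.
    by rewrite ft0 enorm0 ?powR0// subr_eq0 gt_eqF.
  - rewrite -(mul0r (enorm b)); apply: cvgMr_tmp.
    rewrite (_ : 0 = enorm (f t) `^ (p - 1)); first by apply: continuous_enorm_powR; rewrite ?subr_gt0.
    by rewrite ft0 enorm0 ?powR0// subr_eq0 gt_eqF.
rewrite (_ : (fun _ => _) =
  (fun t => enorm (f t) `^ (p - 2) * dotrV (f t) b)); last first.
  by apply/funext => s; rewrite dotrVZl.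
apply: cvgM; last first.
  by apply: continuous_dotrV => //; exact: cst_continuous.
apply: (@continuous_cvg _ _ _ _ _ _ (fun s : R => s `^ (p - 2))); last first.
  exact: continuous_enorm.
apply: differentiable_continuous; apply/derivable1_diffP.
by apply: derivable_powR; rewrite in_itv/= andbT enorm_gt0.
Unshelve. all: by end_near. Qed.

(** Strict convexity of |.|^p, made quantitative: the tangent inequalities at the
    quarter points c and c' of the segment, towards its ends, and at its middle,
    towards c and c', add up to this bound of the midpoint defect from below by a
    monotonicity gap. *)
Lemma powR_midpoint a b :
  p / 4 * dotrV (pflux (3/4 *: a + 1/4 *: b) - pflux (1/4 *: a + 3/4 *: b))
    ((3/4 *: a + 1/4 *: b) - (1/4 *: a + 3/4 *: b)) <=
  (enorm a `^ p + enorm b `^ p) / 2 - enorm (2^-1 *: (a + b)) `^ p.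
Proof.
set c := 3/4 *: a + 1/4 *: b; set c' := 1/4 *: a + 3/4 *: b.
set m := 2^-1 *: (a + b).
have := pflux_tangent c a; have := pflux_tangent c' b.
have := pflux_tangent m c; have := pflux_tangent m c'.
pose h := 4^-1 *: (a - b).
have -> : a - c = h.
  by apply/rowP => i; rewrite !mxE; lra.
have -> : b - c' = - h.
  by apply/rowP => i; rewrite !mxE; lra.
have -> : c - m = h.
  by apply/rowP => i; rewrite !mxE; lra.
have -> : c' - m = - h.
  by apply/rowP => i; rewrite !mxE; lra.
have -> : c - c' = 2 *: h.
  by apply/rowP => i; rewrite !mxE; lra.
clearbody h c c' m; rewrite !dotrVNr dotrVZr dotrVBl.
move: (dotrV (pflux c) h) (dotrV (pflux c') h) (dotrV (pflux m) h) => x y z.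
move: (enorm _ `^ p) (enorm _ `^ p) (enorm _ `^ p) (enorm _ `^ p)
  (enorm _ `^ p) => A B C D E.
lra.
Qed.

Lemma midpoint_ge0 a b :
  0 <= (enorm a `^ p + enorm b `^ p) / 2 - enorm (2^-1 *: (a + b)) `^ p.
Proof.
by apply: le_trans (powR_midpoint a b); rewrite mulr_ge0 ?pflux_monotone ?divr_ge0 ?ltW.
Qed.

Lemma midpoint_gt0 a b : a != b ->
  0 < (enorm a `^ p + enorm b `^ p) / 2 - enorm (2^-1 *: (a + b)) `^ p.
Proof.
move=> ab; apply: lt_le_trans (powR_midpoint a b).
rewrite mulr_gt0 ?divr_gt0// lt_def pflux_monotone andbT.
apply: contra_neq ab => /pflux_strict H.
apply/rowP => i; move/rowP : H => /(_ i); rewrite !mxE; lra.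
Qed.

(** The midpoint defect is positive, hence bounded from below, on the compact set
    of the pairs with |a|^p + |b|^p = 1 and |a - b|^p >= e; homogeneity gives the
    other pairs. *)
Lemma uniform_convexity e : 0 < e -> exists2 k, 0 <= k & forall a b,
  enorm (a - b) `^ p <= e * (enorm a `^ p + enorm b `^ p) +
    k * ((enorm a `^ p + enorm b `^ p) / 2 - enorm (2^-1 *: (a + b)) `^ p).
Proof.
move=> e0.
pose S := [set z : 'rV[R]_N * 'rV[R]_N |
  enorm z.1 `^ p + enorm z.2 `^ p = 1 /\ e <= enorm (z.1 - z.2) `^ p].
pose F (z : 'rV[R]_N * 'rV[R]_N) :=
  (enorm z.1 `^ p + enorm z.2 `^ p) / 2 - enorm (2^-1 *: (z.1 + z.2)) `^ p.
have c1 : continuous (fst : 'rV[R]_N * 'rV[R]_N -> _) by move=> z; exact: cvg_fst.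
have c2 : continuous (snd : 'rV[R]_N * 'rV[R]_N -> _) by move=> z; exact: cvg_snd.
have c3 : continuous (fun z : 'rV[R]_N * 'rV[R]_N => z.1 + z.2).
  by move=> z; apply: cvgD; [exact: c1|exact: c2].
have c4 : continuous (fun z : 'rV[R]_N * 'rV[R]_N => z.1 - z.2).
  by move=> z; apply: cvgB; [exact: c1|exact: c2].
have c5 : continuous (fun z : 'rV[R]_N * 'rV[R]_N => 2^-1 *: (z.1 + z.2)).
  by move=> z; apply: cvgZl_tmp; exact: c3.
have cF : continuous F.
  move=> z; apply: cvgB.
    by apply: cvgMr_tmp; apply: cvgD; apply: (continuous_enorm_powR p0).
  exact: (continuous_enorm_powR p0 c5).
have compS : compact S.
  pose B := [set x : 'rV[R]_N | forall i, x ord0 i \in `[(-1), 1]].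
  have cB : compact B.
    have := @rV_compact R N (fun=> `[(-1), 1]%classic); apply.
    by move=> _; exact: segment_compact.
  apply: (@subclosed_compact _ S (B `*` B)); [|exact: compact_setX|].
    rewrite (_ : S = (fun z => enorm z.1 `^ p + enorm z.2 `^ p) @^-1` [set 1] `&`
       (fun z => enorm (z.1 - z.2) `^ p) @^-1` [set x | e <= x])//.
    apply: closedI; apply: closed_comp.
    - move=> z _; apply: cvgD; exact: continuous_enorm_powR.
    - exact: closed_eq.
    - move=> z _; exact: continuous_enorm_powR.
    - exact: closed_ge.
  have le1 (x : 'rV[R]_N) : enorm x `^ p <= 1 -> B x.
    move=> x1 i; rewrite in_itv/= -ler_norml; apply: le_trans (enorm_coord _ _) _.
    rewrite leNgt; apply/negP => x1'.
    have := gt0_ltr_powR p0 ler01 (enorm_ge0 x) x1'.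
    by rewrite powR1; lra.
  move=> z [z1 _]; split; apply: le1.
  - by rewrite -z1 lerDl powR_ge0.
  - by rewrite -z1 lerDr powR_ge0.
have [k k0 kP] : exists2 k, 0 <= k & forall z, S z -> 1 <= k * F z.
  have [S0|] := eqVneq S set0.
    by exists 0 => // z; rewrite S0.
  move/set0P => S0.
  have [z /set_mem Sz zP] := compact_EVT_min S0 compS (continuous_subspaceT cF).
  have Fz : 0 < F z.
    apply: midpoint_gt0; apply/eqP => zz; case: Sz => _.
    rewrite zz subrr enorm0 ?powR0 ?gt_eqF//; lra.
  have FzF y : S y -> F z <= F y by move=> Sy; apply: zP; exact: mem_set.
  move: (F z) Fz FzF => u u0 uF.
  exists u^-1 => [|y Sy]; first by rewrite invr_ge0 ltW.
  by have := uF y Sy; move: (F y) => v uv; rewrite mulrC ler_pdivlMr ?mul1r.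
exists (2 `^ p * k) => [|a b].
  by rewrite mulr_ge0 ?powR_ge0.
set A := _ `^ p + _ `^ p.
have A0 : 0 <= A by rewrite addr_ge0 ?powR_ge0.
have bound (x y : 'rV[R]_N) : enorm (x - y) `^ p <= 2 `^ p * (enorm x `^ p + enorm y `^ p).
  apply: le_trans (powR_addle p0 (enorm_ge0 _) (enorm_ge0 _)).
  apply: powR_le; rewrite ?(ltW p0) ?enorm_ge0//.
  by rewrite -(enormN y) enormD.
have D0 := midpoint_ge0 a b.
have [le|lt] := leP (enorm (a - b) `^ p) (e * A).
  by rewrite (le_trans le)// lerDl !mulr_ge0 ?powR_ge0.
have Apos : 0 < A.
  rewrite lt_def A0 andbT; apply/eqP => A00.
  by have := lt_le_trans lt (bound a b); rewrite -/A A00 !mulr0 ltxx.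
(* The factor that rescales the pair (a, b) into S. *)
pose s := A `^ - p^-1.
have s0 : 0 < s by rewrite powR_gt0.
have sp : s `^ p = A^-1 by rewrite -powRrM mulNr mulVf ?gt_eqF// powR_inv1.
have scal (x : 'rV[R]_N) : enorm (s *: x) `^ p = A^-1 * enorm x `^ p.
  by rewrite enormZ powRM ?enorm_ge0// ger0_norm ?sp// ltW.
have Sab : S (s *: a, s *: b).
  split => /=; first by rewrite !scal -mulrDr mulVf ?gt_eqF.
  by rewrite -scalerBr scal mulrC ler_pdivlMr// ltW.
have : 1 <= k * (2^-1 - A^-1 * enorm (2^-1 *: (a + b)) `^ p).
  have := kP _ Sab; rewrite /F [(s *: a, _).1]/= [(s *: a, _).2]/=.
  have -> : 2^-1 *: (s *: a + s *: b) = s *: (2^-1 *: (a + b)).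
    by rewrite -scalerDr !scalerA mulrC.
  by rewrite !scal -mulrDr -/A mulVf ?gt_eqF// mul1r.
rewrite -(ler_pM2l Apos) mulr1 => H1.
apply: le_trans (bound a b) _; rewrite -/A.
apply: (@le_trans _ _ (2 `^ p * k * (A / 2 - enorm (2^-1 *: (a + b)) `^ p))).
  rewrite -mulrA ler_wpM2l ?powR_ge0//; apply: le_trans H1 _.
  by rewrite mulrCA mulrBr mulrA divff ?gt_eqF// mul1r.
by rewrite lerDr mulr_ge0// ltW.
Qed.

End p_flux.

(** * Differentiable functions along lines *)

Section derivatives_along_lines.
Context {R : realType} {V : normedModType R}.
Implicit Types (f g : V -> R) (x v : V).

(** Reduces the calculus of functions of several variables to the real line. *)
Lemma is_derive_line f x v df :
  is_derive x v f df <-> is_derive (0 : R) 1 (fun h => f (h *: v + x)) df.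
Proof.
have E : (fun h : R => h^-1 *: ((f \o shift x) (h *: v) - f x)) =
    (fun h : R => h^-1 *: (((fun h => f (h *: v + x)) \o shift (0 : R)) (h *: (1 : R)) -
       f (0 *: v + x))).
  by apply/funext => h /=; rewrite scale0r add0r addr0 /GRing.scale/= mulr1.
split => [] [d1 d2]; constructor.
- by rewrite /derivable /= -E.
- by rewrite -d2 /derive -E.
- by rewrite /derivable E.
- by rewrite -d2 /derive E.
Qed.

Lemma is_derive_comp_scalar (F : R -> R) f x v dF df :
  is_derive (f x) 1 F dF -> is_derive x v f df ->
  is_derive x v (fun y => F (f y)) (dF * df).
Proof.
move=> hF /is_derive_line hf; apply/is_derive_line.
apply: (@is_derive1_comp _ F (fun h => f (h *: v + x))) => //.
by rewrite scale0r add0r.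
Qed.

Lemma is_derive_along f x v (s : R) df : is_derive (s *: v + x) v f df ->
  is_derive s (1 : R) (fun r : R => f (r *: v + x)) df.
Proof.
move=> /is_derive_line fd; rewrite -[df]mulr1.
have E : (fun r : R => f (r *: v + x)) =
    (fun r => (fun h => f (h *: v + (s *: v + x))) (r - s)).
  by apply/funext => r; rewrite addrA -scalerDl subrK.
rewrite E; apply: (@is_derive1_comp _ (fun h => f (h *: v + (s *: v + x)))
  (fun r => r - s)); first by rewrite subrr.
by rewrite -[X in is_derive _ _ _ X]addr0; apply: is_deriveD.
Qed.

Lemma is_derive_add f g x v df dg : is_derive x v f df -> is_derive x v g dg ->
  is_derive x v (fun y => f y + g y) (df + dg).
Proof. by move=> *; exact: is_deriveD. Qed.

Lemma is_derive_mul f g x v df dg : is_derive x v f df -> is_derive x v g dg ->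
  is_derive x v (fun y => f y * g y) (f x * dg + g x * df).
Proof. by move=> *; exact: is_deriveM. Qed.

Lemma is_derive_const (c : R) x v : is_derive x v (fun=> c) 0.
Proof. exact: is_derive_cst. Qed.

End derivatives_along_lines.

Section Ck.
Context {R : realType} {V : normedModType R} {J : Type} (e : J -> V).
Implicit Types (f g : V -> R).

(** Continuous derivatives up to the order k along the directions e.  The
    derivatives are given existentially, so that products and compositions are
    handled by induction on k. *)
Fixpoint Ck (k : nat) f : Prop :=
  continuous f /\
  if k is k'.+1 then exists df : J -> V -> R, forall j,
    (forall x, is_derive x (e j) f (df j x)) /\ Ck k' (df j)
  else True.

Lemma Ck_continuous k f : Ck k f -> continuous f.
Proof. by case: k => [|k] []. Qed.

Lemma CkW k f : Ck k.+1 f -> Ck k f.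
Proof.
elim: k f => [|k IH] f [cf [df fdf]]; split=> //.
by exists df => j; have [fj Cj] := fdf j; split => //; exact: IH.
Qed.

Lemma Ck_cst k c : Ck k (fun=> c).
Proof.
elim: k c => [|k IH] c; split => //; try exact: cst_continuous.
by exists (fun _ _ => 0) => j; split => // x; exact: is_derive_const.
Qed.

Lemma CkD k f g : Ck k f -> Ck k g -> Ck k (fun x => f x + g x).
Proof.
elim: k f g => [|k IH] f g [cf df] [cg dg].
  by split => // x; apply: cvgD; [exact: cf|exact: cg].
split; first by move=> x; apply: cvgD; [exact: cf|exact: cg].
case: df dg => df fdf [dg gdg]; exists (fun j x => df j x + dg j x) => j.
have [fj Cfj] := fdf j; have [gj Cgj] := gdg j; split; last exact: IH.
by move=> x; exact: is_derive_add.
Qed.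

Lemma CkM k f g : Ck k f -> Ck k g -> Ck k (fun x => f x * g x).
Proof.
elim: k f g => [|k IH] f g Cf Cg.
  case: Cf Cg => cf _ [cg _].
  by split => // x; apply: cvgM; [exact: cf|exact: cg].
have Cf' := CkW Cf; have Cg' := CkW Cg.
case: Cf Cg => cf [df fdf] [cg [dg gdg]].
split; first by move=> x; apply: cvgM; [exact: cf|exact: cg].
exists (fun j x => f x * dg j x + g x * df j x) => j.
have [fj Cfj] := fdf j; have [gj Cgj] := gdg j; split.
  by move=> x; exact: is_derive_mul.
by apply: CkD; exact: IH.
Qed.

Lemma Ck_prod k (I : Type) (r : seq I) (F : I -> V -> R) :
  (forall i, Ck k (F i)) -> Ck k (fun x => \prod_(i <- r) F i x).
Proof.
move=> CF; elim: r => [|i r IH].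
  by under eq_fun do rewrite big_nil; exact: Ck_cst.
by under eq_fun do rewrite big_cons; exact: CkM.
Qed.

End Ck.

Lemma Ck_comp (R : realType) (V : normedModType R) (J : Type) (e : J -> V) k
    (F : R -> R) (f : V -> R) :
  @Ck R R unit (fun=> 1) k F -> Ck e k f -> Ck e k (fun x => F (f x)).
Proof.
elim: k F f => [|k IH] F f CF Cf.
  case: CF Cf => cF _ [cf _]; split => // x.
  exact: (continuous_cvg _ (cF (f x)) (cf x)).
have Cf' := CkW Cf.
case: CF Cf => cF [dF FdF] [cf [df fdf]].
split; first by move=> x; exact: (continuous_cvg _ (cF (f x)) (cf x)).
have [Ft CFt] := FdF tt.
exists (fun j x => dF tt (f x) * df j x) => j; have [fj Cfj] := fdf j; split.
  by move=> x; apply: is_derive_comp_scalar.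
by apply: CkM => //; exact: IH.
Qed.

(** * Smooth functions vanishing on a half-line *)

Section flat.
Context {R : realType} (s : R) (s0 : 0 < s).

(** t^-k exp(-s/t) for t > 0, extended by 0.  The derivative of each of these
    functions is a linear combination of two others, so that the whole family is
    smooth. *)
Definition flat (k : nat) (t : R) : R :=
  if 0 < t then t ^- k * expR (- (s / t)) else 0.

Lemma flat_ge0 k t : 0 <= flat k t.
Proof.
rewrite /flat; case: ifPn => // t0.
by rewrite mulr_ge0 ?expR_ge0// invr_ge0 exprn_ge0// ltW.
Qed.

Lemma flat_le0 k t : t <= 0 -> flat k t = 0.
Proof. by move=> t0; rewrite /flat ltNge t0. Qed.

Lemma flatM k t : t * flat k.+1 t = flat k t.
Proof.
rewrite /flat; case: ifPn => [t0|_]; last by rewrite mulr0.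
by rewrite exprS invfM !mulrA divff ?gt_eqF// mul1r.
Qed.

(** The exponential beats powers: (y / (k+1))^(k+1) <= exp y, with y = s / t. *)
Lemma flat_small k t : flat k t <= (k.+1%:R / s) ^+ k.+1 * `|t|.
Proof.
rewrite /flat; case: ifPn => [t0|_]; last first.
  by rewrite mulr_ge0// exprn_ge0// divr_ge0// ltW.
rewrite (ger0_norm (ltW t0)) expRN.
have k0 : 0 < k.+1%:R :> R by rewrite ltr0n.
have y0 : 0 < s / t by rewrite divr_gt0.
have H : (s / t / k.+1%:R) ^+ k.+1 <= expR (s / t).
  rewrite -{2}[s / t](@divfK _ k.+1%:R) ?gt_eqF// expRM_natr.
  apply: lerXn2r; rewrite ?nnegrE ?expR_ge0//.
    by rewrite divr_ge0 ?(ltW y0) ?(ltW k0).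
  by apply: le_trans (expR_ge1Dx _); rewrite lerDr.
have H2 : (expR (s / t))^-1 <= ((s / t / k.+1%:R) ^+ k.+1)^-1.
  by rewrite lef_pV2 ?posrE ?expR_gt0// exprn_gt0 ?divr_gt0.
apply: le_trans (ler_wpM2l _ H2) _; first by rewrite invr_ge0 exprn_ge0// ltW.
have -> : ((s / t / k.+1%:R) ^+ k.+1)^-1 = (k.+1%:R / s * t) ^+ k.+1.
  by rewrite -exprVn !invfM !invrK; congr (_ ^+ _); ring.
rewrite exprMn mulrCA; apply: ler_wpM2l.
  by rewrite exprn_ge0// divr_ge0// ltW.
by rewrite exprS mulrCA mulVf ?mulr1// expf_neq0// gt_eqF.
Qed.

Lemma flat_cvg0 k : flat k h @[h --> (0 : R)] --> 0.
Proof.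
apply/cvgrPdist_le => e e0.
set C := (k.+1%:R / s) ^+ k.+1.
have C0 : 0 < C by rewrite exprn_gt0 ?divr_gt0.
have small : \forall x \near (0 : R), `|x| < e / C.
  by apply: nbhs0_lt; exact: divr_gt0.
near=> x.
rewrite sub0r normrN ger0_norm ?flat_ge0// (le_trans (flat_small _ _))//.
rewrite mulrC -ler_pdivlMr// ltW//; near: x; exact: small.
Unshelve. all: by end_near. Qed.

Lemma is_derive_flat k (t : R) :
  is_derive t (1 : R) (flat k) (s * flat k.+2 t - k%:R * flat k.+1 t).
Proof.
have [t0|t0|->] := ltgtP t 0.
- rewrite !flat_le0 ?ltW// !mulr0 subrr.
  apply: near_eq_is_derive (is_derive_const 0 t 1).
  by near=> y; rewrite flat_le0// ltW//; near: y; exact: lt_nbhsl.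
- have dV : is_derive t (1 : R) (fun y : R => y^-1) (- t ^- 2 *: 1).
    by apply: (@is_deriveV _ id); rewrite gt_eqF.
  have dE : is_derive t (1 : R) (fun y : R => expR (- s * y^-1))
      (expR (- s * t^-1) * (- s * (- t ^- 2 *: 1) + t^-1 * 0)).
    apply: (@is_derive_comp_scalar _ _ expR (fun y : R => - s * y^-1)).
    exact: (is_derive_mul (is_derive_const (- s) t 1) dV).
  have powE y : ((fun y : R => y^-1) ^+ k) y = y^-1 ^+ k.
    elim: k {dE} => [|j IH]; first by rewrite !expr0.
    by rewrite !exprS -IH.
  have := is_derive_mul (is_deriveX k dV) dE.
  rewrite (_ : _ + _ = s * flat k.+2 t - k%:R * flat k.+1 t); last first.
    rewrite /flat t0 /GRing.scale/= mulNr.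
    rewrite powE.
    case: k {dE powE} => [|j]; rewrite /= -!exprVn !exprS.
      by rewrite !mul0r !expr0; ring.
    by ring.
  apply: near_eq_is_derive.
  near=> y; have y0 : 0 < y by near: y; exact: lt_nbhsr.
  by rewrite /flat y0 powE exprVn mulNr.
- rewrite !flat_le0// !mulr0 subrr.
  have C : h^-1 *: ((flat k \o shift 0) (h *: 1) - flat k 0) @[h --> (0 : R)^'] --> (0 : R).
    apply: (@cvg_trans _ (flat k.+1 h @[h --> (0 : R)^'])).
      apply: near_eq_cvg; near=> h.
      have h0 : h != 0 by near: h; exact: nbhs_dnbhs_neq.
      rewrite /= (flat_le0 k (lexx 0)) subr0 addr0 /GRing.scale/= mulr1.
      by rewrite -(flatM k h) mulKf.
    by apply: cvg_within_filter; exact: flat_cvg0.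
  by apply: DeriveDef; [apply/cvg_ex; exists 0|exact: cvg_lim].
Unshelve. all: by end_near. Qed.

Lemma continuous_flat k : continuous (flat k).
Proof.
by move=> t; apply: differentiable_continuous; apply/derivable1_diffP;
  case: (is_derive_flat k t).
Qed.

Lemma Ck_flat n k : @Ck R R unit (fun=> 1) n (flat k).
Proof.
elim: n k => [|n IH] k; split; [exact: continuous_flat| |exact: continuous_flat|] => //.
exists (fun _ t => s * flat k.+2 t + (- k%:R) * flat k.+1 t) => j; split.
  by move=> t; rewrite mulNr; exact: is_derive_flat.
by apply: CkD; apply: CkM => //; exact: Ck_cst.
Qed.

Lemma Ck_id n : @Ck R R unit (fun=> 1) n id.
Proof.
have cid : continuous (@id R) by move=> t; exact: cvg_id.
case: n => [|n]; split => //.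
exists (fun _ _ => 1) => j; split; last exact: Ck_cst.
by move=> t; exact: is_derive_id.
Qed.

(** t exp(-s/t) for t > 0: a smooth approximation of the positive part which is
    nonnegative, and 1-Lipschitz because its derivative lies between 0 and 1. *)
Definition soft_pos (t : R) : R := t * flat 0 t.
Definition dsoft_pos (t : R) : R := flat 0 t + s * flat 1 t.

Lemma Ck_soft_pos n : @Ck R R unit (fun=> 1) n soft_pos.
Proof. by apply: CkM; [exact: Ck_id|exact: Ck_flat]. Qed.

Lemma is_derive_soft_pos (t : R) : is_derive t (1 : R) soft_pos (dsoft_pos t).
Proof.
have := is_derive_mul (is_derive_id t (1 : R)) (is_derive_flat 0 t).
by rewrite mul0r subr0 mulrCA flatM mulr1 addrC.
Qed.

Lemma continuous_dsoft_pos : continuous dsoft_pos.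
Proof.
move=> t; apply: cvgD; first exact: continuous_flat.
by apply: cvgMl_tmp; exact: continuous_flat.
Qed.

Lemma soft_pos_ge0 t : 0 <= soft_pos t.
Proof.
have [t0|t0] := leP t 0; first by rewrite /soft_pos flat_le0 ?mulr0.
by rewrite mulr_ge0 ?flat_ge0 ?ltW.
Qed.

Lemma soft_pos_le0 t : t <= 0 -> soft_pos t = 0.
Proof. by move=> t0; rewrite /soft_pos flat_le0 ?mulr0. Qed.

Lemma dsoft_pos_le0 t : t <= 0 -> dsoft_pos t = 0.
Proof. by move=> t0; rewrite /dsoft_pos !flat_le0 ?mulr0 ?addr0. Qed.

Lemma dsoft_pos_ge0 t : 0 <= dsoft_pos t.
Proof. by rewrite addr_ge0 ?mulr_ge0 ?flat_ge0 ?ltW. Qed.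

Lemma flat0_le1 t : flat 0 t <= 1.
Proof.
rewrite /flat; case: ifPn => // t0; rewrite expr0 invr1 mul1r -expR0 ler_expR.
by rewrite lerNl oppr0 divr_ge0 ?ltW.
Qed.

Lemma dsoft_pos_gt0E t : 0 < t -> dsoft_pos t = (1 + s / t) * expR (- (s / t)).
Proof. by move=> t0; rewrite /dsoft_pos /flat t0 expr0 expr1 invr1; ring. Qed.

(** (1 + y) exp(-y) <= 1, with y = s / t. *)
Lemma dsoft_pos_le1 t : dsoft_pos t <= 1.
Proof.
have [t0|t0] := leP t 0; first by rewrite dsoft_pos_le0.
rewrite dsoft_pos_gt0E// expRN ler_pdivrMr ?expR_gt0// mul1r; exact: expR_ge1Dx.
Qed.

Lemma soft_pos_lipschitz x y : `|soft_pos x - soft_pos y| <= `|x - y|.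
Proof.
wlog xy : x y / x < y => [H|].
  have [xy|xy|->] := ltgtP x y; [exact: H| |by rewrite !subrr].
  by rewrite distrC (distrC x); exact: H.
rewrite distrC (distrC x).
have [|c _ ->] := MVT xy (fun z _ => is_derive_soft_pos z).
  apply: continuous_subspaceT => z.
  by apply: differentiable_continuous; apply/derivable1_diffP;
    case: (is_derive_soft_pos z).
by rewrite normrM ler_piMl// ger0_norm ?dsoft_pos_ge0 ?dsoft_pos_le1.
Qed.

End flat.

Lemma flat_cvg1 {R : realType} (t : R) : 0 < t -> flat n.+1%:R^-1 0 t @[n --> \oo] --> (1 : R).
Proof.
move=> t0; rewrite /flat t0 expr0 invr1.
under eq_cvg do rewrite mul1r.
suff : expR (- (n.+1%:R^-1 / t)) @[n --> \oo] --> expR (- (0 / t)).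
  by rewrite mul0r oppr0 expR0.
apply: (@continuous_cvg _ _ _ _ _ _ expR); first exact: continuous_expR.
by apply: cvgN; apply: cvgMr_tmp; exact: cvg_harmonic.
Qed.

(** The limit at 0 is 0, and not 1: the gradient of w^+ is cut off on {w = 0} as
    well. *)
Lemma dsoft_pos_cvg {R : realType} (t : R) :
  dsoft_pos n.+1%:R^-1 t @[n --> \oo] --> ((0 < t)%R%:R : R).
Proof.
have [t0|t0] := leP t 0.
  by under eq_cvg do rewrite dsoft_pos_le0//; exact: cvg_cst.
rewrite -[X in _ --> X]addr0; apply: cvgD; first exact: flat_cvg1.
rewrite (_ : (fun n => _) = (fun n : nat => t^-1 * (n.+1%:R^-1 * flat n.+1%:R^-1 0 t))); last first.
  by apply/funext => n; rewrite -(flatM _ 0 t); rewrite [in RHS](mulrCA _ t) mulKf ?gt_eqF.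
rewrite -(mulr0 t^-1); apply: cvgMl_tmp; rewrite -(mul0r 1); apply: cvgM.
  exact: cvg_harmonic.
exact: flat_cvg1.
Qed.

(** * Borel sets and translations of the Euclidean space *)

Lemma normr_coord (R : realType) n (x : 'rV[R]_n) i : `|x ord0 i| <= `|x|.
Proof.
rewrite [leRHS]mx_normrE; apply/bigmax_geP; right; exists (ord0, i) => //=.
Qed.

Section rV_measurability.
Context {R : realType} {n : nat}.
Implicit Types (A : 'I_n -> set R) (x v : 'rV[R]_n).

Definition box A : set 'rV[R]_n := [set x | forall i, A i (x ord0 i)].

Lemma measurable_box A : (forall i, measurable (A i)) -> measurable (box A).
Proof.
move=> mA; rewrite (_ : box A = \bigcap_(i in [set: 'I_n])
    ((fun x : 'rV[R]_n => x ord0 i) @^-1` (A i))); last first.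
  by apply/seteqP; split => [x h i _|x h i]; [exact: h|exact: (h i I)].
apply: fin_bigcap_measurable => // i _.
by rewrite -[X in measurable X]setTI; exact: measurable_rV_coord.
Qed.

Definition rat_box (q : {ffun 'I_n -> rat * rat}) (i : 'I_n) : set R :=
  [set t | ratr (q i).1 < t < ratr (q i).2].

Definition closed_rat_box (q : {ffun 'I_n -> rat * rat}) (i : 'I_n) : set R :=
  [set t | ratr (q i).1 <= t <= ratr (q i).2].

(** The closed box must fit in the open set, so that functions integrable on
    compact sets are integrable on the box. *)
Lemma open_rat_box (U : set 'rV[R]_n) x : open U -> U x ->
  exists q, box (rat_box q) x /\ box (closed_rat_box q) `<=` U.
Proof.
move=> oU Ux; have /nbhs_ballP[e /= e0 eU] : nbhs x U by exact: open_nbhs_nbhs.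
have H i : exists ab : rat * rat, ratr ab.1 < x ord0 i < ratr ab.2 /\
    x ord0 i - e < ratr ab.1 /\ ratr ab.2 < x ord0 i + e.
  have [a] := @rat_in_itvoo R (x ord0 i - e) (x ord0 i) ltac:(rewrite ltrBlDr ltrDl//).
  have [b] := @rat_in_itvoo R (x ord0 i) (x ord0 i + e) ltac:(rewrite ltrDl//).
  rewrite !in_itv/= => /andP[b1 b2] /andP[a1 a2].
  by exists (a, b); rewrite a2 b1.
have [q qP] := choice H.
exists (finfun q); split => [i|y yq].
  by rewrite /rat_box/= ffunE; case: (qP i).
apply: eU; split => // i j; rewrite (ord1 i) /ball/=.
have := yq j; rewrite /closed_rat_box/= ffunE => /andP[y1 y2].
have [/andP[x1 x2] [q1 q2]] := qP j.
rewrite ltr_norml; lra.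
Qed.

Lemma measurable_rat_box q : measurable (box (rat_box q)).
Proof.
apply: measurable_box => i.
rewrite (_ : rat_box q i = `]ratr (q i).1, ratr (q i).2[%classic)//.
Qed.

(** An open set is the union of countably many rational boxes.  The sigma-algebra
    of the space is generated by its coordinates, not by its topology. *)
Lemma open_measurable_rV (U : set 'rV[R]_n) : open U -> measurable U.
Proof.
move=> oU; pose F (q : {ffun 'I_n -> rat * rat}) :=
  if `[< box (closed_rat_box q) `<=` U >] then box (rat_box q) else set0.
rewrite (_ : U = \bigcup_q F q).
  apply: countable_bigcupT_measurable => [|q]; first exact: countableP.
  by rewrite /F; case: ifPn => // _; exact: measurable_rat_box.
apply/seteqP; split => [x Ux|x [q _]].
  have [q [xq qU]] := open_rat_box oU Ux; exists q => //.
  by rewrite /F; case: ifPn => // /asboolP.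
rewrite /F; case: ifPn => // /asboolP qU xq; apply: qU => i.
by have /andP[a b] := xq i; rewrite /closed_rat_box/= !ltW.
Qed.

Lemma closed_measurable_rV (C : set 'rV[R]_n) : closed C -> measurable C.
Proof.
by move=> cC; rewrite -[C]setCK; apply: measurableC; apply: open_measurable_rV; exact: closed_openC.
Qed.

Lemma continuous_measurable_rV (f : 'rV[R]_n -> R) : continuous f ->
  measurable_fun setT f.
Proof.
move=> cf; apply: (measurability _ (RGenOInfty.measurableE R)) => _ [_ [a ->] <-].
rewrite setTI; apply: open_measurable_rV; apply: open_comp; last exact: interval_open.
by move=> y _; exact: cf.
Qed.

Definition cube (M : R) : set 'rV[R]_n := box (fun=> `[- M, M]%classic).

Lemma cubeE M x : cube M x <-> forall i, `|x ord0 i| <= M.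
Proof.
by split => H i; have := H i; rewrite /= in_itv/= ler_norml.
Qed.

Lemma measurable_cube M : measurable (cube M).
Proof. exact: measurable_box. Qed.

Lemma cube_lty M : (lebesgue_rV n (cube M) < +oo)%E.
Proof.
rewrite lebesgue_rV_box//.
set l := lebesgue_measure _; have -> : l = (fine l)%:E.
  by rewrite fineK// /l lebesgue_measure_itv/=; case: ifP.
by rewrite prodEFin ltry.
Qed.

Lemma sub_cube M M' : M <= M' -> cube M `<=` cube M'.
Proof. by move=> MM x /cubeE xM; apply/cubeE => i; exact: le_trans (xM i) MM. Qed.

Lemma cube_shift M r x v : (forall i, `|v ord0 i| <= r) -> cube M (x + v) ->
  cube (M + r) x.
Proof.
move=> vr /cubeE xv; apply/cubeE => i; have := xv i; rewrite mxE => xvi.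
rewrite -[x ord0 i](addrK (v ord0 i)); apply: le_trans (ler_normB _ _) _.
exact: lerD.
Qed.

Lemma bounded_sub_cube (S : set 'rV[R]_n) : bounded_set S ->
  exists2 M, 0 < M & S `<=` cube M.
Proof.
move=> [M [_ H]]; exists (`|M| + 1) => [|x Sx]; first by rewrite ltr_pwDr.
apply/cubeE => i; have := H (`|M| + 1) _ x Sx.
rewrite (le_lt_trans (ler_norm M)) ?ltrDl// => /(_ isT); apply: le_trans.
exact: normr_coord.
Qed.

(** Boxes generate the Borel sets and are stable by intersection; the cubes
    exhaust the space. *)
Lemma box_measure_unique (m1 m2 : {measure set 'rV[R]_n -> \bar R}) :
  (forall A, (forall i, measurable (A i)) -> m1 (box A) = m2 (box A)) ->
  (forall M, (m1 (cube M) < +oo)%E) ->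
  forall S, measurable S -> m1 S = m2 S.
Proof.
move=> m12 m1oo.
pose G := [set S | exists2 A : 'I_n -> set R, (forall i, measurable (A i)) & S = box A].
apply: (@measure_unique _ _ _ G (fun k : nat => cube k%:R)).
- apply/seteqP; split.
    apply: smallest_sub; first exact: smallest_sigma_algebra.
    rewrite -bigcup_seq; apply: bigcup_sub => i _ _ [B mB <-].
    apply: sub_sigma_algebra; exists (fun j => if j == i then B else setT).
      by move=> j; case: eqP.
    rewrite setTI; apply/seteqP; split => [x Bx j|x /(_ i)] /=.
      by case: eqP => // ->.
    by rewrite eqxx.
  apply: smallest_sub; first exact: sigma_algebra_measurable.
  by move=> _ [A mA ->]; exact: measurable_box.
- move=> _ _ [A mA ->] [B mB ->]; exists (fun i => A i `&` B i).
    by move=> i; exact: measurableI.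
  by apply/seteqP; split => [x [a b] i|x ab]; split => // i; case: (ab i).
- by move=> k; exists (fun=> `[- k%:R, k%:R]%classic).
- apply/seteqP; split => // x _; exists (Num.truncn `|x|).+1 => //.
  apply/cubeE => i; apply: le_trans (normr_coord x i) _.
  by rewrite ltW// truncnS_gt.
- by move=> _ [A mA ->]; exact: m12.
- by move=> k; exact: m1oo.
Qed.

End rV_measurability.

Section translation.
Context {R : realType}.

Lemma measurable_translate n (v : 'rV[R]_n) : measurable_fun setT (fun x : 'rV[R]_n => x + v).
Proof.
apply: measurable_fun_rVP => i.
rewrite (_ : (fun _ => _) = (fun x : 'rV[R]_n => x ord0 i + v ord0 i)).
  by apply: measurable_funD => //; exact: measurable_rV_coord.
by apply/funext => x; rewrite mxE.
Qed.

Lemma lebesgue_measure_translate (c : R) (A : set R) : measurable A ->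
  lebesgue_measure ((fun t => t + c) @^-1` A) = lebesgue_measure A.
Proof.
have mc' : measurable_fun setT (fun t : R => t + c) by exact: measurable_funD.
have mc : @measurable_fun _ _ (measurableTypeR R) (measurableTypeR R) setT
  (fun t : R => t + c) := mc'.
move=> mA; symmetry.
pose m2 := measure_function_pushforward__canonical__measure_function_Measure
  (@lebesgue_measure R) mc.
suff H X : ocitv X -> lebesgue_measure X = m2 X.
  exact: (@lebesgue_measure_unique R m2 H A mA).
move=> [[a b] _ <-].
rewrite /m2 /= /pushforward.
rewrite (_ : _ @^-1` _ = `]a - c, b - c]%classic).
  rewrite !lebesgue_measure_itv/= !lte_fin ltrD2r; case: ifP => // _.
  by rewrite -!EFinB; congr EFin; ring.
by apply/seteqP; split => t /=; rewrite !in_itv/= ltrBlDr lerBrDr.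
Qed.

(** Translations act on boxes side by side. *)
Lemma lebesgue_rV_translate n (v : 'rV[R]_n) (A : set 'rV[R]_n) : measurable A ->
  lebesgue_rV n ((fun x => x + v) @^-1` A) = lebesgue_rV n A.
Proof.
move=> mA; symmetry.
pose m2 := measure_function_pushforward__canonical__measure_function_Measure
  (lebesgue_rV n) (measurable_translate v).
suff H B : (forall i, measurable (B i)) -> lebesgue_rV n (box B) = m2 (box B).
  exact: (@box_measure_unique R n (lebesgue_rV n) m2 H (@cube_lty R n) A mA).
move=> mB; transitivity (lebesgue_rV n [set x | forall i,
    ((fun t => t + v ord0 i) @^-1` B i) (x ord0 i)]).
  have mB' i : measurable ((fun t => t + v ord0 i) @^-1` B i).
    rewrite -[X in measurable X]setTI.
    have mc : measurable_fun setT (fun t : R => t + v ord0 i) by exact: measurable_funD.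
    exact: (mc measurableT _ (mB i)).
  have := lebesgue_rV_box mB'; rewrite /box => ->; rewrite (lebesgue_rV_box mB).
  by apply: eq_bigr => i _; rewrite lebesgue_measure_translate.
congr (lebesgue_rV n _).
by apply/seteqP; split => x /= xB i; have := xB i; rewrite mxE.
Qed.

Lemma integral_translate n (v : 'rV[R]_n) (f : 'rV[R]_n -> R) :
  (lebesgue_rV n).-integrable setT (EFin \o f) ->
  \int[lebesgue_rV n]_x f (x + v) = \int[lebesgue_rV n]_x f x.
Proof.
move=> fi; rewrite /Rintegral; congr fine.
have mf := measurable_int _ fi.
pose m2 := measure_function_pushforward__canonical__measure_function_Measure
  (lebesgue_rV n) (measurable_translate v).
have EI g : (\int[m2]_x g x = \int[lebesgue_rV n]_x g x)%E.
  by apply: eq_measure_integral => A mA _; exact: lebesgue_rV_translate.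
have fvi : (lebesgue_rV n).-integrable setT ((EFin \o f) \o (fun x => x + v)).
  case/integrableP : fi => _ foo; apply/integrableP; split.
    by apply: measurableT_comp => //; exact: measurable_translate.
  have mabs : measurable_fun setT (abse \o (EFin \o f)) by exact: measurableT_comp.
  have := ge0_integral_pushforward (measurable_translate v) (lebesgue_rV n)
    measurableT mabs (fun x _ => abse_ge0 _).
  rewrite preimage_setT => E.
  suff : (\int[lebesgue_rV n]_x
     ((abse \o (EFin \o f)) \o (fun x => (x + v)%R)) x < +oo)%E by [].
  rewrite -E.
  by rewrite [X in (X < _)%E]EI.
have := @integral_pushforward _ _ _ _ R _ (measurable_translate v) (lebesgue_rV n)
  setT (EFin \o f) mf fvi measurableT.
by rewrite preimage_setT => <-; exact: EI.
Qed.

End translation.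

(** * Test functions and their integrals *)

Lemma continuous_compose (T U V : topologicalType) (f : T -> U) (g : U -> V) :
  continuous f -> continuous g -> continuous (fun x => g (f x)).
Proof. by move=> cf cg x; exact: (continuous_comp (cf x) (cg (f x))). Qed.

Lemma continuous_addr (R : realType) (V : normedModType R) (w : V) :
  continuous (fun x : V => x + w).
Proof. by move=> x; apply: cvgD; [exact: cvg_id|exact: cvg_cst]. Qed.

Lemma continuous_line (R : realType) (V : normedModType R) (v w : V) :
  continuous (fun r : R => r *: v + w).
Proof.
by move=> x; apply: cvgD; [apply: cvgZr_tmp; exact: cvg_id|exact: cvg_cst].
Qed.

Section continuous_real_functions.
Context {R : realType} {T : topologicalType}.
Implicit Types f g : T -> R.

Lemma continuous_add f g : continuous f -> continuous g ->
  continuous (fun x => f x + g x).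
Proof. by move=> cf cg x; apply: cvgD; [exact: cf|exact: cg]. Qed.

Lemma continuous_sub f g : continuous f -> continuous g ->
  continuous (fun x => f x - g x).
Proof. by move=> cf cg x; apply: cvgB; [exact: cf|exact: cg]. Qed.

Lemma continuous_mul f g : continuous f -> continuous g ->
  continuous (fun x => f x * g x).
Proof. by move=> cf cg x; apply: cvgM; [exact: cf|exact: cg]. Qed.

End continuous_real_functions.

Section smooth_test.
Context {R : realType} {N : nat}.
Implicit Types (phi eta : 'rV[R]_N -> R) (Omega : set 'rV[R]_N).

Local Notation e_ := (fun i : 'I_N => delta_mx ord0 i : 'rV[R]_N).

Lemma iter_partial_rcons s i phi :
  iter_partial (rcons s i) phi = iter_partial s (partial i phi).
Proof. by rewrite /iter_partial foldr_rcons. Qed.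

Lemma smooth_partial i phi : smooth phi -> smooth (partial i phi).
Proof. by move=> sm s; rewrite -iter_partial_rcons; exact: sm. Qed.

Lemma smooth_is_derive i phi x : smooth phi ->
  is_derive x (e_ i) phi (partial i phi x).
Proof. by move=> /(_ [::])[_ /(_ i x)] d; exact: DeriveDef. Qed.

Lemma smooth_continuous phi : smooth phi -> continuous phi.
Proof. by move=> /(_ [::])[]. Qed.

Lemma smooth_Ck phi k : smooth phi -> Ck e_ k phi.
Proof.
elim: k phi => [|k IH] phi sm; split => //; try exact: smooth_continuous.
exists (fun i => partial i phi) => i; split; last exact/IH/smooth_partial.
by move=> x; exact: smooth_is_derive.
Qed.

Lemma Ck_smooth phi : (forall k, Ck e_ k phi) -> smooth phi.
Proof.
move=> C s; elim/last_ind: s phi C => [|s i IH] phi C.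
  split=> [|i x]; first exact: Ck_continuous (C 0%N).
  by have [_ [df /(_ i)[/(_ x)[]]]] := C 1%N.
rewrite iter_partial_rcons; apply: IH => k.
have [_ [df /(_ i)[d Cd]]] := C k.+1.
suff -> : partial i phi = df i by [].
by apply/funext => x; have [_] := d x.
Qed.

Lemma test0_out Omega phi x : test_function Omega phi -> ~ Omega x -> phi x = 0.
Proof.
move=> [_ _ sub] nx; apply/eqP/negPn/negP => px; apply: nx; apply: sub.
exact: subset_closure.
Qed.

(** The function vanishes on a neighbourhood of x. *)
Lemma partial0_out Omega phi i x : test_function Omega phi -> ~ Omega x ->
  partial i phi x = 0.
Proof.
move=> [_ _ sub] nx; have nsx : ~ Defs.support phi x by move=> sx; apply: nx; exact: sub.
have near0 : \forall y \near x, (cst 0 : _ -> R) y = phi y.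
  have : nbhs x (~` Defs.support phi).
    by apply: open_nbhs_nbhs; split => //; apply: closed_openC; exact: closed_closure.
  apply: filterS => y nsy; apply/esym/eqP/negPn/negP => py.
  by apply: nsy; exact: subset_closure.
by rewrite /partial -(near_eq_derive _ near0) derive_cst.
Qed.

Lemma test_smooth Omega phi : test_function Omega phi -> smooth phi.
Proof. by case. Qed.

Lemma test_sub Omega phi eta : smooth eta ->
  (forall x, phi x = 0 -> eta x = 0) ->
  test_function Omega phi -> test_function Omega eta.
Proof.
move=> sm pe [_ cp sub].
have sup : Defs.support eta `<=` Defs.support phi.
  apply: closure_subset => x /= ex; apply: contra_neq ex; exact: pe.
split => //; last exact: subset_trans sub.
apply: subclosed_compact cp sup; exact: closed_closure.
Qed.

Lemma test_comp Omega phi (F : R -> R) : (forall k, @Ck R R unit (fun=> 1) k F) ->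
  F 0 = 0 -> test_function Omega phi -> test_function Omega (fun x => F (phi x)).
Proof.
move=> CF F0 tphi; apply: (test_sub _ _ tphi) => [|x ->//].
by apply: Ck_smooth => k; apply: Ck_comp => //; exact/smooth_Ck/(test_smooth tphi).
Qed.

Lemma testZ Omega phi c : test_function Omega phi -> test_function Omega (fun x => c * phi x).
Proof.
move=> tphi; apply: (test_sub _ _ tphi) => [|x ->]; last by rewrite mulr0.
apply: Ck_smooth => k; apply: CkM; first exact: Ck_cst.
exact/smooth_Ck/(test_smooth tphi).
Qed.

Lemma testD Omega phi eta : test_function Omega phi -> test_function Omega eta ->
  test_function Omega (fun x => phi x + eta x).
Proof.
move=> [sp cp subp] [se ce sube].
have sup : Defs.support (fun x => phi x + eta x) `<=` Defs.support phi `|` Defs.support eta.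
  rewrite /Defs.support -closureU; apply: closure_subset => x /= pe.
  have [p0|] := eqVneq (phi x) 0; last by left.
  by right; apply: contra_neq pe => ->; rewrite p0 addr0.
split.
- by apply: Ck_smooth => k; apply: CkD; exact: smooth_Ck.
- apply: subclosed_compact (compactU cp ce) sup; exact: closed_closure.
- by move=> x sx; case: (sup _ sx) => ?; [exact: subp|exact: sube].
Qed.

End smooth_test.

Section integral_of_derivatives.
Context {R : realType} {N : nat}.
Local Notation mu := (lebesgue_rV N).
Implicit Types (f g z : 'rV[R]_N -> R).

Local Notation e_ := (fun i : 'I_N => delta_mx ord0 i : 'rV[R]_N).

(** Compact supports enter estimates through a common cube M only. *)
Definition vanish_out (M : R) f := forall x, ~ cube M x -> f x = 0.

Lemma integrable_cube_cst M c :
  mu.-integrable setT (EFin \o ((cst c : 'rV[R]_N -> R) \_ (cube M))).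
Proof.
rewrite -restrict_EFin; apply/(integrable_mkcond _ (measurable_cube M)).
apply: measurable_bounded_integrable => //.
- exact: measurable_cube.
- exact: cube_lty.
- exists `|c|; split => // x cx y _ /=; exact: ltW.
Qed.

Lemma vanish_bounded M f : continuous f -> vanish_out M f ->
  exists2 c, 0 <= c & forall x, `|f x| <= c.
Proof.
move=> cf f0.
have cK : compact (cube M : set 'rV[R]_N).
  have := @rV_compact R N (fun=> `[- M, M]%classic); apply.
  by move=> _; exact: segment_compact.
have [c [_ H]] : bounded_set (f @` cube M).
  by apply/compact_bounded/continuous_compact => //; exact: continuous_subspaceT.
exists (`|c| + 1) => [|x]; first by rewrite addr_ge0.
have [Kx|nKx] := pselect (cube M x); last by rewrite f0// normr0 addr_ge0.
by apply: (H (`|c| + 1)); [rewrite (le_lt_trans (ler_norm c))// ltrDl|exists x].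
Qed.

Lemma vanish_integrable M f : continuous f -> vanish_out M f ->
  mu.-integrable setT (EFin \o f).
Proof.
move=> cf f0; have [c c0 fc] := vanish_bounded cf f0.
apply: integrable_dominated (integrable_cube_cst M c) => //.
- exact: continuous_measurable_rV.
- move=> x _; rewrite patchE; case: ifPn => // /negP.
  by rewrite inE => nx; rewrite f0// normr0.
Qed.

(** The integral is the limit of those of the difference quotients, which vanish
    by translation invariance; the mean value theorem dominates the quotients. *)
Lemma integral_derivative0 M i z dz : continuous z -> continuous dz ->
  (forall x, is_derive x (e_ i) z (dz x)) ->
  vanish_out M z -> vanish_out M dz -> \int[mu]_x dz x = 0.
Proof.
move=> cz cdz zdz z0 dz0.
have [c c0 dzc] := vanish_bounded cdz dz0.
have zi := vanish_integrable cz z0.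
pose h (k : nat) : R := k.+1%:R^-1.
have h0 k : 0 < h k by rewrite invr_gt0.
pose F k (x : 'rV[R]_N) := (h k)^-1 * (z (x + h k *: e_ i) - z x).
have czt k : continuous (fun x : 'rV[R]_N => z (x + h k *: e_ i)).
  by apply: continuous_compose cz; exact: continuous_addr.
have cF k : continuous (F k).
  by apply: continuous_mul; [exact: cst_continuous|exact: continuous_sub].
(* Steps are at most 1, so that the quotients vanish outside the cube M + 1. *)
have he1 k j : `|(h k *: e_ i) ord0 j| <= 1.
  rewrite !mxE normrM [X in X * _]ger0_norm ?(ltW (h0 k))//.
  apply: (@le_trans _ _ (h k)); last by rewrite /h invf_le1 ?ler1n ?ltr0n.
  by rewrite ler_piMr ?(ltW (h0 k))//; case: eqP; case: eqP; rewrite ?normr1 ?normr0.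
have nM (x : 'rV[R]_N) k : ~ cube (M + 1) x -> ~ cube M x /\ ~ cube M (x + h k *: e_ i).
  move=> nx; split => Kx; apply: nx; last exact: cube_shift (he1 k) Kx.
  by apply: sub_cube Kx; rewrite lerDl.
have FM k : vanish_out (M + 1) (F k).
  by move=> x /(nM x k)[nx nxh]; rewrite /F !z0 ?subrr ?mulr0.
have zti k : mu.-integrable setT (EFin \o (fun x : 'rV[R]_N => z (x + h k *: e_ i))).
  apply: (@vanish_integrable (M + 1)) => // x /(nM x k)[_ nxh]; exact: z0.
have IF k : \int[mu]_x F k x = 0.
  rewrite /F RintegralZl//; last exact: integrable_sub.
  by rewrite RintegralB// integral_translate// subrr mulr0.
have Fc k x : `|F k x| <= (cst c \_ (cube (M + 1))) x.
  rewrite patchE; case: ifPn => [_|/negP nx]; last first.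
    by rewrite FM ?normr0// => Kx; apply: nx; rewrite inE.
  rewrite /= /F normrM ger0_norm ?invr_ge0 ?(ltW (h0 k))//.
  have [|t _] := MVT (h0 k) (fun s _ => is_derive_along (zdz (s *: e_ i + x))).
    apply: continuous_subspaceT; apply: continuous_compose cz.
    exact: continuous_line.
  rewrite scale0r add0r subr0 (addrC _ x) => ->.
  by rewrite normrM mulrCA (ger0_norm (ltW (h0 k))) mulVf ?mulr1 ?gt_eqF.
have cv : (fun k => \int[mu]_x F k x) @ \oo --> \int[mu]_x dz x.
  apply: (@Rintegral_dominated _ _ _ mu setT measurableT F dz (cst c \_ (cube (M + 1)))).
  - by move=> k; exact: continuous_measurable_rV.
  - exact: continuous_measurable_rV.
  - exact: integrable_cube_cst.
  - by move=> k x _; exact: Fc.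
  - apply: aeW => x _; have [dv <-] := zdz x.
    have C : t^-1 *: ((z \o shift x) (t *: e_ i) - z x) @[t --> (0 : R)^'] -->
      'D_(e_ i) z x by exact: dv.
    have hc : h @ \oo --> (0 : R)^'.
      move=> A; rewrite /dnbhs /= => nA.
      have H : \forall k \near \oo, h k != 0 -> A (h k) := @cvg_harmonic R _ nA.
      apply: filterS H => k; apply; exact: lt0r_neq0 (h0 k).
    apply: cvg_trans (cvg_comp _ _ hc C); apply: near_eq_cvg.
    by apply: nearW => k; rewrite /= /F [x + _]addrC.
by rewrite -(cvg_lim _ cv)//; under eq_fun do rewrite IF; rewrite lim_cst.
Qed.

End integral_of_derivatives.

(** * Integration by parts and the inequality of Poincare *)

Section positive_powers.
Context {R : realType}.

(** The function |t|^p is the sum of two of these, which have a derivative of the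
    same kind when p > 1. *)
Definition pos_pow (p t : R) : R := Num.max t 0 `^ p.

Lemma continuous_pos_pow p : 0 < p -> continuous (pos_pow p).
Proof.
move=> p0; have E : pos_pow p = (fun t => `|Num.max t 0| `^ p).
  by apply/funext => t; rewrite ger0_norm// le_max lexx orbT.
rewrite E; apply: (@continuous_compose _ _ _ (fun t : R => Num.max t 0) (fun t => `|t| `^ p)).
  move=> t; apply: (@continuous_max _ _ id (cst 0)); [exact: cvg_id|exact: cvg_cst].
exact: continuous_abs_powR.
Qed.

Lemma is_derive_pos_pow p (t : R) : 1 < p ->
  is_derive t (1 : R) (pos_pow p) (p * pos_pow (p - 1) t).
Proof.
move=> p1; have p0 : 0 < p by exact: lt_trans p1.
have p10 : 0 < p - 1 by rewrite subr_gt0.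
have neg r y : 0 < r -> y <= 0 -> pos_pow r y = 0.
  by move=> r0 y0; rewrite /pos_pow max_r// powR0// gt_eqF.
have pos r y : 0 < y -> pos_pow r y = y `^ r.
  by move=> y0; rewrite /pos_pow max_l// ltW.
have [t0|t0|->] := ltgtP t 0.
- rewrite neg ?(ltW t0)// mulr0.
  apply: near_eq_is_derive (is_derive_const 0 t 1).
  near=> y; rewrite neg// ltW//; near: y; exact: lt_nbhsl.
- rewrite pos//.
  have t1 : t \in `]0, +oo[ by rewrite in_itv/= t0.
  have D : is_derive t (1 : R) (fun y : R => y `^ p) (p * t `^ (p - 1)).
    apply: DeriveDef; first exact: derivable_powR.
    by rewrite -derive1E powR_derive1.
  apply: near_eq_is_derive D.
  near=> y; rewrite pos//; near: y; exact: lt_nbhsr.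
- rewrite neg// mulr0.
  have C : h^-1 *: ((pos_pow p \o shift 0) (h *: 1) - pos_pow p 0) @[h --> (0 : R)^'] --> (0 : R).
    apply: (@cvg_trans _ (pos_pow (p - 1) h @[h --> (0 : R)^'])).
      apply: near_eq_cvg; near=> h.
      have h0 : h != 0 by near: h; exact: nbhs_dnbhs_neq.
      rewrite /= (neg p 0)// subr0 addr0 /GRing.scale/= mulr1.
      have [hn|hp|hE] := ltgtP h 0; last by rewrite hE eqxx in h0.
        by rewrite !neg ?(ltW hn)// mulr0.
      by rewrite !pos// -(mulr_powRB1 (ltW hp) p0) mulKf.
    apply: cvg_within_filter.
    by have := @continuous_pos_pow (p - 1) p10 0; rewrite /continuous_at neg.
  by apply: DeriveDef; [apply/cvg_ex; exists 0|exact: cvg_lim].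
Unshelve. all: by end_near. Qed.

Lemma abs_pos_pow p t : 0 < p -> `|t| `^ p = pos_pow p t + pos_pow p (- t).
Proof.
move=> p0; rewrite /pos_pow; have [t0|t0] := leP 0 t.
  rewrite ger0_norm// (max_r (_ : - t <= 0)) ?oppr_le0//.
  by rewrite powR0 ?addr0// gt_eqF.
rewrite ltr0_norm// (max_l (_ : 0 <= - t)) ?oppr_ge0 ?(ltW t0)//.
by rewrite powR0 ?add0r// gt_eqF.
Qed.

Definition dabs_pow (p t : R) : R := p * (pos_pow (p - 1) t - pos_pow (p - 1) (- t)).

Lemma is_derive_abs_pow p (t : R) : 1 < p ->
  is_derive t (1 : R) (fun t : R => `|t| `^ p) (dabs_pow p t).
Proof.
move=> p1; have p0 : 0 < p by exact: lt_trans p1.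
have -> : (fun t : R => `|t| `^ p) = (fun t => pos_pow p t + pos_pow p (- t)).
  by apply/funext => s; exact: abs_pos_pow.
have -> : dabs_pow p t =
    p * pos_pow (p - 1) t + (p * pos_pow (p - 1) (- t)) * (- 1).
  by rewrite /dabs_pow; ring.
apply: is_derive_add; first exact: is_derive_pos_pow.
apply: (@is_derive_comp_scalar _ _ (pos_pow p) (fun s : R => - s)).
  exact: is_derive_pos_pow.
Qed.

Lemma continuous_dabs_pow p : 1 < p -> continuous (dabs_pow p).
Proof.
move=> p1; have p10 : 0 < p - 1 by rewrite subr_gt0.
apply: continuous_mul; first exact: cst_continuous.
apply: continuous_sub; first exact: continuous_pos_pow.
apply: continuous_compose (continuous_pos_pow p10).
exact: opp_continuous.
Qed.

Lemma normr_dabs_pow p t : 1 < p -> `|dabs_pow p t| = p * `|t| `^ (p - 1).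
Proof.
move=> p1; have p10 : 0 < p - 1 by rewrite subr_gt0.
rewrite abs_pos_pow// /dabs_pow normrM ger0_norm; last by rewrite ltW// (lt_trans _ p1).
congr (_ * _); rewrite /pos_pow; have [t0|t0] := leP 0 t.
  by rewrite [Num.max (- t) 0]max_r ?oppr_le0// powR0 ?gt_eqF// subr0 addr0 ger0_norm ?powR_ge0.
rewrite powR0 ?gt_eqF// sub0r add0r normrN.
by rewrite ger0_norm ?powR_ge0.
Qed.

End positive_powers.

Section coordinates.
Context {R : realType} {N : nat}.
Local Notation e_ := (fun i : 'I_N => delta_mx ord0 i : 'rV[R]_N).

Lemma is_derive_coord (i j : 'I_N) (x : 'rV[R]_N) :
  is_derive x (e_ i) (fun y => y ord0 j) (i == j)%:R.
Proof.
apply/is_derive_line.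
have -> : (fun h : R => (h *: e_ i + x) ord0 j) =
    (fun h : R => (i == j)%:R * h + x ord0 j).
  by apply/funext => h; rewrite !mxE eqxx/= mulrC eq_sym.
have := is_derive_add
  (is_derive_mul (is_derive_const ((i == j)%:R : R) (0 : R) (1 : R))
    (is_derive_id (0 : R) (1 : R)))
  (is_derive_const (x ord0 j) (0 : R) (1 : R)).
by rewrite mulr1 mulr0 !addr0.
Qed.

Lemma Ck_coord k (j : 'I_N) : Ck e_ k (fun y : 'rV[R]_N => y ord0 j).
Proof.
have cc : continuous (fun x : 'rV[R]_N => x ord0 j) by exact: coord_continuous.
case: k => [|k]; split => //.
exists (fun i _ => (i == j)%:R) => i; split; last exact: Ck_cst.
by move=> x; exact: is_derive_coord.
Qed.

End coordinates.

Section tests_on_Omega.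
Context {R : realType} {N : nat} (Omega : set 'rV[R]_N) (M : R).
Hypotheses (oO : open Omega) (OM : Omega `<=` cube M).
Local Notation mu := (lebesgue_rV N).
Implicit Types (phi eta : 'rV[R]_N -> R).

Local Notation e_ := (fun i : 'I_N => delta_mx ord0 i : 'rV[R]_N).

Let mO : measurable Omega. Proof. exact: open_measurable_rV. Qed.

Lemma Rintegral_full f : (forall x, ~ Omega x -> f x = 0) ->
  \int[mu]_(x in Omega) f x = \int[mu]_x f x.
Proof.
move=> f0; rewrite Rintegral_mkcond; congr (Rintegral _ _ _).
apply/funext => x; rewrite patchE; case: ifPn => // /negP nx.
by rewrite f0// => Ox; apply: nx; rewrite inE.
Qed.

Lemma continuous_integrable f : continuous f -> (forall x, ~ Omega x -> f x = 0) ->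
  mu.-integrable Omega (EFin \o f).
Proof.
move=> cf f0; apply: (integrableS measurableT mO) => //.
apply: (@vanish_integrable _ _ M) => // x nx; apply: f0 => Ox.
by apply: nx; exact: OM.
Qed.

Lemma Lp_continuous p f : 0 < p -> continuous f -> (forall x, ~ Omega x -> f x = 0) ->
  Lp mu Omega p f.
Proof.
move=> p0 cf f0; split.
  exact: measurable_funS measurableT (@subsetT _ _) (continuous_measurable_rV cf).
apply: continuous_integrable => [|x nx]; last by rewrite f0// normr0 powR0// gt_eqF.
exact: continuous_compose cf (continuous_abs_powR p0).
Qed.

Lemma test_Lp p phi : 0 < p -> test_function Omega phi -> Lp mu Omega p phi.
Proof.
move=> p0 t; apply: Lp_continuous => //; last by move=> x; exact: test0_out t.
exact/smooth_continuous/(test_smooth t).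
Qed.

Lemma partial_continuous i phi : test_function Omega phi -> continuous (partial i phi).
Proof. by move=> /test_smooth t; exact/smooth_continuous/smooth_partial. Qed.

Lemma partial_Lp p i phi : 0 < p -> test_function Omega phi ->
  Lp mu Omega p (partial i phi).
Proof.
move=> p0 t; apply: Lp_continuous => //; first exact: partial_continuous.
by move=> x; exact: partial0_out t.
Qed.

Lemma integral_by_parts i phi eta : test_function Omega phi ->
  test_function Omega eta ->
  \int[mu]_(x in Omega) (phi x * partial i eta x) =
  - \int[mu]_(x in Omega) (partial i phi x * eta x).
Proof.
move=> tp te; have cp := smooth_continuous (test_smooth tp).
have ce := smooth_continuous (test_smooth te).
have cdp := partial_continuous (i := i) tp.
have cde := partial_continuous (i := i) te.
have i1 : mu.-integrable Omega (EFin \o (fun x => phi x * partial i eta x)).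
  apply: continuous_integrable; first exact: continuous_mul.
  by move=> x nx; rewrite (test0_out tp nx) mul0r.
have i2 : mu.-integrable Omega (EFin \o (fun x => partial i phi x * eta x)).
  apply: continuous_integrable; first exact: continuous_mul.
  by move=> x nx; rewrite (test0_out te nx) mulr0.
apply/eqP; rewrite -addr_eq0 -RintegralD// Rintegral_full; last first.
  by move=> x nx; rewrite (test0_out tp nx) (test0_out te nx) mul0r mulr0 addr0.
apply/eqP; apply: (@integral_derivative0 _ _ M i (fun x => phi x * eta x)).
- exact: continuous_mul.
- by apply: continuous_add; exact: continuous_mul.
- move=> x; rewrite (mulrC (partial i phi x)).
  by apply: is_derive_mul; apply: smooth_is_derive; [exact: test_smooth tp|exact: test_smooth te].
- by move=> x nx; rewrite (test0_out tp) ?mul0r// => /OM.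
- move=> x nx; have nO : ~ Omega x by move=> /OM.
  by rewrite (test0_out tp nO) (test0_out te nO) mul0r mulr0 addr0.
Qed.

(** The partial derivative of x_i |phi|^p is |phi|^p + p x_i |phi|^(p-1) sgn(phi)
    d_i phi, and its integral vanishes, so that the energy of phi is at most
    p M int |phi|^(p-1) |d_i phi|.  The inequality of Young absorbs half of it. *)
Lemma poincare_test p (i : 'I_N) : 1 < p -> 0 < M -> exists2 c, 0 <= c &
  forall phi, test_function Omega phi ->
    energy mu Omega p phi <= c * energy mu Omega p (partial i phi).
Proof.
move=> p1 M0; have p0 : 0 < p by exact: lt_trans p1.
have [q [q0 pq pqE]] := conjugate_exists p1.
have pM : 0 < p * M by rewrite mulr_gt0.
(* The weight 1 / (2 p M) leaves half of the energy on the right-hand side. *)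
have [c c0 young] := young_small p0 q0 pq (divr_gt0 ltr01 (mulr_gt0 (ltr0Sn R 1) pM)).
exists (2 * (p * M * c)) => [|phi tp].
  by rewrite !mulr_ge0// ltW.
have cp := smooth_continuous (test_smooth tp).
have cdp := partial_continuous (i := i) tp.
have cc : continuous (fun x : 'rV[R]_N => x ord0 i) by exact: coord_continuous.
pose z (x : 'rV[R]_N) := x ord0 i * `|phi x| `^ p.
pose w (x : 'rV[R]_N) := x ord0 i * (dabs_pow p (phi x) * partial i phi x).
have cP : continuous (fun x => `|phi x| `^ p).
  exact: continuous_compose cp (continuous_abs_powR p0).
have cw : continuous w.
  apply: continuous_mul => //; apply: continuous_mul => //.
  exact: continuous_compose cp (continuous_dabs_pow p1).
have w0 x : ~ Omega x -> w x = 0.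
  by move=> nx; rewrite /w (partial0_out i tp nx) !mulr0.
have P0 x : ~ Omega x -> `|phi x| `^ p = 0.
  by move=> nx; rewrite (test0_out tp nx) normr0 powR0// gt_eqF.
have wi : mu.-integrable Omega (EFin \o w) by exact: continuous_integrable.
have [mphi phii] := test_Lp p0 tp; have [mdphi dphii] := partial_Lp i p0 tp.
have key : \int[mu]_(x in Omega) (w x + `|phi x| `^ p) = 0.
  rewrite Rintegral_full; last by move=> x nx; rewrite w0// P0// addr0.
  apply: (@integral_derivative0 _ _ M i z).
  - exact: continuous_mul.
  - exact: continuous_add.
  - move=> x; rewrite /w -[X in _ + X]mulr1; apply: is_derive_mul.
      by have := is_derive_coord i i x; rewrite eqxx.
    apply: (@is_derive_comp_scalar _ _ (fun t => `|t| `^ p)).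
      exact: is_derive_abs_pow.
    exact: smooth_is_derive (test_smooth tp).
  - by move=> x nx; rewrite /z P0 ?mulr0// => /OM.
  - by move=> x nx; rewrite w0 ?P0 ?addr0// => /OM.
move: key; rewrite RintegralD// => /eqP; rewrite addrC addr_eq0 => /eqP key.
rewrite -/(energy mu Omega p phi) in key.
have : energy mu Omega p phi <= \int[mu]_(x in Omega) `|w x|.
  by rewrite key; apply: le_trans (ler_norm _) _; rewrite normrN le_normr_Rintegral.
have : \int[mu]_(x in Omega) `|w x| <= p * M *
    ((1 / (2 * (p * M))) * energy mu Omega p phi + c * energy mu Omega p (partial i phi)).
  rewrite /energy -!RintegralZl// -RintegralD//; try exact: integrable_scale.
  rewrite -RintegralZl//; last by apply: integrable_add => //; exact: integrable_scale.
  apply: le_Rintegral => //.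
  - exact: integrable_norm.
  - by apply: integrable_scale => //; apply: integrable_add => //; exact: integrable_scale.
  move=> x Ox; rewrite /w normrM (normrM (dabs_pow _ _)) normr_dabs_pow//.
  have := young (`|phi x| `^ (p - 1)) `|partial i phi x| (powR_ge0 _ _) (normr_ge0 _).
  rewrite -powRrM pqE.
  have /cubeE/(_ i) xM := OM Ox.
  move=> /(ler_wpM2l (ltW pM)); apply: le_trans.
  rewrite mulrA mulrCA -!mulrA ler_pM2l// [leLHS]mulrA.
  by rewrite !mulrA ler_wpM2r// ler_wpM2r ?powR_ge0.
have e1 := energy_ge0 mu Omega p phi.
move: (energy _ _ _ _) (energy _ _ _ _) e1 => dE E e1 H1 H2.
have := le_trans H2 H1.
have -> : p * M * (1 / (2 * (p * M)) * E + c * dE) = E / 2 + p * M * c * dE.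
  by field; rewrite !gt_eqF.
by lra.
Qed.

End tests_on_Omega.

(** * The fundamental lemma of the calculus of variations *)

Section open_boxes.
Context {R : realType} {n : nat}.

(** Boxes with such sides are stable by intersection and contain the whole
    space: a pi-system for the argument of Dynkin, on which smooth bumps can be
    used. *)
Definition open_boxes : set (set 'rV[R]_n) := [set S |
  exists2 A : 'I_n -> set R,
    (forall i, A i = setT \/ exists a b, A i = `]a, b[%classic) & S = box A].

Lemma open_boxes_measurable : open_boxes `<=` @measurable _ 'rV[R]_n.
Proof.
move=> _ [A HA ->]; apply: measurable_box => i.
by case: (HA i) => [->|[a [b ->]]].
Qed.

Lemma open_boxesT : open_boxes setT.
Proof.
exists (fun=> setT) => [i|]; first by left.
by apply/seteqP; split.
Qed.

Lemma open_boxesI : setI_closed open_boxes.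
Proof.
move=> _ _ [A HA ->] [B HB ->]; exists (fun i => A i `&` B i); last first.
  by apply/seteqP; split => [x [a b] i|x ab]; split => // i; case: (ab i).
move=> i; case: (HA i) (HB i) => [->|[a [b ->]]] [->|[a' [b' ->]]].
- by left; rewrite setTI.
- by right; exists a', b'; rewrite setTI.
- by right; exists a, b; rewrite setIT.
- right; exists (Num.max a a'), (Num.min b b').
  apply/seteqP; split => t /=; rewrite !in_itv/= gt_max lt_min.
    by move=> [/andP[-> ->] /andP[-> ->]].
  by move=> /andP[/andP[-> ->] /andP[-> ->]].
Qed.

Lemma measurable_open_boxes : @measurable _ 'rV[R]_n = <<s open_boxes >>.
Proof.
apply/seteqP; split; last first.
  apply: smallest_sub; first exact: sigma_algebra_measurable.
  exact: open_boxes_measurable.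
apply: smallest_sub; first exact: smallest_sigma_algebra.
rewrite -bigcup_seq; apply: bigcup_sub => i _ _ [B mB <-].
pose coord (x : g_sigma_algebraType open_boxes) : R := (x : 'rV[R]_n) ord0 i.
have mc : measurable_fun setT coord.
  apply: (measurability _ (RGenOpens.measurableE R)) => _ [_ [a [b ->]] <-].
  apply: sub_sigma_algebra; exists (fun j => if j == i then `]a, b[%classic else setT).
    by move=> j; case: eqP => _; [right; exists a, b|left].
  rewrite setTI; apply/seteqP; split => [x Bx j|x /(_ i)] /=.
    by case: eqP => // ->.
  by rewrite eqxx.
exact: (mc measurableT B mB).
Qed.

Local Notation mu := (lebesgue_rV n).

(** The sets on which the integral of g vanishes form a Dynkin system. *)
Lemma ae0_open_boxes (Q : set 'rV[R]_n) (g : 'rV[R]_n -> R) : measurable Q ->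
  mu.-integrable Q (EFin \o g) ->
  (forall S, open_boxes S -> \int[mu]_(x in S `&` Q) g x = 0) ->
  {ae mu, forall x, Q x -> g x = 0}.
Proof.
move=> mQ gi g0.
have giS S : measurable S -> mu.-integrable (S `&` Q) (EFin \o g).
  by move=> mS; apply: integrableS gi => //; exact: measurableI.
have H S : measurable S -> \int[mu]_(x in S `&` Q) g x = 0.
  rewrite measurable_open_boxes.
  apply: (@dynkin_induction _ _ _ (fun S => \int[mu]_(x in S `&` Q) g x = 0)
    measurable_open_boxes open_boxesI).
  - exact: g0 open_boxesT.
  - exact: g0.
  - move=> A mA A0.
    have QE : Q = (A `&` Q) `|` (~` A `&` Q) by rewrite -setIUl setUv setTI.
    have := @Rintegral_setU _ _ _ mu (A `&` Q) (~` A `&` Q) g.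
    rewrite -QE A0 add0r => <- //.
    + by have := g0 _ open_boxesT; rewrite setTI.
    + exact: measurableI.
    + by apply: measurableI => //; exact: measurableC.
    + apply/disj_setPS => x [[Ax _] [nAx _]]; exact: nAx.
  - move=> F mF tF F0.
    have iF : mu.-integrable (\bigcup_k (F k `&` Q)) (EFin \o g).
      by rewrite -setI_bigcupl; apply: giS; exact: bigcup_measurable.
    rewrite /Rintegral setI_bigcupl integral_bigcup//; last 2 first.
    + exact: trivIset_setIr.
    + by move=> k; exact: measurableI.
    rewrite eseries0// => k _ _.
    by rewrite -(EFin_Rintegral (measurableI _ _ (mF k) mQ) (giS _ (mF k))) F0.
have : ae_eq mu Q (EFin \o g) (cst 0%E).
  apply: integral_ae_eq => // E EQ mE.
  rewrite integral0 -(EFin_Rintegral mE (integrableS mQ mE EQ gi)).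
  by rewrite -[E](setIidl EQ) H.
by apply: filterS => x + Qx => /(_ Qx) [].
Qed.

End open_boxes.

Section fundamental_lemma.
Context {R : realType} {N : nat} (Omega : set 'rV[R]_N).
Hypothesis (oO : open Omega).
Local Notation mu := (lebesgue_rV N).
Local Notation e_ := (fun i : 'I_N => delta_mx ord0 i : 'rV[R]_N).

Definition closed_box (a b : 'I_N -> R) : set 'rV[R]_N := box (fun i => `[a i, b i]%classic).
Definition open_box (a b : 'I_N -> R) : set 'rV[R]_N := box (fun i => `]a i, b i[%classic).

Lemma closed_closed_box a b : closed (closed_box a b).
Proof.
have -> : closed_box a b = \bigcap_(i in [set: 'I_N])
    ((fun x : 'rV[R]_N => x ord0 i) @^-1` `[a i, b i]%classic).
  by apply/seteqP; split => [x h i _|x h i]; [exact: h|exact: (h i I)].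
apply: closed_bigI => i _; apply: closed_comp; last exact: interval_closed.
by move=> x _; exact: coord_continuous.
Qed.

Lemma compact_closed_box a b : compact (closed_box a b).
Proof.
have := @rV_compact R N (fun i => `[a i, b i]%classic); apply.
by move=> i; exact: segment_compact.
Qed.

(** A product of flat functions; when s tends to 0 it increases to the indicator of
    the open box. *)
Definition bump (s : R) (a b : 'I_N -> R) (x : 'rV[R]_N) : R :=
  \prod_(i < N) (flat s 0 (x ord0 i - a i) * flat s 0 (b i - x ord0 i)).

Lemma bump_out s a b x : ~ open_box a b x -> bump s a b x = 0.
Proof.
move=> nx; have [i ni] : exists i, ~ (`]a i, b i[%classic : set R) (x ord0 i).
  by apply/existsNP.
rewrite /bump (bigD1 i)//=.
have [ai|ai] := leP (x ord0 i) (a i).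
  by rewrite flat_le0 ?mul0r// subr_le0.
have [bi|bi] := leP (b i) (x ord0 i).
  by rewrite [X in _ * X * _]flat_le0 ?mulr0 ?mul0r// subr_le0.
by exfalso; apply: ni; rewrite /= in_itv/= ai bi.
Qed.

Lemma bump_bounds s a b x : 0 < s -> 0 <= bump s a b x <= 1.
Proof.
move=> s0; apply/andP; split.
  by apply: prodr_ge0 => i _; rewrite mulr_ge0 ?flat_ge0.
by apply: prodr_ile1 => i _; rewrite mulr_ge0 ?flat_ge0//= mulr_ile1 ?flat_ge0 ?flat0_le1.
Qed.

Lemma bump_smooth s a b : 0 < s -> smooth (bump s a b).
Proof.
move=> s0; apply: Ck_smooth => k; apply: Ck_prod => i; apply: CkM.
  apply: (Ck_comp (F := flat s 0)); first exact: Ck_flat.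
  by apply: CkD; [exact: Ck_coord|exact: Ck_cst].
apply: (Ck_comp (F := flat s 0)); first exact: Ck_flat.
apply: CkD; first exact: Ck_cst.
have -> : (fun x : 'rV[R]_N => - x ord0 i) = (fun x => (-1) * x ord0 i).
  by apply/funext => x; rewrite mulN1r.
by apply: CkM; [exact: Ck_cst|exact: Ck_coord].
Qed.

Lemma bump_test s a b : 0 < s -> closed_box a b `<=` Omega ->
  test_function Omega (bump s a b).
Proof.
move=> s0 abO.
have sub : Defs.support (bump s a b) `<=` closed_box a b.
  rewrite [X in _ `<=` X](closure_id _).1; last exact: closed_closed_box.
  apply: closure_subset => x /= bx i.
  have [|nx] := pselect (open_box a b x).
    by move=> /(_ i); rewrite /= !in_itv/= => /andP[/ltW -> /ltW ->].
  by move: bx; rewrite bump_out// eqxx.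
split; first exact: bump_smooth.
- apply: subclosed_compact (@compact_closed_box a b) sub; exact: closed_closure.
- exact: subset_trans abO.
Qed.

Lemma bump_cvg a b x :
  bump k.+1%:R^-1 a b x @[k --> \oo] --> ((\1_(open_box a b) x : R)).
Proof.
rewrite indicE; case: (boolP (x \in open_box a b)) => [|/negP nx]; last first.
  have E k : bump k.+1%:R^-1 a b x = 0.
    by rewrite bump_out// => xo; apply: nx; rewrite inE.
  by under eq_cvg do rewrite E; exact: cvg_cst.
rewrite inE => xo.
suff : bump k.+1%:R^-1 a b x @[k --> \oo] --> (\prod_(i < N) (1 * 1) : R).
  by rewrite big1// => i _; rewrite mulr1.
apply: cvg_big => [|i _]; first exact: mul_continuous.
have := xo i; rewrite /= in_itv/= => /andP[ai bi].
by apply: cvgM; apply: flat_cvg1; rewrite subr_gt0.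
Qed.

(** Letting bumps tend to the indicator of an open box shows that the integral of
    g vanishes on the boxes inside Omega, hence g = 0 almost everywhere on each of
    them, and countably many rational boxes cover Omega. *)
Lemma fundamental_lemma g : locally_integrable_on Omega g ->
  (forall phi, test_function Omega phi -> \int[mu]_(x in Omega) (g x * phi x) = 0) ->
  {ae mu, forall x, Omega x -> g x = 0}.
Proof.
move=> [mg gloc] g0.
have mO : measurable Omega by exact: open_measurable_rV.
have box0 a b : closed_box a b `<=` Omega -> \int[mu]_(x in open_box a b) g x = 0.
  move=> abO; set K := closed_box a b; set B := open_box a b.
  have BK : B `<=` K.
    by move=> x Bx i; have := Bx i; rewrite /= !in_itv/= => /andP[/ltW -> /ltW ->].
  have mK : measurable K by apply: closed_measurable_rV; exact: closed_closed_box.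
  have mB : measurable B by apply: measurable_box => i.
  have gK : mu.-integrable K (EFin \o g) by apply: gloc => //; exact: compact_closed_box.
  have mgK := integrable_measurable gK.
  have E k : \int[mu]_(x in K) (g x * bump k.+1%:R^-1 a b x) = 0.
    have s0 : 0 < k.+1%:R^-1 :> R by rewrite invr_gt0.
    rewrite -(g0 _ (bump_test s0 abO)) Rintegral_mkcond [RHS]Rintegral_mkcond.
    congr (Rintegral _ _ _); apply/funext => x; rewrite !patchE.
    have [Kx|nKx] := pselect (K x).
      by rewrite !mem_set//; exact: abO.
    rewrite memNset//; case: ifPn => // _; rewrite bump_out ?mulr0// => /BK.
    exact.
  have : (fun k => \int[mu]_(x in K) (g x * bump k.+1%:R^-1 a b x)) @ \oo -->
      \int[mu]_(x in K) (g x * \1_B x).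
    apply: (@Rintegral_dominated _ _ _ mu K mK _ _ (fun x => `|g x|)).
    - move=> k; apply: measurable_funM => //.
      apply: measurable_funS measurableT (@subsetT _ _) _.
      apply: continuous_measurable_rV; apply: smooth_continuous.
      by apply: bump_smooth; rewrite invr_gt0.
    - have m1 : measurable_fun K (\1_B : 'rV[R]_N -> R).
        apply: measurable_funTS; exact: measurable_indic.
      exact: measurable_funM.
    - exact: integrable_norm.
    - move=> k x _; rewrite normrM ler_piMr//.
      have s0 : 0 < k.+1%:R^-1 :> R by rewrite invr_gt0.
      by have /andP[b0 b1] := bump_bounds a b x s0; rewrite ger0_norm.
    - by apply: aeW => x _; apply: cvgMl_tmp; exact: bump_cvg.
  move=> /cvg_lim H; have {}H : \int[mu]_(x in K) (g x * \1_B x) = 0.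
    by rewrite -H//; under eq_fun do rewrite E; rewrite lim_cst.
  rewrite -H Rintegral_mkcond [RHS]Rintegral_mkcond.
  congr (Rintegral _ _ _); apply/funext => x; rewrite !patchE indicE.
  have [Bx|nBx] := pselect (B x).
    by rewrite !mem_set ?mulr1//; exact: BK.
  by rewrite (memNset nBx) mulr0; case: ifP.
pose good (q : {ffun 'I_N -> rat * rat}) := box (closed_rat_box q : 'I_N -> set R) `<=` Omega.
have ae_good q : good q -> {ae mu, forall x, box (rat_box q) x -> g x = 0}.
  move=> gq; have mQ := @measurable_rat_box R N q.
  have closedE : box (closed_rat_box q : 'I_N -> set R) =
      closed_box (fun i => ratr (q i).1) (fun i => ratr (q i).2).
    by apply/seteqP; split => x xi i; have := xi i; rewrite /= in_itv.
  apply: ae0_open_boxes => //.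
    apply: (@integrableS _ _ _ _ (box (closed_rat_box q))) => //.
    - by rewrite closedE; apply: closed_measurable_rV; exact: closed_closed_box.
    - by move=> x xq i; have /andP[a b] := xq i; rewrite /closed_rat_box/= !ltW.
    - by apply: gloc => //; rewrite closedE; exact: compact_closed_box.
  move=> _ [A HA ->].
  have /choice[ab abP] : forall i, exists ab : R * R,
      [/\ A i `&` rat_box q i = `]ab.1, ab.2[%classic, ratr (q i).1 <= ab.1 & ab.2 <= ratr (q i).2].
    move=> i; case: (HA i) => [->|[a [b ->]]].
      exists (ratr (q i).1, ratr (q i).2); split => //.
      by rewrite setTI; apply/seteqP; split => t /=; rewrite in_itv.
    exists (Num.max a (ratr (q i).1), Num.min b (ratr (q i).2)); split => /=.
    - apply/seteqP; split => t /=; rewrite !in_itv/= /rat_box/= gt_max lt_min.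
        by move=> [/andP[-> ->] /andP[-> ->]].
      by move=> /andP[/andP[-> ->] /andP[-> ->]].
    - by rewrite le_max lexx orbT.
    - by rewrite ge_min lexx orbT.
  rewrite (_ : box A `&` _ = open_box (fun i => (ab i).1) (fun i => (ab i).2)).
    apply: box0 => x xab; apply: gq => i; have [_ a1 b1] := abP i.
    have := xab i; rewrite /closed_rat_box/= in_itv/= => /andP[a2 b2].
    by rewrite (le_trans a1 a2) (le_trans b2 b1).
  apply/seteqP; split => [x [xA xq] i|x xab].
    by have [<- _ _] := abP i; split; [exact: xA|exact: xq].
  by split => i; have := xab i; have [<- _ _] := abP i => -[].
(* All rational boxes at once, enumerated by their codes. *)
have : {ae mu, forall x, forall k : nat,
    if unpickle k is Some q then good q -> box (rat_box q) x -> g x = 0 else True}.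
  apply: ae_foralln => k; case: unpickle => [q|]; last exact: aeW.
  have [gq|ngq] := pselect (good q); last exact: aeW.
  by apply: filterS (ae_good _ gq) => x Hx _; exact: Hx.
apply: filterS => x Hx Ox; have [q [xq qO]] := open_rat_box oO Ox.
by have := Hx (pickle q); rewrite pickleK; apply.
Qed.

End fundamental_lemma.

(** * Weak gradients *)

Section pairing.
Context d (T : measurableType d) (R : realType)
  (mu : {measure set T -> \bar R}) (D : set T) (mD : measurable D).

(** Continuity of the pairing with a fixed h, for the topology of L^p. *)
Lemma pairing_small (p q : R) (h : T -> R) e : 0 < p -> 0 < q -> p^-1 + q^-1 = 1 ->
  Lp mu D q h -> 0 < e -> exists2 r, 0 < r & forall g, Lp mu D p g ->
    energy mu D p g <= r -> `|\int[mu]_(x in D) (h x * g x)| <= e.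
Proof.
move=> p0 q0 pq hq e0; have Eh := energy_ge0 mu D q h.
have [c c0 H] := @young_Rintegral _ T R mu D mD p q
  (e / 2 / (energy mu D q h + 1)) p0 q0 pq
  ltac:(by rewrite !divr_gt0// ltr_wpDl).
exists (e / 2 / (c + 1)) => [|g gp gr]; first by rewrite !divr_gt0// ltr_wpDl.
apply: le_trans (H _ _ hq gp) _.
have e2 : 0 < e / 2 by rewrite divr_gt0.
rewrite [leRHS](_ : e = e / 2 + e / 2); last by lra.
apply: lerD.
  rewrite mulrAC ler_pdivrMr; last by rewrite ltr_wpDl.
  by rewrite ler_pM2l// lerDl.
apply: le_trans (ler_wpM2l c0 gr) _.
rewrite mulrA ler_pdivrMr; last by rewrite ltr_wpDl.
by rewrite mulrC ler_pM2l// lerDl.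
Qed.

Lemma ae_ord (n : nat) (P : 'I_n -> T -> Prop) :
  (forall i, {ae mu, forall x, P i x}) -> {ae mu, forall x, forall i, P i x}.
Proof.
move=> aeP.
have : {ae mu, forall x, forall k : nat, if insub k is Some i then P i x else True}.
  by apply: ae_foralln => k; case: insubP => [i _ _|_]; [exact: aeP|exact: aeW].
by apply: filterS => x Px i; have := Px (val i); rewrite valK.
Qed.

End pairing.

Section weak_gradients.
Context {R : realType} {N : nat} (Omega : set 'rV[R]_N) (M : R).
Hypotheses (oO : open Omega) (OM : Omega `<=` cube M).
Local Notation mu := (lebesgue_rV N).
Implicit Types (phi eta u v : 'rV[R]_N -> R) (G H : 'rV[R]_N -> 'rV[R]_N) (p : R).

Let mO : measurable Omega. Proof. exact: open_measurable_rV. Qed.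

(** On a bounded domain |u| <= 1 + |u|^p is integrable. *)
Lemma Lp_integrable p u : 1 < p -> Lp mu Omega p u -> mu.-integrable Omega (EFin \o u).
Proof.
move=> p1 [mu_ ui].
have i1 : mu.-integrable Omega (EFin \o (fun=> 1 : R)).
  apply: (@integrableS _ _ _ _ (cube M)) => //; first exact: measurable_cube.
  apply: measurable_bounded_integrable => //.
  - exact: measurable_cube.
  - exact: cube_lty.
  - exists 1; split => // x x1 y _ /=; rewrite normr1; exact: ltW.
apply: integrable_dominated (integrable_add mO i1 ui) => // x _.
have [le|gt] := leP `|u x| 1; first by rewrite (le_trans le)// lerDl powR_ge0.
have := @le1r_powR R `|u x| p (ltW gt) (ltW p1) => /le_trans; apply.
by rewrite lerDr.
Qed.

Lemma Lp_locally_integrable p u : 1 < p -> Lp mu Omega p u ->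
  locally_integrable_on Omega u.
Proof.
move=> p1 up; split => [|K cK KO]; first by case: up.
apply: integrableS (Lp_integrable p1 up) => //.
by apply: closed_measurable_rV; exact: compact_closed.
Qed.

(** The support of phi is a compact set on which g is integrable, and eta is
    bounded. *)
Lemma locally_integrable_mul g phi eta : locally_integrable_on Omega g ->
  test_function Omega phi -> continuous eta -> (forall x, ~ Defs.support phi x -> eta x = 0) ->
  mu.-integrable Omega (EFin \o (fun x => g x * eta x)).
Proof.
move=> [mg gl] tp ce e0; have [sp cp sub] := tp.
have mK : measurable (Defs.support phi) by apply: closed_measurable_rV; exact: closed_closure.
have gK := gl _ cp sub.
have [c c0 ec] : exists2 c, 0 <= c & forall x, `|eta x| <= c.
  apply: (@vanish_bounded _ _ M) => // x nx; apply: e0 => sx; apply: nx.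
  by apply: OM; exact: sub.
have gi : mu.-integrable Omega (EFin \o (fun x => (c * `|g x|) * \1_(Defs.support phi) x)).
  have : mu.-integrable Omega ((EFin \o (fun x => c * `|g x|)) \_ (Defs.support phi)).
    apply/integrable_restrict => //; rewrite setIidr//.
    by apply: integrable_scale => //; exact: integrable_norm.
  apply: eq_integrable => // x _ /=; rewrite patchE indicE.
  by case: ifPn => _; rewrite ?mulr1 ?mulr0.
apply: integrable_dominated gi => //.
  apply: measurable_funM => //.
  by apply: measurable_funTS; exact: continuous_measurable_rV.
move=> x Ox; rewrite normrM indicE; case: (boolP (x \in _)) => [_|/negP nx].
  by rewrite mulr1 mulrC ler_wpM2r.
by rewrite e0 ?normr0 ?mulr0// => sx; apply: nx; rewrite inE.
Qed.

Lemma support_out phi x : ~ Defs.support phi x -> phi x = 0.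
Proof.
move=> nx; apply/eqP/negPn/negP => px; apply: nx; exact: subset_closure.
Qed.

Lemma partial_support_out phi i x : ~ Defs.support phi x -> partial i phi x = 0.
Proof.
move=> nsx.
have near0 : \forall y \near x, (cst 0 : _ -> R) y = phi y.
  have : nbhs x (~` Defs.support phi).
    by apply: open_nbhs_nbhs; split => //; apply: closed_openC; exact: closed_closure.
  by apply: filterS => y nsy; rewrite (support_out nsy).
by rewrite /partial -(near_eq_derive _ near0) derive_cst.
Qed.

Lemma locally_integrable_test g phi : locally_integrable_on Omega g ->
  test_function Omega phi ->
  mu.-integrable Omega (EFin \o (fun x => g x * phi x)).
Proof.
move=> gl tp; apply: (locally_integrable_mul gl tp).
  exact/smooth_continuous/(test_smooth tp).
exact: support_out.
Qed.

Lemma locally_integrable_partial g phi i : locally_integrable_on Omega g ->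
  test_function Omega phi ->
  mu.-integrable Omega (EFin \o (fun x => g x * partial i phi x)).
Proof.
move=> gl tp; apply: (locally_integrable_mul gl tp).
  exact: partial_continuous tp.
by move=> x; exact: partial_support_out.
Qed.

Lemma locally_integrableD g h : locally_integrable_on Omega g ->
  locally_integrable_on Omega h -> locally_integrable_on Omega (fun x => g x + h x).
Proof.
move=> [mg gl] [mh hl]; split; first exact: measurable_funD.
move=> K cK KO; apply: integrable_add; [|exact: gl|exact: hl].
by apply: closed_measurable_rV; exact: compact_closed.
Qed.

Lemma locally_integrableZ c g : locally_integrable_on Omega g ->
  locally_integrable_on Omega (fun x => c * g x).
Proof.
move=> [mg gl]; split; first exact: measurable_funM.
move=> K cK KO; apply: integrable_scale; last exact: gl.
by apply: closed_measurable_rV; exact: compact_closed.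
Qed.

Lemma weak_gradient_unique u v G H : is_weak_gradient Omega u G ->
  is_weak_gradient Omega v H -> {ae mu, forall x, Omega x -> u x = v x} ->
  {ae mu, forall x, Omega x -> G x = H x}.
Proof.
move=> [lu wG] [lv wH] uv.
suff : {ae mu, forall x, forall i : 'I_N, Omega x -> G x ord0 i = H x ord0 i}.
  by apply: filterS => x E Ox; apply/rowP => i; exact: E.
apply: ae_ord => i; have [lG iG] := wG i; have [lH iH] := wH i.
have : {ae mu, forall x, Omega x -> G x ord0 i + (-1) * H x ord0 i = 0}.
  apply: fundamental_lemma => //.
    by apply: locally_integrableD => //; exact: locally_integrableZ.
  move=> phi tp.
  have E : \int[mu]_(x in Omega) (u x * partial i phi x) =
      \int[mu]_(x in Omega) (v x * partial i phi x).
    apply: Rintegral_eq_ae => //.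
    - exact/integrable_measurable/locally_integrable_partial.
    - exact/integrable_measurable/locally_integrable_partial.
    - by apply: filterS uv => x uv Ox; rewrite uv.
  transitivity (\int[mu]_(x in Omega) (G x ord0 i * phi x - H x ord0 i * phi x)).
    by apply: eq_Rintegral => x _; ring.
  rewrite RintegralB//; [|exact: locally_integrable_test|exact: locally_integrable_test].
  apply/eqP; rewrite subr_eq0 -eqr_opp -iG// -iH//; exact/eqP.
by apply: filterS => x E Ox; have := E Ox; rewrite mulN1r => /subr0_eq.
Qed.

Lemma weak_gradientD u v G H : is_weak_gradient Omega u G ->
  is_weak_gradient Omega v H ->
  is_weak_gradient Omega (fun x => u x + v x) (fun x => G x + H x).
Proof.
move=> [lu wG] [lv wH]; split; first exact: locally_integrableD.
move=> i; have [lG iG] := wG i; have [lH iH] := wH i; split.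
  under eq_fun do rewrite mxE; exact: locally_integrableD.
move=> phi tp.
under eq_Rintegral do rewrite mulrDl.
under [in RHS]eq_Rintegral do rewrite mxE mulrDl.
rewrite RintegralD//; try exact: locally_integrable_partial.
rewrite RintegralD//; try exact: locally_integrable_test.
by rewrite iG// iH// opprD.
Qed.

Lemma weak_gradientZ c u G : is_weak_gradient Omega u G ->
  is_weak_gradient Omega (fun x => c * u x) (fun x => c *: G x).
Proof.
move=> [lu wG]; split; first exact: locally_integrableZ.
move=> i; have [lG iG] := wG i; split.
  under eq_fun do rewrite mxE; exact: locally_integrableZ.
move=> phi tp.
under eq_Rintegral do rewrite -mulrA.
under [in RHS]eq_Rintegral do rewrite mxE -mulrA.
rewrite RintegralZl//; last exact: locally_integrable_partial.
rewrite RintegralZl//; last exact: locally_integrable_test.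
by rewrite iG// mulrN.
Qed.

Lemma test_weak_gradient phi : test_function Omega phi ->
  is_weak_gradient Omega phi (grad phi).
Proof.
move=> tp; have lt1 : (1 : R) < 2 by lra.
have lt0 : (0 : R) < 2 by lra.
split; first exact: Lp_locally_integrable lt1 (test_Lp oO OM lt0 tp).
move=> i; split.
  under eq_fun do rewrite mxE.
  exact: Lp_locally_integrable lt1 (partial_Lp oO OM i lt0 tp).
move=> eta te; under [in RHS]eq_Rintegral do rewrite mxE.
exact: integral_by_parts oO OM _ _ _ tp te.
Qed.

Lemma wgradP u G : is_weak_gradient Omega u G ->
  is_weak_gradient Omega u (wgrad Omega u).
Proof. by move=> wG; apply: (@getPex _ [set G | is_weak_gradient Omega u G]); exists G. Qed.

End weak_gradients.

(** * Limits of test functions *)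

Section fast_energy.
Context d (T : measurableType d) (R : realType)
  (mu : {measure set T -> \bar R}) (D : set T) (mD : measurable D).

(** An energy below 4^-n makes 2^n |h n|^p bounded almost everywhere. *)
Lemma fast_energy_cvg0 (p : R) (h : nat -> T -> R) : 0 < p ->
  (forall n, Lp mu D p (h n)) -> (forall n, energy mu D p (h n) <= 4^-1 ^+ n) ->
  {ae mu, forall x, D x -> h n x @[n --> \oo] --> 0}.
Proof.
move=> p0 hp he.
have := @Rintegral_fast_bounded _ _ _ mu D mD (fun n x => 2 ^+ n * `|h n x| `^ p).
have H1 n : mu.-integrable D (EFin \o (fun x => 2 ^+ n * `|h n x| `^ p)).
  by apply: integrable_scale => //; case: (hp n).
have H2 n x : D x -> 0 <= 2 ^+ n * `|h n x| `^ p by rewrite mulr_ge0 ?powR_ge0.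
have H3 n : \int[mu]_(x in D) (2 ^+ n * `|h n x| `^ p) <= 2^-1 ^+ n.
  rewrite RintegralZl//; last by case: (hp n).
  apply: le_trans (ler_wpM2l _ (he n)) _; first exact: exprn_ge0.
  by rewrite -exprMn (_ : 2 * 4^-1 = 2^-1)//; field.
move=> /(_ H1 H2 H3); apply: filterS => x + Dx => /(_ Dx) [c hc].
have c0 : 0 <= c by apply: le_trans (hc 0%N); rewrite mulr_ge0 ?powR_ge0.
have cv : `|h n x| `^ p @[n --> \oo] --> (0 : R).
  apply: (@squeeze_cvgr _ _ _ _ (fun=> 0) (fun n => c * 2^-1 ^+ n)).
  - near=> n; rewrite powR_ge0/= exprVn ler_pdivlMr ?exprn_gt0// mulrC; exact: hc.
  - exact: cvg_cst.
  - by apply: (@cvg_geometric _ c (2^-1)); rewrite ger0_norm//; lra.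
apply/norm_cvg0P.
have -> : (fun n => `|h n x|) = (fun n => `| `|h n x| `^ p | `^ p^-1).
  apply/funext => n; rewrite (ger0_norm (powR_ge0 _ _)) -powRrM mulfV ?gt_eqF//.
  by rewrite powRr1.
have ip : 0 < p^-1 by rewrite invr_gt0.
have := continuous_cvg _ (@continuous_abs_powR R _ ip 0) cv.
by rewrite normr0 powR0 ?gt_eqF//; apply.
Unshelve. all: by end_near. Qed.

End fast_energy.

Section sobolev_pairs.
Context {R : realType} {N : nat} (Omega : set 'rV[R]_N) (M : R).
Hypotheses (oO : open Omega) (OM : Omega `<=` cube M).
Variables (p : R).
Hypothesis (p1 : 1 < p).
Local Notation mu := (lebesgue_rV N).
Local Notation Lp := (Lp mu Omega p).
Local Notation energy := (energy mu Omega p).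
Implicit Types (phi eta u v w : 'rV[R]_N -> R) (G H K : 'rV[R]_N -> 'rV[R]_N)
  (Q : ('rV[R]_N -> R) -> Prop).

Let mO : measurable Omega. Proof. exact: open_measurable_rV. Qed.
Let p0 : 0 < p. Proof. exact: lt_trans p1. Qed.

Definition Lpv G := forall i, Lp (fun x => G x ord0 i).

Definition denergy G H := \sum_(i < N) energy (fun x => G x ord0 i - H x ord0 i).

(** Pairs (u, G) that are limits of pairs (phi, grad phi).  Carrying the field
    avoids the choice of a representative of the weak gradient, and the property
    [Q] of the test functions allows approximations by nonnegative ones. *)
Definition Sob Q u G := [/\ Lp u, Lpv G & forall e, 0 < e -> exists phi,
  [/\ test_function Omega phi, Q phi, energy (fun x => u x - phi x) <= e &
      denergy G (grad phi) <= e]].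

Definition any_test phi := True.
Definition nonneg_test phi := forall x, 0 <= phi x.

Lemma denergy_ge0 G H : 0 <= denergy G H.
Proof. by apply: sumr_ge0 => i _; exact: energy_ge0. Qed.

Lemma denergyC G H : denergy G H = denergy H G.
Proof. by apply: eq_bigr => i _; exact: energyBC. Qed.

Lemma denergy_self G : denergy G G = 0.
Proof.
by rewrite /denergy big1// => i _; apply: energy_subrr; exact: lt0r_neq0.
Qed.

Lemma denergy_coord G H i : energy (fun x => G x ord0 i - H x ord0 i) <= denergy G H.
Proof.
rewrite /denergy (bigD1 i)//= lerDl; apply: sumr_ge0 => j _; exact: energy_ge0.
Qed.

Lemma denergy_tri G H K : Lpv G -> Lpv H -> Lpv K ->
  denergy G K <= 2 `^ p * (denergy G H + denergy H K).
Proof.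
move=> Gp Hp Kp; rewrite -big_split/= mulr_sumr; apply: ler_sum => i _.
exact: energy_tri.
Qed.

Lemma LpvD G H : Lpv G -> Lpv H -> Lpv (fun x => G x + H x).
Proof.
by move=> Gp Hp i; under eq_fun do rewrite mxE; exact: LpD.
Qed.

Lemma LpvZ c G : Lpv G -> Lpv (fun x => c *: G x).
Proof. by move=> Gp i; under eq_fun do rewrite mxE; exact: LpZ. Qed.

Lemma LpvB G H : Lpv G -> Lpv H -> Lpv (fun x => G x - H x).
Proof.
by move=> Gp Hp i; under eq_fun do rewrite !mxE; exact: LpB.
Qed.

Lemma grad_Lpv phi : test_function Omega phi -> Lpv (grad phi).
Proof.
move=> tp i; rewrite (_ : (fun x => grad phi x ord0 i) = partial i phi); last first.
  by apply/funext => x; rewrite mxE.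
exact: (partial_Lp oO OM i p0 tp).
Qed.

Lemma SobW Q u G : Sob Q u G -> Sob any_test u G.
Proof.
by move=> [up Gp H]; split => // e /H[phi [tp _ ? ?]]; exists phi; split.
Qed.

Lemma Sob_test Q phi : test_function Omega phi -> Q phi -> Sob Q phi (grad phi).
Proof.
move=> tp Qp; split; first exact: (test_Lp oO OM p0 tp).
  exact: grad_Lpv.
move=> e e0; exists phi; split => //; last by rewrite denergy_self ltW.
by rewrite energy_subrr ?(ltW e0)//; exact: lt0r_neq0.
Qed.

Lemma Sob_closed Q u G : Lp u -> Lpv G -> (forall e, 0 < e -> exists v H,
    [/\ Sob Q v H, energy (fun x => u x - v x) <= e & denergy G H <= e]) ->
  Sob Q u G.
Proof.
move=> up Gp S; split => // e e0.
pose r := e / (2 `^ p * 2).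
have pp : 0 < 2 `^ p :> R by rewrite powR_gt0.
have r0 : 0 < r by rewrite divr_gt0// mulr_gt0.
have er : e = 2 `^ p * (r + r) by rewrite /r; field; rewrite gt_eqF.
have [v [H [[vp Hp vH] uv GH]]] := S r r0.
have [phi [tp Qp vphi Hphi]] := vH r r0; exists phi; split => //; rewrite er.
  apply: le_trans (energy_tri mO p0 up vp (test_Lp oO OM p0 tp)) _.
  exact: (ler_wpM2l (ltW pp) (lerD uv vphi)).
apply: le_trans (denergy_tri Gp Hp (grad_Lpv tp)) _.
exact: (ler_wpM2l (ltW pp) (lerD GH Hphi)).
Qed.

Lemma grad_add phi eta x : smooth phi -> smooth eta ->
  grad (fun x => phi x + eta x) x = grad phi x + grad eta x.
Proof.
move=> sp se; apply/rowP => i; rewrite !mxE.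
by have [_] := is_derive_add (smooth_is_derive i x sp) (smooth_is_derive i x se).
Qed.

Lemma grad_scale c phi x : smooth phi ->
  grad (fun x => c * phi x) x = c *: grad phi x.
Proof.
move=> sp; apply/rowP => i; rewrite !mxE.
have [_ D] := is_derive_mul (is_derive_const c x (delta_mx ord0 i)) (smooth_is_derive i x sp).
by rewrite mulr0 addr0 in D.
Qed.

Lemma grad_comp (F dF : R -> R) phi x : (forall t : R, is_derive t (1 : R) F (dF t)) ->
  smooth phi -> grad (fun x => F (phi x)) x = dF (phi x) *: grad phi x.
Proof.
move=> FdF sp; apply/rowP => i; rewrite !mxE.
by have [_] := is_derive_comp_scalar (FdF (phi x)) (smooth_is_derive i x sp).
Qed.

Lemma SobD u v G H : Sob any_test u G -> Sob any_test v H ->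
  Sob any_test (fun x => u x + v x) (fun x => G x + H x).
Proof.
move=> [up Gp uG] [vp Hp vH]; split; [exact: LpD|exact: LpvD|move=> e e0].
have pp : 0 < 2 `^ p :> R by rewrite powR_gt0.
pose r := e / (2 `^ p * 2).
have r0 : 0 < r by rewrite divr_gt0// mulr_gt0.
have er : e = 2 `^ p * (r + r) by rewrite /r; field; rewrite gt_eqF.
have [phi [tp _ u1 u2]] := uG r r0; have [eta [te _ v1 v2]] := vH r r0.
exists (fun x => phi x + eta x); split => //; first exact: testD.
  rewrite er (_ : energy _ = energy (fun x => (u x - phi x) + (v x - eta x))); last first.
    by apply: eq_Rintegral => x _; congr (`|_| `^ _); ring.
  apply: le_trans (energyD mO p0 _ _) _.
  - exact: (LpB mO p0 up (test_Lp oO OM p0 tp)).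
  - exact: (LpB mO p0 vp (test_Lp oO OM p0 te)).
  - exact: (ler_wpM2l (ltW pp) (lerD u1 v1)).
rewrite er; apply: (@le_trans _ _ (2 `^ p * (denergy G (grad phi) + denergy H (grad eta)))).
  rewrite -big_split/= mulr_sumr; apply: ler_sum => i _.
  rewrite (_ : energy _ = energy (fun x => (G x ord0 i - grad phi x ord0 i) +
      (H x ord0 i - grad eta x ord0 i))); last first.
    apply: eq_Rintegral => x _; congr (`|_| `^ _).
    rewrite (grad_add x (test_smooth tp) (test_smooth te)) !mxE; ring.
  apply: energyD => //.
  - exact: (LpB mO p0 (Gp i) (grad_Lpv tp i)).
  - exact: (LpB mO p0 (Hp i) (grad_Lpv te i)).
exact: (ler_wpM2l (ltW pp) (lerD u2 v2)).
Qed.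

Lemma SobZ c u G : Sob any_test u G ->
  Sob any_test (fun x => c * u x) (fun x => c *: G x).
Proof.
move=> [up Gp uG]; split; [exact: LpZ|exact: LpvZ|move=> e e0].
have c1 : 0 < `|c| `^ p + 1 by rewrite ltr_wpDl ?powR_ge0.
have [phi [tp _ u1 u2]] := uG (e / (`|c| `^ p + 1)) (divr_gt0 e0 c1).
have le t : t <= e / (`|c| `^ p + 1) -> 0 <= t -> `|c| `^ p * t <= e.
  rewrite ler_pdivlMr// => te t0; apply: le_trans te.
  by rewrite mulrC ler_wpM2l// lerDl.
exists (fun x => c * phi x); split => //; first exact: testZ.
  rewrite (_ : energy _ = energy (fun x => c * (u x - phi x))); last first.
    by apply: eq_Rintegral => x _; rewrite mulrBr.
  rewrite energyZ//; last exact: (LpB mO p0 up (test_Lp oO OM p0 tp)).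
  by apply: le => //; exact: energy_ge0.
rewrite (_ : denergy _ _ = `|c| `^ p * denergy G (grad phi)); last first.
  rewrite /denergy mulr_sumr; apply: eq_bigr => i _.
  rewrite -(energyZ mO c p0 (LpB mO p0 (Gp i) (grad_Lpv tp i))).
  apply: eq_Rintegral => x _; congr (`|_| `^ _).
  by rewrite (grad_scale c x (test_smooth tp)) !mxE mulrBr.
by apply: le => //; exact: denergy_ge0.
Qed.

Lemma SobB u v G H : Sob any_test u G -> Sob any_test v H ->
  Sob any_test (fun x => u x - v x) (fun x => G x - H x).
Proof.
move=> uG vH; have := SobD uG (SobZ (-1) vH).
rewrite (_ : (fun x => u x + -1 * v x) = (fun x => u x - v x)); last first.
  by apply/funext => x; rewrite mulN1r.
by rewrite (_ : (fun x => G x + -1 *: H x) = (fun x => G x - H x))//; apply/funext => x; rewrite scaleN1r.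
Qed.

Lemma Sob_eq_ae Q u v G H : Sob Q u G -> measurable_fun Omega v ->
  (forall i, measurable_fun Omega (fun x => H x ord0 i)) ->
  {ae mu, forall x, Omega x -> u x = v x} ->
  {ae mu, forall x, Omega x -> G x = H x} -> Sob Q v H.
Proof.
move=> uG mv mH uv GH; have [up Gp _] := uG.
have vp : Lp v by apply: Lp_eq_ae up.
have Hp : Lpv H.
  move=> i; apply: Lp_eq_ae (Gp i) => //.
  by apply: filterS GH => x E Ox; rewrite E.
apply: Sob_closed => // e e0; exists u, G; split => //.
  rewrite energy_eq0_ae ?(ltW e0)//; first exact: lt0r_neq0.
    by case: up.
  by apply: filterS uv => x E Ox; rewrite E.
rewrite /denergy big1 ?(ltW e0)// => i _; apply: energy_eq0_ae => //.
- exact: lt0r_neq0.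
- by case: (Gp i).
- by apply: filterS GH => x E Ox; rewrite E.
Qed.

(** Integration by parts against a test function phi passes to the limit, since
    phi and its derivatives lie in the dual L^q. *)
Lemma Sob_weak_gradient Q u G : Sob Q u G -> is_weak_gradient Omega u G.
Proof.
move=> [up Gp uG]; split; first exact: (Lp_locally_integrable oO OM p1 up).
move=> i; split; first exact: (Lp_locally_integrable oO OM p1 (Gp i)).
move=> phi tp.
have [q [q0 pq _]] := conjugate_exists p1.
have pLq := test_Lp oO OM q0 tp; have dLq := partial_Lp oO OM i q0 tp.
apply/eqP; rewrite -subr_eq0 opprK -normr_le0.
apply/ler_addgt0Pr => e e0; rewrite add0r.
have e2 : 0 < e / 2 by rewrite divr_gt0.
have [r1 r10 H1] := pairing_small mO p0 q0 pq dLq e2.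
have [r2 r20 H2] := pairing_small mO p0 q0 pq pLq e2.
have r0 : 0 < Num.min r1 r2 by rewrite lt_min r10.
have m1 : Num.min r1 r2 <= r1 by rewrite ge_min lexx.
have m2 : Num.min r1 r2 <= r2 by rewrite ge_min lexx orbT.
have [eta [te _ u1 u2]] := uG _ r0.
have etap := test_Lp oO OM p0 te; have detap := partial_Lp oO OM i p0 te.
have B1 := H1 _ (LpB mO p0 up etap) (le_trans u1 m1).
have detap' : Lp (fun x => grad eta x ord0 i) by exact: grad_Lpv.
have B2 := H2 _ (LpB mO p0 (Gp i) detap') (le_trans (denergy_coord _ _ _) (le_trans u2 m2)).
have i1 := Lp_mul mO p0 q0 pq dLq up; have i2 := Lp_mul mO p0 q0 pq dLq etap.
have i3 := Lp_mul mO p0 q0 pq pLq (Gp i); have i4 := Lp_mul mO p0 q0 pq pLq detap'.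
have ibp := integral_by_parts oO OM i te tp.
have -> : \int[mu]_(x in Omega) (u x * partial i phi x) +
    \int[mu]_(x in Omega) (G x ord0 i * phi x) =
  \int[mu]_(x in Omega) (partial i phi x * (u x - eta x)) +
  \int[mu]_(x in Omega) (phi x * (G x ord0 i - grad eta x ord0 i)).
  under [X in _ = X + _]eq_Rintegral do rewrite mulrBr.
  under [X in _ = _ + X]eq_Rintegral do rewrite mulrBr.
  rewrite !RintegralB//.
  under eq_Rintegral do rewrite mulrC.
  under [X in _ + X = _]eq_Rintegral do rewrite mulrC.
  have -> : \int[mu]_(x in Omega) (partial i phi x * eta x) =
      - \int[mu]_(x in Omega) (phi x * grad eta x ord0 i).
    under eq_Rintegral do rewrite mulrC.
    rewrite ibp; congr (- _); apply: eq_Rintegral => x _.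
    by rewrite mxE mulrC.
  ring.
apply: le_trans (ler_normD _ _) _.
by have := lerD B1 B2; lra.
Qed.

(** Density, with the constant of test functions enlarged by the two
    quasi-triangle inequalities. *)
Lemma Sob_poincare (i : 'I_N) : 0 < M -> exists2 c, 0 <= c & forall u G,
  Sob any_test u G -> energy u <= c * energy (fun x => G x ord0 i).
Proof.
move=> M0; have [c c0 P] := poincare_test oO OM i p1 M0.
have pp : 0 < 2 `^ p :> R by rewrite powR_gt0.
exists (2 `^ p * c * 2 `^ p) => [|u G [up Gp uG]]; first by rewrite !mulr_ge0 ?(ltW pp).
apply/ler_addgt0Pr => e e0.
(* The total weight of the two approximation errors in the estimate. *)
pose b := 2 `^ p * (1 + c * 2 `^ p).
have b0 : 0 < b.
  by rewrite mulr_gt0// ltr_pwDl// mulr_ge0// ltW.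
have [phi [tp _ u1 u2]] := uG (e / b) (divr_gt0 e0 b0).
have phip := test_Lp oO OM p0 tp; have dphip := grad_Lpv tp i.
have D1 : energy u <= 2 `^ p * (energy (fun x => u x - phi x) + energy phi).
  rewrite (_ : energy u = energy (fun x => (u x - phi x) + phi x)); last first.
    by apply: eq_Rintegral => x _; rewrite subrK.
  by apply: energyD => //; exact: LpB.
have D2 : energy (partial i phi) <= 2 `^ p *
    (energy (fun x => G x ord0 i - grad phi x ord0 i) + energy (fun x => G x ord0 i)).
  rewrite (energyBC mu).
  rewrite (_ : energy (partial i phi) = energy (fun x => (grad phi x ord0 i - G x ord0 i) + G x ord0 i)); last first.
    by apply: eq_Rintegral => x _; rewrite subrK mxE.
  by apply: energyD => //; exact: LpB.
have D3 := P _ tp; have D4 := le_trans (denergy_coord _ _ i) u2.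
apply: le_trans D1 _.
apply: (@le_trans _ _ (2 `^ p * (e / b + c * (2 `^ p * (e / b + energy (fun x => G x ord0 i)))))).
  apply: (ler_wpM2l (ltW pp)); apply: (lerD u1).
  apply: le_trans D3 _; apply: (ler_wpM2l c0); apply: le_trans D2 _.
  exact: (ler_wpM2l (ltW pp) (lerD D4 (lexx _))).
have eb : e = e / b * b by rewrite divfK// gt_eqF.
rewrite [X in _ <= _ + X]eb; move: (e / b) (energy _) => f E.
rewrite /b; move: (2 `^ p) => P2.
by rewrite le_eqVlt; apply/orP; left; apply/eqP; ring.
Qed.

End sobolev_pairs.

(** * Positive parts *)

Section truncation.
Context {R : realType} {N : nat} (Omega : set 'rV[R]_N) (M : R).
Hypotheses (oO : open Omega) (OM : Omega `<=` cube M).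
Variables (p : R).
Hypothesis (p1 : 1 < p).
Local Notation mu := (lebesgue_rV N).
Local Notation Lp := (Lp mu Omega p).
Local Notation energy := (energy mu Omega p).
Local Notation Sob := (Sob Omega p).
Local Notation Lpv := (Lpv Omega p).
Local Notation denergy := (denergy Omega p).
Implicit Types (phi eta u v w : 'rV[R]_N -> R) (G H K : 'rV[R]_N -> 'rV[R]_N).

Let mO : measurable Omega. Proof. exact: open_measurable_rV. Qed.
Let p0 : 0 < p. Proof. exact: lt_trans p1. Qed.
Let pn0 : p != 0. Proof. exact: lt0r_neq0. Qed.

Lemma measurable_continuous_comp (F : R -> R) u : continuous F ->
  measurable_fun Omega u -> measurable_fun Omega (fun x => F (u x)).
Proof.
move=> cF mu_; have mF : measurable_fun setT F by exact: continuous_measurable_fun.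
exact: (measurableT_comp mF mu_).
Qed.

Lemma LpM_le1 (c g : 'rV[R]_N -> R) : measurable_fun Omega c ->
  (forall x, `|c x| <= 1) -> Lp g -> Lp (fun x => c x * g x).
Proof.
move=> mc c1 gp; apply: (Lp_dominated mO p0 _ gp).
  by apply: measurable_funM => //; case: gp.
by move=> x _; rewrite normrM ler_piMl.
Qed.

Lemma energyM_le1 (c g : 'rV[R]_N -> R) : measurable_fun Omega c ->
  (forall x, `|c x| <= 1) -> Lp g -> energy (fun x => c x * g x) <= energy g.
Proof.
move=> mc c1 gp; apply: (energy_le mO p0 (LpM_le1 mc c1 gp) gp).
by apply: aeW => x _; rewrite normrM ler_piMl.
Qed.

(** Dominated convergence with the bound |g|^p. *)
Lemma energyM_cvg0 (c : nat -> 'rV[R]_N -> R) g :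
  (forall n, measurable_fun Omega (c n)) -> (forall n x, `|c n x| <= 1) ->
  {ae mu, forall x, Omega x -> c n x @[n --> \oo] --> 0} -> Lp g ->
  (fun n => energy (fun x => c n x * g x)) @ \oo --> 0.
Proof.
move=> mc c1 c0 gp; have [mg gi] := gp.
rewrite -[X in _ --> X](energy0 mu Omega pn0).
apply: (@Rintegral_dominated _ _ _ mu Omega mO _ _ (fun x => `|g x| `^ p)).
- by move=> n; apply: measurable_powabs; exact: measurable_funM.
- by apply: measurable_powabs; exact: measurable_cst.
- exact: gi.
- move=> n x _; rewrite ger0_norm ?powR_ge0//; apply: powR_le => //; first exact: ltW.
  by rewrite normrM ler_piMl.
- apply: filterS c0 => x + Ox => /(_ Ox) cx.
  have cg : c n x * g x @[n --> \oo] --> 0 by rewrite -(mul0r (g x)); exact: cvgMr_tmp.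
  exact: (continuous_cvg _ (@continuous_abs_powR R p p0 0) cg).
Qed.

Lemma cvg0_small (c : nat -> R) e : c @ \oo --> 0 -> 0 < e -> exists n, c n <= e.
Proof.
move=> /cvgr0Pnorm_le c0 e0; have [n _ H] := c0 e e0.
by exists n; apply: le_trans (ler_norm _) (H n (leqnn n)).
Qed.

Lemma Lpv_dsoft (s : R) w G : 0 < s -> Sob any_test w G ->
  Lpv (fun x => dsoft_pos s (w x) *: G x).
Proof.
move=> s0 [wp Gp _] i; under eq_fun do rewrite mxE.
apply: (@LpM_le1 (fun x => dsoft_pos s (w x)) (fun x => G x ord0 i)); last exact: Gp.
  by apply: measurable_continuous_comp; [exact: continuous_dsoft_pos|case: wp].
by move=> x; rewrite ger0_norm ?dsoft_pos_ge0 ?dsoft_pos_le1.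
Qed.

(** Approximated by [soft_pos s (phi n)], where phi n tends to w fast enough to
    converge almost everywhere.  The gradients differ by
    dsoft_pos (phi n) (G - grad (phi n)), which is small in L^p, and by
    (dsoft_pos w - dsoft_pos (phi n)) G, which tends to 0 by dominated
    convergence. *)
Lemma Sob_soft_pos (s : R) w G : 0 < s -> Sob any_test w G ->
  Sob (@nonneg_test R N) (fun x => soft_pos s (w x)) (fun x => dsoft_pos s (w x) *: G x).
Proof.
move=> s0 wG; have [wp Gp wS] := wG.
have /choice[phi phiP] : forall n : nat, exists phi,
    [/\ test_function Omega phi, any_test phi, energy (fun x => w x - phi x) <= 4^-1 ^+ n &
        denergy G (grad phi) <= 4^-1 ^+ n] by move=> n; apply: wS; rewrite exprn_gt0.
have tp n : test_function Omega (phi n) by case: (phiP n).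
have php n := test_Lp oO OM p0 (tp n).
have gphp n := grad_Lpv oO OM p1 (tp n).
have cS : continuous (soft_pos s).
  by apply: Ck_continuous; exact: (Ck_soft_pos s0 0).
have SLp u : Lp u -> Lp (fun x => soft_pos s (u x)).
  move=> up; apply: (Lp_dominated mO p0 _ up).
    by apply: measurable_continuous_comp => //; case: up.
  move=> x _; have := soft_pos_lipschitz s0 (u x) 0.
  by rewrite (soft_pos_le0 s (lexx 0)) !subr0.
have aec : {ae mu, forall x, Omega x -> phi n x @[n --> \oo] --> w x}.
  have := fast_energy_cvg0 mO p0 (fun n => LpB mO p0 wp (php n))
    (fun n => let: And4 _ _ h _ := phiP n in h).
  apply: filterS => x + Ox => /(_ Ox) h.
  have E : (fun n => phi n x) = (fun n => w x - (w x - phi n x)).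
    by apply/funext => n; rewrite opprB addrC subrK.
  suff : phi n x @[n --> \oo] --> w x - 0 by rewrite subr0.
  by rewrite E; apply: cvgB => //; exact: cvg_cst.
have tS n : test_function Omega (fun x => soft_pos s (phi n x)).
  apply: test_comp => //; last exact: soft_pos_le0.
  by move=> k; exact: Ck_soft_pos.
pose dw n x := dsoft_pos s (w x) - dsoft_pos s (phi n x).
have mdw n : measurable_fun Omega (dw n).
  apply: measurable_funB; apply: measurable_continuous_comp;
    try exact: continuous_dsoft_pos; by [case: wp|case: (php n)].
have dw1 n x : `|dw n x| <= 1.
  rewrite /dw ler_norml.
  have := dsoft_pos_ge0 s0 (w x); have := dsoft_pos_le1 s (w x).
  have := dsoft_pos_ge0 s0 (phi n x); have := dsoft_pos_le1 s (phi n x); lra.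
have dwc : {ae mu, forall x, Omega x -> dw n x @[n --> \oo] --> 0}.
  apply: filterS aec => x + Ox => /(_ Ox) h.
  rewrite -(subrr (dsoft_pos s (w x))); apply: cvgB; first exact: cvg_cst.
  by apply: (@continuous_cvg _ _ _ _ _ _ (dsoft_pos s)) => //; exact: continuous_dsoft_pos.
pose I i n := energy (fun x => dw n x * G x ord0 i).
have I0 i : I i @ \oo --> 0 by exact: energyM_cvg0.
have q0 : (fun n => (4^-1 : R) ^+ n) @ \oo --> 0.
  by apply: cvg_expr; rewrite ger0_norm//; lra.
pose b n := 4^-1 ^+ n + \sum_(i < N) (2 `^ p * (4^-1 ^+ n + I i n)).
have b0 : b @ \oo --> 0.
  suff : b @ \oo --> (0 + \sum_(i < N) (2 `^ p * (0 + 0)) : R).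
    by rewrite add0r big1// => i _; rewrite addr0 mulr0.
  apply: cvgD => //; apply: cvg_big => [|i _]; first exact: add_continuous.
  by apply: cvgMl_tmp; apply: cvgD.
apply: (Sob_closed oO OM p1); [exact: SLp|exact: Lpv_dsoft|move=> e e0].
have [n bn] := cvg0_small b0 e0.
have In0 i : 0 <= 2 `^ p * (4^-1 ^+ n + I i n).
  by rewrite mulr_ge0 ?powR_ge0// addr_ge0 ?exprn_ge0 ?energy_ge0.
exists (fun x => soft_pos s (phi n x)), (grad (fun x => soft_pos s (phi n x))).
have [_ _ h1 h2] := phiP n; split.
- by apply: (Sob_test oO OM p1 (tS n)) => x; exact: soft_pos_ge0.
- apply: (le_trans _ bn); apply: (@le_trans _ _ (4^-1 ^+ n)); last first.
    by rewrite lerDl; exact: sumr_ge0.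
  apply: le_trans h1; apply: (energy_le mO p0).
  + exact: (LpB mO p0 (SLp _ wp) (SLp _ (php n))).
  + exact: (LpB mO p0 wp (php n)).
  + by apply: aeW => x _; exact: soft_pos_lipschitz.
- apply: (le_trans _ bn); apply: (@le_trans _ _ (\sum_(i < N) (2 `^ p * (4^-1 ^+ n + I i n)))); last first.
    by rewrite lerDr exprn_ge0.
  apply: ler_sum => i _.
  have dphi1 x : `|dsoft_pos s (phi n x)| <= 1.
    by rewrite ger0_norm ?dsoft_pos_ge0 ?dsoft_pos_le1.
  have mdphi : measurable_fun Omega (fun x => dsoft_pos s (phi n x)).
    by apply: measurable_continuous_comp; [exact: continuous_dsoft_pos|case: (php n)].
  have dGp := LpB mO p0 (Gp i) (gphp n i).
  have L1 := LpM_le1 mdphi dphi1 dGp.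
  have L2 := LpM_le1 (mdw n) (dw1 n) (Gp i).
  rewrite (_ : energy _ = energy (fun x =>
      dsoft_pos s (phi n x) * (G x ord0 i - grad (phi n) x ord0 i) + dw n x * G x ord0 i)); last first.
    apply: eq_Rintegral => x _; congr (`|_| `^ _).
    rewrite (grad_comp x (is_derive_soft_pos s0) (test_smooth (tp n))) !mxE /dw.
    ring.
  apply: (le_trans (energyD mO p0 L1 L2)); apply: ler_wpM2l; first exact: powR_ge0.
  apply: lerD; last exact: lexx.
  apply: le_trans (energyM_le1 mdphi dphi1 dGp) _.
  exact: le_trans (denergy_coord _ _ _ _ i) h2.
Qed.

(** The limit of [Sob_soft_pos] when s tends to 0. *)
Lemma Sob_pos w G : Sob any_test w G ->
  Sob (@nonneg_test R N) (fun x => Num.max (w x) 0) (fun x => (0 < w x)%R%:R *: G x).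
Proof.
move=> wG; have [wp Gp wS] := wG; have [mw _] := wp.
pose s (k : nat) : R := k.+1%:R^-1.
have s0 k : 0 < s k by rewrite invr_gt0.
have mind : measurable_fun Omega (fun x => (0 < w x)%R%:R : R).
  rewrite (_ : (fun x => _) = (fun x => \1_(`]0, +oo[%classic : set R) (w x))).
    have mi : measurable_fun setT (\1_(`]0, +oo[%classic : set R) : R -> R).
      by apply: measurable_indic.
    exact: (measurableT_comp mi mw).
  apply/funext => x; rewrite indicE; have [w0|w0] := ltP 0 (w x).
    by rewrite mem_set//= in_itv/= w0.
  by rewrite memNset//= in_itv/= andbT => w0'; move: w0; rewrite leNgt w0'.
have ind1 x : `|(0 < w x)%R%:R| <= 1 :> R by case: (0 < w x); rewrite ?normr1 ?normr0.
have maxp : Lp (fun x => Num.max (w x) 0).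
  apply: (Lp_dominated mO p0 _ wp); first by apply: measurable_maxr.
  by move=> x _; case: (leP (w x) 0) => // _; rewrite normr0.
have cutp : Lpv (fun x => (0 < w x)%R%:R *: G x).
  move=> i; under eq_fun do rewrite mxE.
  exact: (@LpM_le1 (fun x => (0 < w x)%R%:R) (fun x => G x ord0 i) mind ind1 (Gp i)).
pose c k x : R := (0 < w x)%R%:R - dsoft_pos (s k) (w x).
have mc k : measurable_fun Omega (c k).
  apply: measurable_funB => //; apply: measurable_continuous_comp => //.
  exact: continuous_dsoft_pos.
have c1 k x : `|c k x| <= 1.
  have := dsoft_pos_ge0 (s0 k) (w x); have := dsoft_pos_le1 (s k) (w x).
  by rewrite /c ler_norml; case: (0 < w x) => /=; lra.
have cc : {ae mu, forall x, Omega x -> c k x @[k --> \oo] --> 0}.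
  apply: aeW => x _; rewrite -(subrr ((0 < w x)%R%:R : R)); apply: cvgB; first exact: cvg_cst.
  exact: dsoft_pos_cvg.
pose d k x : R := (0 < w x)%R%:R - flat (s k) 0 (w x).
have md k : measurable_fun Omega (d k).
  apply: measurable_funB => //; apply: measurable_continuous_comp => //.
  exact: continuous_flat.
have d1 k x : `|d k x| <= 1.
  have := flat_ge0 (s k) 0 (w x); have := flat0_le1 (s0 k) (w x).
  by rewrite /d ler_norml; case: (0 < w x) => /=; lra.
have dc : {ae mu, forall x, Omega x -> d k x @[k --> \oo] --> 0}.
  apply: aeW => x _; rewrite -(subrr ((0 < w x)%R%:R : R)); apply: cvgB; first exact: cvg_cst.
  have [w0|w0] := ltP 0 (w x); first exact: flat_cvg1.
  by under eq_cvg do rewrite flat_le0//; exact: cvg_cst.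
pose b k := energy (fun x => d k x * w x) + \sum_(i < N) energy (fun x => c k x * G x ord0 i).
have b0 : b @ \oo --> 0.
  suff : b @ \oo --> (0 + \sum_(i < N) 0 : R) by rewrite big1// addr0.
  apply: cvgD; first exact: energyM_cvg0.
  apply: cvg_big => [|i _]; first exact: add_continuous.
  exact: energyM_cvg0.
apply: (Sob_closed oO OM p1) => // e e0; have [k bk] := cvg0_small b0 e0.
exists (fun x => soft_pos (s k) (w x)), (fun x => dsoft_pos (s k) (w x) *: G x); split.
- exact: Sob_soft_pos.
- apply: (le_trans _ bk); rewrite (_ : energy _ = energy (fun x => d k x * w x)).
    by rewrite lerDl; apply: sumr_ge0 => i _; exact: energy_ge0.
  apply: eq_Rintegral => x _; congr (`|_| `^ _); rewrite /d /soft_pos.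
  by case: (ltP 0 (w x)) => _ /=; rewrite ?mulr1n ?mulr0n; ring.
- apply: (le_trans _ bk); rewrite (_ : denergy _ _ = \sum_(i < N) energy (fun x => c k x * G x ord0 i)).
    by rewrite lerDr energy_ge0.
  apply: eq_bigr => i _; apply: eq_Rintegral => x _; congr (`|_| `^ _).
  by rewrite !mxE -mulrBl.
Qed.

End truncation.

(** * The space of limits and the Sobolev space *)

Section W01p_pairs.
Context {R : realType} {N : nat} (Omega : set 'rV[R]_N) (M : R).
Hypotheses (oO : open Omega) (OM : Omega `<=` cube M).
Local Notation mu := (lebesgue_rV N).
Implicit Types (u v w : 'rV[R]_N -> R) (G H K : 'rV[R]_N -> 'rV[R]_N).

Let mO : measurable Omega. Proof. exact: open_measurable_rV. Qed.

Lemma restrict_powR (p : R) u x : 0 < p ->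
  (`|(EFin \o (u \_ Omega)) x| `^ p)%E = ((fun y => (`|u y| `^ p)%:E) \_ Omega) x.
Proof.
move=> p0; have -> : (`|(EFin \o (u \_ Omega)) x|)%E = (`|(u \_ Omega) x|)%:E by [].
rewrite poweR_EFin !patchE; case: ifPn => // _.
by rewrite normr0 powR0// gt_eqF.
Qed.

Lemma Lp_norm_energy (p : R) u : 0 < p -> Lp mu Omega p u ->
  Lp_norm Omega p u = (energy mu Omega p u `^ p^-1)%:E.
Proof.
move=> p0 [mu_ ui]; rewrite /Lp_norm unlock.
rewrite (_ : \int[mu]_x _ = (energy mu Omega p u)%:E)%E ?poweR_EFin//.
rewrite /energy (EFin_Rintegral mO ui) [RHS]integral_mkcond.
by apply: eq_integral => x _; exact: restrict_powR.
Qed.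

Lemma Lp_onP (p : R) u : 0 < p -> Lp_on Omega p u <-> Lp mu Omega p u.
Proof.
move=> p0; have E : (\int[mu]_x (`|(EFin \o (u \_ Omega)) x| `^ p))%E =
    (\int[mu]_(x in Omega) (`|u x| `^ p)%:E)%E.
  rewrite [RHS]integral_mkcond; apply: eq_integral => x _.
  exact: restrict_powR.
split.
  case/andP => /set_mem m /set_mem; rewrite /= /finite_norm => f.
  have mu_ : measurable_fun Omega u by apply/(measurable_restrictT _ mO).
  have foo : (\int[mu]_(x in Omega) (`|u x| `^ p)%:E < +oo)%E.
    by rewrite -E -powR_Lnorm ?gt_eqF//; exact: poweR_lty.
  split; first exact: mu_.
  exact: (integrable_ge0 (measurable_powabs p mu_) (fun x _ => powR_ge0 _ _) foo).
move=> up; have [mu_ ui] := up; apply/andP; split; apply: mem_set => /=.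
  exact/(measurable_restrictT _ mO).
by rewrite /finite_norm -/(Lp_norm Omega p u) Lp_norm_energy// ltry.
Qed.

Variables (p : R).
Hypothesis (p1 : 1 < p).
Let p0 : 0 < p. Proof. exact: lt_trans p1. Qed.
Local Notation Sob := (Sob Omega p).

Lemma Sob_wgrad_ae Q u G : Sob Q u G -> {ae mu, forall x, Omega x -> wgrad Omega u x = G x}.
Proof.
move=> uG; have wG := Sob_weak_gradient oO OM p1 uG.
exact: (weak_gradient_unique oO OM (wgradP wG) wG (aeW _ (fun x _ => erefl))).
Qed.

Lemma wgrad_measurable u G i : is_weak_gradient Omega u G ->
  measurable_fun Omega (fun x => wgrad Omega u x ord0 i).
Proof. by move=> /wgradP[_ /(_ i)[[]]]. Qed.

Lemma Sob_wgrad Q u G : Sob Q u G -> Sob Q u (wgrad Omega u).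
Proof.
move=> uG; have [[mu_ _] _ _] := uG.
apply: (Sob_eq_ae oO OM p1 uG) => //.
- by move=> i; exact: wgrad_measurable (Sob_weak_gradient oO OM p1 uG).
- exact: aeW.
- by have := Sob_wgrad_ae uG; apply: filterS => x E Ox; rewrite E.
Qed.

Lemma wgrad_sub_energy u G phi i : is_weak_gradient Omega u G ->
  Lpv Omega p G -> test_function Omega phi ->
  Lp mu Omega p (fun x => wgrad Omega (u \- phi)%R x ord0 i) /\
  energy mu Omega p (fun x => wgrad Omega (u \- phi)%R x ord0 i) =
  energy mu Omega p (fun x => G x ord0 i - grad phi x ord0 i).
Proof.
move=> wG Gp tp.
have wD : is_weak_gradient Omega (u \- phi)%R (fun x => G x + (-1) *: grad phi x).
  have := weak_gradientD oO OM wG (weak_gradientZ oO OM (-1) (test_weak_gradient oO OM tp)).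
  by rewrite (_ : (fun x => u x + -1 * phi x) = u \- phi)//; apply/funext => x; rewrite mulN1r.
have gphi := grad_Lpv oO OM p1 tp.
have ae : {ae mu, forall x, Omega x -> G x ord0 i - grad phi x ord0 i =
    wgrad Omega (u \- phi)%R x ord0 i}.
  have := weak_gradient_unique oO OM (wgradP wD) wD (aeW _ (fun x _ => erefl)).
  by apply: filterS => x + Ox => /(_ Ox) ->; rewrite !mxE mulN1r.
have D := LpB mO p0 (Gp i) (gphi i).
have mw := wgrad_measurable i wD.
split; first exact: (Lp_eq_ae mO mw ae D).
by have [mD _] := D; rewrite (energy_eq_ae mO p mD mw ae).
Qed.

Lemma W1p_norm_sub u G phi : Lp mu Omega p u -> is_weak_gradient Omega u G ->
  Lpv Omega p G -> test_function Omega phi ->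
  W1p_norm Omega p (u \- phi)%R =
  (energy mu Omega p (fun x => u x - phi x) `^ p^-1 +
   \sum_(i < N) energy mu Omega p (fun x => G x ord0 i - grad phi x ord0 i) `^ p^-1)%:E.
Proof.
move=> up wG Gp tp; rewrite /W1p_norm EFinD -sumEFin.
rewrite (Lp_norm_energy p0 (LpB mO p0 up (test_Lp oO OM p0 tp))); congr (_ + _)%E.
apply: eq_bigr => i _; have [L E] := wgrad_sub_energy i wG Gp tp.
by rewrite (Lp_norm_energy p0 L) E.
Qed.

Lemma powRK a : 0 <= a -> (a `^ p^-1) `^ p = a.
Proof. by move=> a0; rewrite -powRrM mulVf ?gt_eqF// powRr1. Qed.

Lemma powRK' a : 0 <= a -> (a `^ p) `^ p^-1 = a.
Proof. by move=> a0; rewrite -powRrM mulfV ?gt_eqF// powRr1. Qed.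

(** The definition of W_0^{1,p} involves the norm of the chosen weak gradient of
    u - phi; by uniqueness it is grad u - grad phi almost everywhere, and the norm
    and the energies are small together. *)
Lemma W01pP u : W01p Omega p u <-> Sob (@any_test R N) u (wgrad Omega u).
Proof.
split.
  move=> [[uL [G wG GL]] H]; apply: (@Sob_wgrad _ _ G).
  have up : Lp mu Omega p u by apply/Lp_onP.
  have Gp : Lpv Omega p G by move=> i; apply/Lp_onP.
  split => // e e0.
  (* There are N components of the gradient, whose energies add up. *)
  pose r := e / N.+1%:R.
  have r0 : 0 < r by rewrite divr_gt0.
  have rip : 0 < r `^ p^-1 by rewrite powR_gt0.
  have re : r <= e by rewrite ler_pdivrMr// ler_peMr ?ler1n// ltW.
  have [phi tp] := H _ rip; rewrite (W1p_norm_sub up wG Gp tp) lte_fin => nphi.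
  have le_r a : 0 <= a -> a `^ p^-1 <= r `^ p^-1 -> a <= r.
    move=> a0 ar; rewrite -(powRK a0) -(powRK (ltW r0)).
    by apply: powR_le ar; [exact: ltW|exact: powR_ge0].
  have s0 : 0 <= \sum_(i < N) energy mu Omega p (fun x => G x ord0 i - grad phi x ord0 i) `^ p^-1.
    by apply: sumr_ge0 => i _; exact: powR_ge0.
  exists phi; split => //.
    apply: (le_trans _ re); apply: le_r; first exact: energy_ge0.
    by apply: le_trans (ltW nphi); rewrite lerDl.
  apply: (@le_trans _ _ (\sum_(i < N) r)).
    apply: ler_sum => i _; apply: le_r; first exact: energy_ge0.
    apply: le_trans (ltW nphi); rewrite (bigD1 i)//= addrCA lerDl addr_ge0 ?powR_ge0//.
    by apply: sumr_ge0 => j _; exact: powR_ge0.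
  rewrite sumr_const card_ord -[X in X *+ _]mulr1 -mulrnAr /r.
  by rewrite mulrAC ler_pdivrMr// ler_pM2l// ler_nat.
move=> uG; have [up Gp uS] := uG; have wG := Sob_weak_gradient oO OM p1 uG.
split.
  split; first exact/Lp_onP.
  by exists (wgrad Omega u) => // i; exact/Lp_onP.
move=> eps eps0.
pose r := eps / N.+2%:R.
have r0 : 0 < r by rewrite divr_gt0.
have rp : 0 < r `^ p by rewrite powR_gt0.
have [phi [tp _ h1 h2]] := uS _ rp; exists phi => //.
have le_r a : 0 <= a -> a <= r `^ p -> a `^ p^-1 <= r.
  move=> a0 ar; rewrite -(powRK' (ltW r0)).
  by apply: powR_le ar => //; rewrite invr_ge0 ltW.
rewrite (W1p_norm_sub up wG Gp tp) lte_fin.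
apply: (@le_lt_trans _ _ (r + \sum_(i < N) r)).
  apply: lerD; first by apply: le_r h1; exact: energy_ge0.
  apply: ler_sum => i _; apply: le_r; first exact: energy_ge0.
  exact: le_trans (denergy_coord _ _ _ _ i) h2.
rewrite sumr_const card_ord -mulrS -[X in X *+ _]mulr1 -mulrnAr /r.
by rewrite mulrAC ltr_pdivrMr// ltr_pM2l// ltr_nat.
Qed.

End W01p_pairs.

(** * The form of the p-Laplacian *)

Section flux_pairing.
Context {R : realType} {N : nat} (Omega : set 'rV[R]_N).
Local Notation mu := (lebesgue_rV N).
Hypothesis (mO : measurable Omega).
Variables (p q : R).
Hypotheses (p1 : 1 < p) (pq : p^-1 + q^-1 = 1).
Implicit Types (G H K : 'rV[R]_N -> 'rV[R]_N).
Local Notation Lpv := (Lpv Omega p).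

Let p0 : 0 < p. Proof. exact: lt_trans p1. Qed.

Lemma conjugate_gt0 : 0 < q.
Proof.
have p1' : p^-1 < 1 by rewrite invf_lt1.
by rewrite -invr_gt0; move: (q^-1) pq => r; lra.
Qed.

Lemma conjugate_eq : (p - 1) * q = p.
Proof.
have q0 := conjugate_gt0; have := pq.
move=> /(congr1 (fun t => t * p * q)).
rewrite mulrDl mulVf ?gt_eqF// mul1r mulrDl.
rewrite (mulrC q^-1) -!mulrA mulVf ?gt_eqF// mulr1 mul1r.
lra.
Qed.

Let q0 := conjugate_gt0.

Lemma Rintegral_sum (f : 'I_N -> 'rV[R]_N -> R) (r : seq 'I_N) :
  (forall i, mu.-integrable Omega (EFin \o f i)) ->
  \int[mu]_(x in Omega) (\sum_(i <- r) f i x) =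
  \sum_(i <- r) \int[mu]_(x in Omega) f i x.
Proof.
move=> fi; elim: r => [|i r IH].
  rewrite big_nil -[RHS](mul0r 0); under eq_Rintegral do rewrite big_nil.
  by rewrite /Rintegral integral0_eq// mul0r.
rewrite big_cons -IH -RintegralD//; last exact: integrable_bigsum.
by apply: eq_Rintegral => x _; rewrite big_cons.
Qed.

Lemma Lp_sum (f : 'I_N -> 'rV[R]_N -> R) (r : seq 'I_N) :
  (forall i, Lp mu Omega p (f i)) -> Lp mu Omega p (fun x => \sum_(i <- r) f i x).
Proof.
move=> fp; elim: r => [|i r IH].
  under eq_fun do rewrite big_nil.
  split; first exact: measurable_cst.
  rewrite normr0 powR0 ?gt_eqF//; exact: integrable0.
by under eq_fun do rewrite big_cons; apply: LpD.
Qed.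

Lemma Lp_norm_comp f : Lp mu Omega p f -> Lp mu Omega p (fun x => `|f x|).
Proof.
move=> fp; apply: (Lp_dominated mO p0 _ fp); last by move=> x _; rewrite normr_id.
by apply: measurableT_comp => //; case: fp.
Qed.

Lemma measurable_enorm G : (forall i, measurable_fun Omega (fun x => G x ord0 i)) ->
  measurable_fun Omega (fun x => enorm (G x)).
Proof.
move=> mG; have ms : measurable_fun setT (@Num.sqrt R).
  by apply: continuous_measurable_fun; exact: sqrt_continuous.
apply: (measurableT_comp ms); apply: measurable_sum => i.
exact: measurable_funM.
Qed.

Lemma Lp_enorm G : Lpv G -> Lp mu Omega p (fun x => enorm (G x)).
Proof.
move=> Gp; have := Lp_sum (index_enum 'I_N) (fun i => Lp_norm_comp (Gp i)).
move=> S; apply: (Lp_dominated mO p0 _ S).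
  by apply: measurable_enorm => i; case: (Gp i).
move=> x _; rewrite !ger0_norm ?enorm_ge0//; first exact: enorm_le_sum.
by apply: sumr_ge0.
Qed.

Lemma measurable_pflux G i : Lpv G ->
  measurable_fun Omega (fun x => pflux p (G x) ord0 i).
Proof.
move=> Gp; under eq_fun do rewrite mxE; apply: measurable_funM; last by case: (Gp i).
apply: (measurableT_comp (measurable_powR (p - 2))).
by apply: measurable_enorm => j; case: (Gp j).
Qed.

(** (|c|^(p-1))^q = |c|^p. *)
Lemma Lq_pflux G i : Lpv G -> Lp mu Omega q (fun x => pflux p (G x) ord0 i).
Proof.
move=> Gp; have mf := measurable_pflux i Gp; split => //.
have [_ ei] := Lp_enorm Gp.
apply: (integrable_dominated mO _ _ ei); first exact: measurable_powabs.
move=> x _; rewrite (ger0_norm (powR_ge0 _ _)) (ger0_norm (enorm_ge0 _)).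
rewrite -[X in _ <= _ `^ X]conjugate_eq powRrM -(enorm_pflux p1).
apply: powR_le (normr_ge0 _) (enorm_coord _ _); exact: ltW.
Qed.

Lemma pairing_integrable G H : Lpv G -> Lpv H ->
  mu.-integrable Omega (EFin \o (fun x => dotrV (pflux p (G x)) (H x))).
Proof.
move=> Gp Hp; apply: integrable_bigsum => // i _.
exact: (Lp_mul mO p0 q0 pq (Lq_pflux i Gp) (Hp i)).
Qed.

Lemma p_formE G H : p_form Omega p G H =
  \int[mu]_(x in Omega) dotrV (pflux p (G x)) (H x).
Proof. by []. Qed.

Lemma p_form_sum G H : Lpv G -> Lpv H -> p_form Omega p G H =
  \sum_(i < N) \int[mu]_(x in Omega) (pflux p (G x) ord0 i * H x ord0 i).
Proof.
move=> Gp Hp; rewrite p_formE -Rintegral_sum// => i.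
exact: (Lp_mul mO p0 q0 pq (Lq_pflux i Gp) (Hp i)).
Qed.

Lemma p_formZ c G H : Lpv G -> Lpv H ->
  p_form Omega p G (fun x => c *: H x) = c * p_form Omega p G H.
Proof.
move=> Gp Hp; rewrite !p_formE -RintegralZl//; last exact: pairing_integrable.
by apply: eq_Rintegral => x _; rewrite dotrVZr.
Qed.

Lemma p_formB G H K : Lpv G -> Lpv H -> Lpv K ->
  p_form Omega p G (fun x => H x - K x) = p_form Omega p G H - p_form Omega p G K.
Proof.
move=> Gp Hp Kp; rewrite !p_formE -RintegralB//; try exact: pairing_integrable.
by apply: eq_Rintegral => x _; rewrite dotrVBr.
Qed.

Lemma p_form_eq_ae G G' H H' : Lpv G -> Lpv G' -> Lpv H -> Lpv H' ->
  {ae mu, forall x, Omega x -> G x = G' x} ->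
  {ae mu, forall x, Omega x -> H x = H' x} ->
  p_form Omega p G H = p_form Omega p G' H'.
Proof.
move=> Gp Gp' Hp Hp' GG HH; rewrite !p_formE; apply: Rintegral_eq_ae => //.
- exact/integrable_measurable/pairing_integrable.
- exact/integrable_measurable/pairing_integrable.
- by apply: filterS2 GG HH => x G1 H1 Ox; rewrite G1// H1.
Qed.

(** The flux of G lies in the dual L^q, component by component. *)
Lemma p_form_small G e : Lpv G -> 0 < e -> exists2 r, 0 < r & forall H, Lpv H ->
  \sum_(i < N) energy mu Omega p (fun x => H x ord0 i) <= r ->
  `|p_form Omega p G H| <= e.
Proof.
move=> Gp e0; pose EG := \sum_(i < N) energy mu Omega q (fun x => pflux p (G x) ord0 i).
have EG0 : 0 <= EG by apply: sumr_ge0 => i _; exact: energy_ge0.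
have e2 : 0 < e / 2 by rewrite divr_gt0.
have s0 : 0 < e / 2 / (EG + 1) by rewrite divr_gt0// ltr_wpDl.
have [c c0 Y] := young_Rintegral mu mO p0 q0 pq s0.
exists (e / 2 / (c + 1)) => [|H Hp Hr]; first by rewrite divr_gt0// ltr_wpDl.
rewrite p_form_sum//; apply: le_trans (ler_norm_sum _ _ _) _.
apply: (@le_trans _ _ (e / 2 / (EG + 1) * EG +
    c * \sum_(i < N) energy mu Omega p (fun x => H x ord0 i))).
  rewrite !mulr_sumr -big_split/=; apply: ler_sum => i _.
  exact: (Y _ _ (Lq_pflux i Gp) (Hp i)).
rewrite [leRHS](_ : e = e / 2 + e / 2); last by lra.
apply: lerD.
  rewrite mulrAC ler_pdivrMr; last by rewrite ltr_wpDl.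
  by rewrite ler_pM2l// lerDl.
apply: le_trans (ler_wpM2l c0 Hr) _.
rewrite mulrA ler_pdivrMr; last by rewrite ltr_wpDl.
by rewrite mulrC ler_pM2l// lerDl.
Qed.

End flux_pairing.

(** * Comparison with superharmonic functions *)

Section comparison.
Context {R : realType} {N : nat} (Omega : set 'rV[R]_N) (M : R).
Hypotheses (oO : open Omega) (OM : Omega `<=` cube M) (M0 : 0 < M).
Variables (p q : R).
Hypotheses (p1 : 1 < p) (pq : p^-1 + q^-1 = 1) (i0 : 'I_N).
Variables (f psi : 'rV[R]_N -> R).
Hypothesis (fq : Lp (lebesgue_rV N) Omega q f).
Local Notation mu := (lebesgue_rV N).
Local Notation Sob := (Sob Omega p).
Local Notation Lpv := (Lpv Omega p).
Local Notation gr := (wgrad Omega).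
Implicit Types (u v w : 'rV[R]_N -> R) (G H K : 'rV[R]_N -> 'rV[R]_N).

Let mO : measurable Omega. Proof. exact: open_measurable_rV. Qed.
Let p0 : 0 < p. Proof. exact: lt_trans p1. Qed.
Let q0 : 0 < q. Proof. exact: conjugate_gt0 p1 pq. Qed.

Lemma W01p_Lpv u : W01p Omega p u -> Lpv (gr u).
Proof. by move=> /(W01pP oO OM p1)[]. Qed.

Lemma W01p_Lp u : W01p Omega p u -> Lp mu Omega p u.
Proof. by move=> /(W01pP oO OM p1)[]. Qed.

Lemma Sob_W01p Q u G : Sob Q u G -> W01p Omega p u.
Proof. by move=> /SobW/(Sob_wgrad oO OM p1) uG; exact/(W01pP oO OM p1). Qed.

Lemma data_integrable w : Lp mu Omega p w ->
  mu.-integrable Omega (EFin \o (fun x => f x * w x)).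
Proof. by move=> wp; exact: (Lp_mul mO p0 q0 pq fq wp). Qed.

(** Both sides are continuous with respect to the test function. *)
Lemma superharmonic_test v w K : superharmonic Omega p f v ->
  Sob (@nonneg_test R N) w K ->
  \int[mu]_(x in Omega) (f x * w x) <= p_form Omega p (gr v) K.
Proof.
move=> [vW vsup] [wp Kp wS]; have vp := W01p_Lpv vW.
apply/ler_addgt0Pr => e e0; have e2 : 0 < e / 2 by rewrite divr_gt0.
have [r1 r10 H1] := pairing_small mO p0 q0 pq fq e2.
have [r2 r20 H2] := p_form_small mO p1 pq vp e2.
have m1 : Num.min r1 r2 <= r1 by rewrite ge_min lexx.
have m2 : Num.min r1 r2 <= r2 by rewrite ge_min lexx orbT.
have r0 : 0 < Num.min r1 r2 by rewrite lt_min r10.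
have [phi [tp phi0 h1 h2]] := wS _ r0.
have php := test_Lp oO OM p0 tp; have gphp := grad_Lpv oO OM p1 tp.
have B1 := H1 _ (LpB mO p0 wp php) (le_trans h1 m1).
have DE : \sum_(i < N) energy mu Omega p (fun x => (K x - grad phi x) ord0 i) =
    denergy Omega p K (grad phi).
  by apply: eq_bigr => i _; apply: eq_Rintegral => x _; rewrite !mxE.
have B2 : `|p_form Omega p (gr v) (fun x => K x - grad phi x)| <= e / 2.
  by apply: H2; [exact: (LpvB oO p1 Kp gphp)|rewrite DE; exact: le_trans h2 m2].
have B3 := vsup _ tp phi0.
have E1 : \int[mu]_(x in Omega) (f x * (w x - phi x)) =
    \int[mu]_(x in Omega) (f x * w x) - \int[mu]_(x in Omega) (f x * phi x).
  rewrite -(RintegralB mO (data_integrable wp) (data_integrable php)).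
  by apply: eq_Rintegral => x _; rewrite mulrBr.
rewrite (p_formB mO p1 pq vp Kp gphp) in B2; rewrite E1 in B1.
move: B1 B2 B3; rewrite !ler_norml => /andP[_ A] /andP[B _] C.
move: (p_form _ _ _ _) (p_form _ _ _ _) (\int[mu]_(x in Omega) (f x * w x))
  (\int[mu]_(x in Omega) (f x * phi x)) A B C => a b c d A B C.
lra.
Qed.

(** Test the variational inequality with u + phi. *)
Lemma solution_superharmonic u : solves_obstacle_problem Omega p f psi u ->
  superharmonic Omega p f u.
Proof.
move=> [[uW psiu] VI]; split=> // phi tp phi0.
have uS := (W01pP oO OM p1 u).1 uW.
have pS := @Sob_test _ _ _ _ oO OM p p1 (@any_test R N) _ tp I.
pose v := fun x => u x + phi x.
have vW : W01p Omega p v by exact: (Sob_W01p (SobD oO OM p1 uS pS)).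
have := VI v; have -> : v \- u = phi by apply/funext => x; rewrite /= /v addrC addKr.
have -> : (fun x => f x * (v x - u x)) = (fun x => f x * phi x).
  by apply/funext => x; rewrite /v [u x + _]addrC addrK.
have phiW := Sob_W01p pS.
rewrite (p_form_eq_ae mO p1 pq (W01p_Lpv uW) (W01p_Lpv uW) (W01p_Lpv phiW)
  (grad_Lpv oO OM p1 tp) _ (Sob_wgrad_ae oO OM p1 pS)); last exact: aeW.
apply; split => //.
by apply: filterS psiu => x h Ox; apply: le_trans (h Ox) _; rewrite /v lerDl.
Qed.

(** Testing the variational inequality with min(u, v), and the
    superharmonicity of v with (u - v)^+, bounds the monotonicity gap of the flux
    on {u > v} by 0; strict monotonicity and the inequality of Poincare conclude. *)
Lemma solution_le_superharmonic u v : solves_obstacle_problem Omega p f psi u ->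
  superharmonic Omega p f v -> le_ae_on Omega psi v -> le_ae_on Omega u v.
Proof.
move=> [[uW psiu] VI] vsup psiv; have [vW _] := vsup.
have uS := (W01pP oO OM p1 u).1 uW; have vS := (W01pP oO OM p1 v).1 vW.
have up := W01p_Lpv uW; have vp := W01p_Lpv vW.
pose w x := u x - v x; pose W x := gr u x - gr v x.
have wS : Sob (@any_test R N) w W by exact: (SobB oO OM p1 uS vS).
have posS := Sob_pos oO OM p1 wS.
set wp := fun x => Num.max (w x) 0 in posS.
set Wp := fun x => (0 < w x)%R%:R *: W x in posS.
have [wpL WpL _] := posS.
pose z x := u x - wp x.
have zS := SobB oO OM p1 uS (SobW posS).
have zW : W01p Omega p z by exact: (Sob_W01p zS).
have psiz : le_ae_on Omega psi z.
  apply: filterS2 psiu psiv => x h1 h2 Ox.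
  rewrite /z /wp /w; case: (leP (u x - v x) 0) => _; first by rewrite subr0 h1.
  by rewrite opprB addrC subrK h2.
have VIz := VI z (conj zW psiz).
have zuE : z \- u = (fun x => (-1) * wp x).
  by apply/funext => x; rewrite /z mulN1r /= addrAC subrr add0r.
have zuS : Sob (@any_test R N) (z \- u) (fun x => (-1) *: Wp x).
  by rewrite zuE; exact: (SobZ oO OM p1 (-1) (SobW posS)).
rewrite (p_form_eq_ae mO p1 pq up up (W01p_Lpv (Sob_W01p zuS)) (LpvZ oO p1 (-1) WpL)
  _ (Sob_wgrad_ae oO OM p1 zuS)) in VIz; last exact: aeW.
rewrite (p_formZ mO p1 pq (-1) up WpL) in VIz.
have E : \int[mu]_(x in Omega) (f x * (z x - u x)) = - \int[mu]_(x in Omega) (f x * wp x).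
  rewrite -mulN1r -RintegralZl//; last exact: data_integrable.
  by apply: eq_Rintegral => x _; rewrite /z; ring.
rewrite E in VIz.
have SH := superharmonic_test vsup posS.
pose k x := dotrV (pflux p (gr u x)) (Wp x) - dotrV (pflux p (gr v x)) (Wp x).
have ki : mu.-integrable Omega (EFin \o k).
  by apply: (integrable_sub mO); exact: (pairing_integrable mO p1 pq).
have kE x : k x = (0 < w x)%R%:R * dotrV (pflux p (gr u x) - pflux p (gr v x)) (gr u x - gr v x).
  by rewrite /k /Wp !dotrVZr -mulrBr dotrVBl.
have k0 x : 0 <= k x by rewrite kE mulr_ge0// pflux_monotone.
have kle : \int[mu]_(x in Omega) k x <= 0.
  rewrite RintegralB//; [|exact: (pairing_integrable mO p1 pq)|exact: (pairing_integrable mO p1 pq)].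
  rewrite -!p_formE; move: VIz SH.
  move: (p_form _ _ _ _) (p_form _ _ _ _) (\int[mu]_(x in Omega) _) => a b c; lra.
have kae := Rintegral_eq0 mO ki (fun x _ => k0 x) kle.
have W0 : {ae mu, forall x, Omega x -> Wp x ord0 i0 = 0}.
  apply: filterS kae => x + Ox => /(_ Ox); rewrite kE /Wp /W !mxE => /eqP.
  rewrite mulf_eq0 => /orP[/eqP ->|/eqP/(pflux_strict p1) ->]; first by rewrite mul0r.
  by rewrite subrr mulr0.
have [c c0 PC] := Sob_poincare oO OM p1 i0 M0.
have := PC _ _ (SobW posS).
rewrite (energy_eq_ae mO p _ _ W0); [|by case: (WpL i0)|exact: measurable_cst].
rewrite energy0 ?gt_eqF// mulr0 => /(energy_eq0 mO p0 wpL).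
apply: filterS => x + Ox => /(_ Ox); rewrite /wp => h.
by rewrite -subr_le0 -/(w x) -h le_max lexx.
Qed.

Lemma solution_lowest u : solves_obstacle_problem Omega p f psi u ->
  lowest_superharmonic_above Omega p f psi u.
Proof.
move=> su; split; first exact: solution_superharmonic.
- by case: su => -[].
- by move=> v; exact: solution_le_superharmonic.
Qed.

(** Functions that are equal almost everywhere have the same weak gradients. *)
Lemma solution_eq_ae u u' : solves_obstacle_problem Omega p f psi u ->
  W01p Omega p u' -> {ae mu, forall x, Omega x -> u x = u' x} ->
  solves_obstacle_problem Omega p f psi u'.
Proof.
move=> [[uW psiu] VI] uW' uu.
have uS := (W01pP oO OM p1 u).1 uW; have uS' := (W01pP oO OM p1 u').1 uW'.
have wu := Sob_weak_gradient oO OM p1 uS; have wu' := Sob_weak_gradient oO OM p1 uS'.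
split; first by split => //; apply: filterS2 psiu uu => x h1 h2 Ox; rewrite -(h2 Ox); exact: h1.
move=> v vK; have := VI v vK; have [vW _] := vK.
have vS := (W01pP oO OM p1 v).1 vW.
have dS := SobB oO OM p1 vS uS; have dS' := SobB oO OM p1 vS uS'.
have guu := weak_gradient_unique oO OM wu wu' uu.
have dW := Sob_W01p dS; have dW' := Sob_W01p dS'.
have gdd : {ae mu, forall x, Omega x -> gr (v \- u) x = gr (v \- u') x}.
  apply: (weak_gradient_unique oO OM (wgradP (Sob_weak_gradient oO OM p1 dS))
    (wgradP (Sob_weak_gradient oO OM p1 dS'))).
  by apply: filterS uu => x h Ox; rewrite /= h.
rewrite (p_form_eq_ae mO p1 pq (W01p_Lpv uW) (W01p_Lpv uW') (W01p_Lpv dW) (W01p_Lpv dW') guu gdd).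
congr (_ <= _); have vp := W01p_Lp vW; have up := W01p_Lp uW; have up' := W01p_Lp uW'.
apply: Rintegral_eq_ae => //.
- by apply: integrable_measurable; apply: data_integrable; exact: (LpB mO p0 vp up).
- by apply: integrable_measurable; apply: data_integrable; exact: (LpB mO p0 vp up').
- by apply: filterS uu => x h Ox; rewrite h.
Qed.

End comparison.

(** * Existence of a minimizer *)

Section existence.
Context {R : realType} {N : nat} (Omega : set 'rV[R]_N) (M : R).
Hypotheses (oO : open Omega) (OM : Omega `<=` cube M) (M0 : 0 < M).
Variables (p q : R).
Hypotheses (p1 : 1 < p) (pq : p^-1 + q^-1 = 1) (i0 : 'I_N).
Variables (f psi : 'rV[R]_N -> R).
Hypothesis (fq : Lp (lebesgue_rV N) Omega q f) (psiW : W01p Omega p psi).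
Local Notation mu := (lebesgue_rV N).
Local Notation Sob := (Sob Omega p).
Local Notation Lpv := (Lpv Omega p).
Local Notation Lp := (Lp mu Omega p).
Local Notation energy_q := (energy mu Omega q).
Local Notation energy := (energy mu Omega p).
Local Notation gr := (wgrad Omega).
Implicit Types (u v w : 'rV[R]_N -> R) (G H K : 'rV[R]_N -> 'rV[R]_N).

Let mO : measurable Omega. Proof. exact: open_measurable_rV. Qed.
Let p0 : 0 < p. Proof. exact: lt_trans p1. Qed.
Let pn0 : p != 0. Proof. exact: lt0r_neq0. Qed.
Let q0 : 0 < q. Proof. exact: conjugate_gt0 p1 pq. Qed.

Definition dirichlet H := \int[mu]_(x in Omega) (enorm (H x) `^ p).

Definition admissible v H := Sob (@any_test R N) v H /\ le_ae_on Omega psi v.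

Definition functional v H := dirichlet H / p - \int[mu]_(x in Omega) (f x * v x).

Lemma dirichlet_integrable H : Lpv H ->
  mu.-integrable Omega (EFin \o (fun x => enorm (H x) `^ p)).
Proof.
move=> /(Lp_enorm mO p1)[_]; apply: eq_integrable => // x _ /=.
by rewrite ger0_norm ?enorm_ge0.
Qed.

Lemma dirichlet_ge0 H : 0 <= dirichlet H.
Proof. by apply: Rintegral_ge0 => x _; exact: powR_ge0. Qed.

Lemma energy_le_dirichlet H i : Lpv H -> energy (fun x => H x ord0 i) <= dirichlet H.
Proof.
move=> Hp; have [_ Hi] := Hp i; apply: (le_Rintegral mO Hi (dirichlet_integrable Hp)).
by move=> x _; apply: powR_le; [exact: ltW|exact: normr_ge0|exact: enorm_coord].
Qed.

Lemma dirichlet_tangent G H : Lpv G -> Lpv H ->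
  p * p_form Omega p G (fun x => H x - G x) <= dirichlet H - dirichlet G.
Proof.
move=> Gp Hp; have Dp := LpvB oO p1 Hp Gp.
have iG := dirichlet_integrable Gp; have iH := dirichlet_integrable Hp.
have iGD := pairing_integrable mO p1 pq Gp Dp.
rewrite p_formE -(RintegralZl p mO iGD) /dirichlet -(RintegralB mO iH iG).
apply: (le_Rintegral mO (integrable_scale mO p iGD) (integrable_sub mO iH iG)).
by move=> x _; exact: pflux_tangent.
Qed.

(** The inequality of Young bounds int f v by a small multiple of the energy of v,
    hence of the Dirichlet integral by Poincare, plus a constant. *)
Lemma functional_coercive : exists c, forall v H, Sob (@any_test R N) v H ->
  dirichlet H <= 2 * p * functional v H + c.
Proof.
have [C C0 PC] := Sob_poincare oO OM p1 i0 M0.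
have s0 : 0 < (2 * p * (C + 1))^-1.
  by rewrite invr_gt0 mulr_gt0 ?mulr_gt0 ?ltr_wpDl.
have qp : q^-1 + p^-1 = 1 by rewrite addrC.
have [c c0 Y] := young_Rintegral mu mO q0 p0 qp s0.
exists (2 * p * (c * energy_q f)) => v H vS; have [vp Hp _] := vS.
have := Y _ _ vp fq; have := PC _ _ vS; have := energy_le_dirichlet i0 Hp.
rewrite (_ : \int[mu]_(x in Omega) (v x * f x) = \int[mu]_(x in Omega) (f x * v x)); last first.
  by apply: eq_Rintegral => x _; rewrite mulrC.
rewrite /functional; have D0 := dirichlet_ge0 H.
move: (\int[mu]_(x in Omega) (f x * v x)) (dirichlet H) D0
  (energy (fun x => H x ord0 i0)) (energy v) (energy_q f)
  => I D D0 E1 E2 F h1 h2 h3.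
have h4 : E2 <= C * D by apply: le_trans h2 _; exact: ler_wpM2l.
have h5 : (2 * p * (C + 1))^-1 * E2 <= D / (2 * p).
  rewrite mulrC ler_pdivrMr ?mulr_gt0 ?ltr_wpDl//.
  have -> : D / (2 * p) * (2 * p * (C + 1)) = D * (C + 1) by field.
  by apply: le_trans h4 _; rewrite mulrC ler_wpM2l// lerDl.
have h6 : I <= D / (2 * p) + c * F.
  by apply: le_trans (ler_norm _) _; apply: le_trans h3 _; rewrite lerD2r.
have p2 : 0 < 2 * p by rewrite mulr_gt0.
have -> : 2 * p * (D / p - I) + 2 * p * (c * F) = 2 * D - 2 * p * (I - c * F) by field.
have : 2 * p * (I - c * F) <= 2 * p * (D / (2 * p)) by rewrite ler_pM2l// lerBlDr.
have -> : 2 * p * (D / (2 * p)) = D by field.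
lra.
Qed.

Lemma admissible_segment v v' H H' t : admissible v H -> admissible v' H' ->
  0 <= t <= 1 ->
  admissible (fun x => v x + t * (v' x - v x)) (fun x => H x + t *: (H' x - H x)).
Proof.
move=> [vS psiv] [vS' psiv'] /andP[t0 t1]; split.
  exact: (SobD oO OM p1 vS (SobZ oO OM p1 t (SobB oO OM p1 vS' vS))).
apply: filterS2 psiv psiv' => x h1 h2 Ox; have := h1 Ox; have := h2 Ox.
move=> a b; have : 0 <= (1 - t) * (v x - psi x) + t * (v' x - psi x).
  by rewrite addr_ge0// mulr_ge0// subr_ge0.
by move=> h; lra.
Qed.

Lemma uniform_convexity_dirichlet e : 0 < e -> exists2 k, 0 <= k & forall G H,
  Lpv G -> Lpv H ->
  dirichlet (fun x => G x - H x) <= e * (dirichlet G + dirichlet H) +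
    k * ((dirichlet G + dirichlet H) / 2 - dirichlet (fun x => 2^-1 *: (G x + H x))).
Proof.
move=> e0; have [k k0 U] := @uniform_convexity R N p p1 e e0.
exists k => // G H Gp Hp.
have iG := dirichlet_integrable Gp; have iH := dirichlet_integrable Hp.
have iD := dirichlet_integrable (LpvB oO p1 Gp Hp).
have iM := dirichlet_integrable (LpvZ oO p1 2^-1 (LpvD oO p1 Gp Hp)).
have iGH := integrable_add mO iG iH.
have E1 : e * (dirichlet G + dirichlet H) =
    \int[mu]_(x in Omega) (e * (enorm (G x) `^ p + enorm (H x) `^ p)).
  by rewrite (RintegralZl e mO iGH) (RintegralD mO iG iH).
have iGH2 := integrable_scale mO 2^-1 iGH.
have iS := integrable_sub mO iGH2 iM.
have E2 : k * ((dirichlet G + dirichlet H) / 2 - dirichlet (fun x => 2^-1 *: (G x + H x))) =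
    \int[mu]_(x in Omega) (k * (2^-1 * (enorm (G x) `^ p + enorm (H x) `^ p) -
       enorm (2^-1 *: (G x + H x)) `^ p)).
  rewrite (RintegralZl k mO iS) (RintegralB mO iGH2 iM) (RintegralZl 2^-1 mO iGH).
  by rewrite (RintegralD mO iG iH) (mulrC 2^-1).
have i1 := integrable_scale mO e iGH; have i2 := integrable_scale mO k iS.
rewrite E1 E2 -(RintegralD mO i1 i2).
apply: (le_Rintegral mO iD (integrable_add mO i1 i2)) => x _.
by rewrite (mulrC 2^-1); exact: U.
Qed.

Lemma functional_has_inf :
  has_inf [set J | exists v H, admissible v H /\ J = functional v H].
Proof.
split.
  exists (functional psi (gr psi)), psi, (gr psi); split => //.
  by split; [exact: (W01pP oO OM p1 psi).1 psiW|exact: aeW].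
have [c C] := functional_coercive; exists (- c / (2 * p)) => _ [v [H [[vS _] ->]]].
have := le_trans (dirichlet_ge0 H) (C _ _ vS).
rewrite ler_pdivrMr ?mulr_gt0//; move: (functional _ _) => J; lra.
Qed.

Lemma harmonic_small (e : R) : 0 < e -> exists n0, forall n, (n0 <= n)%N -> n.+1%:R^-1 <= e.
Proof.
move=> e0; have /cvgr0Pnorm_le/(_ e e0)[n0 _ H] := @cvg_harmonic R.
by exists n0 => n n0n; apply: le_trans (ler_norm _) (H n n0n).
Qed.

Lemma denergy_cvg (Hn : nat -> 'rV[R]_N -> 'rV[R]_N) H :
  (forall i e, 0 < e -> exists n0, forall n, (n0 <= n)%N ->
    energy (fun x => H x ord0 i - Hn n x ord0 i) <= e) ->
  forall e, 0 < e -> exists n0, forall n, (n0 <= n)%N -> denergy Omega p H (Hn n) <= e.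
Proof.
move=> HH e e0; have e1 : 0 < e / N.+1%:R by rewrite divr_gt0.
have [n0 n0P] := choice (fun i => HH i _ e1).
exists (\max_(i < N) n0 i)%N => n le_n.
apply: (@le_trans _ _ (\sum_(i < N) (e / N.+1%:R))).
  apply: ler_sum => i _; apply: n0P; apply: leq_trans le_n.
  exact: (@leq_bigmax _ n0 i).
rewrite sumr_const card_ord -[X in X *+ _]mulr1 -mulrnAr mulrAC.
by rewrite ler_pdivrMr// ler_pM2l// ler_nat.
Qed.

(** The direct method.  If two competitors almost minimize the functional, so does
    their midpoint, and the midpoint defect of the Dirichlet integral is small;
    by uniform convexity minimizing sequences are Cauchy.  At the limit, the
    tangent inequality gives lower semicontinuity. *)
Lemma functional_minimizer : exists v H, admissible v H /\
  forall v' H', admissible v' H' -> functional v H <= functional v' H'.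
Proof.
have HI := functional_has_inf.
set A := [set J | _] in HI; pose m := inf A.
have mlb v H : admissible v H -> m <= functional v H.
  by move=> vS; apply: ge_inf; [case: HI|exists v, H].
have /choice[vH vHP] : forall n : nat, exists vH : ('rV[R]_N -> R) * ('rV[R]_N -> 'rV[R]_N),
    admissible vH.1 vH.2 /\ functional vH.1 vH.2 <= m + n.+1%:R^-1.
  move=> n; have e0 : 0 < n.+1%:R^-1 :> R by rewrite invr_gt0.
  have [_ [v [H [vS ->]]] lt] := inf_adherent e0 HI.
  by exists (v, H); split => //; exact: ltW.
pose v n := (vH n).1; pose H n := (vH n).2.
have vS n : admissible (v n) (H n) by case: (vHP n).
have Jn n : functional (v n) (H n) <= m + n.+1%:R^-1 by case: (vHP n).
have vp n : Lp (v n) by case: (vS n) => -[].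
have Hp n : Lpv (H n) by case: (vS n) => -[].
have [c C] := functional_coercive.
pose B := 2 * p * (m + 1) + c.
have p2 : 0 < 2 * p by rewrite mulr_gt0.
have EB n : dirichlet (H n) <= B.
  apply: le_trans (C _ _ (vS n).1) _; rewrite /B lerD2r ler_pM2l//.
  by apply: le_trans (Jn n) _; rewrite lerD2l invf_le1// ler1n.
have B0 : 0 <= B := le_trans (dirichlet_ge0 _) (EB 0%N).
(* The linear term drops out of the midpoint defect. *)
have defect n k r : n.+1%:R^-1 <= r -> k.+1%:R^-1 <= r ->
    (dirichlet (H n) + dirichlet (H k)) / 2 -
      dirichlet (fun x => 2^-1 *: (H n x + H k x)) <= p * r.
  move=> nr kr.
  have h01 : (0 <= 2^-1 :> R) && (2^-1 <= 1 :> R) by rewrite invr_ge0 ler0n invf_le1 ?ler1n.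
  have := mlb _ _ (admissible_segment (vS n) (vS k) h01).
  have HE : (fun x => H n x + 2^-1 *: (H k x - H n x)) = (fun x => 2^-1 *: (H n x + H k x)).
    by apply/funext => x; apply/rowP => i; rewrite !mxE; lra.
  have IE : \int[mu]_(x in Omega) (f x * (v n x + 2^-1 * (v k x - v n x))) =
      2^-1 * (\int[mu]_(x in Omega) (f x * v n x) + \int[mu]_(x in Omega) (f x * v k x)).
    have in_ := data_integrable oO p1 pq fq (vp n).
    have ik := data_integrable oO p1 pq fq (vp k).
    rewrite -(RintegralD mO in_ ik) -(RintegralZl 2^-1 mO (integrable_add mO in_ ik)).
    by apply: eq_Rintegral => x _; field.
  rewrite /functional HE IE; have := Jn n; have := Jn k; rewrite /functional.
  set Dn := dirichlet (H n); set Dk := dirichlet (H k).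
  set D := dirichlet (fun x => 2^-1 *: (H n x + H k x)).
  move: (\int[mu]_(x in Omega) (f x * v n x)) (\int[mu]_(x in Omega) (f x * v k x)) => In Ik.
  move: Dn Dk D (n.+1%:R^-1) (k.+1%:R^-1) nr kr => Dn Dk D a b nr kr h1 h2 h3.
  have : (Dn / p + Dk / p) / 2 - D / p <= r by lra.
  rewrite -(ler_pM2l p0).
  by have -> : p * ((Dn / p + Dk / p) / 2 - D / p) = (Dn + Dk) / 2 - D by field.
have cauchyD e : 0 < e -> exists n0, forall n k, (n0 <= n)%N -> (n0 <= k)%N ->
    dirichlet (fun x => H n x - H k x) <= e.
  move=> e0; have B1 : 0 < 4 * B + 1 by rewrite ltr_wpDl// mulr_ge0.
  have [k k0 U] := uniform_convexity_dirichlet (divr_gt0 e0 B1).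
  have kp1 : 0 < k * p + 1 by apply: ltr_wpDl => //; exact: (mulr_ge0 k0 (ltW p0)).
  have kp : 0 < 2 * (k * p + 1) by exact: mulr_gt0.
  have [n0 n0P] := harmonic_small (divr_gt0 e0 kp).
  exists n0 => n j n0n n0j; apply: le_trans (U _ _ (Hp n) (Hp j)) _.
  have := defect n j _ (n0P _ n0n) (n0P _ n0j).
  move=> /(ler_wpM2l k0) h.
  have h' : e / (4 * B + 1) * (dirichlet (H n) + dirichlet (H j)) <= e / 2.
    apply: (@le_trans _ _ (e / (4 * B + 1) * (2 * B))).
      apply: (ler_wpM2l (ltW (divr_gt0 e0 B1))).
      by rewrite mulr_natl mulr2n; exact: (lerD (EB n) (EB j)).
    have -> : e / (4 * B + 1) * (2 * B) = e * (2 * B) / (4 * B + 1) by rewrite mulrAC.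
    rewrite (ler_pdivrMr _ _ B1) -mulrA (ler_pM2l e0) [_^-1 * _]mulrC.
    have -> : (4 * B + 1) / 2 = 2 * B + 2^-1 by field.
    by rewrite lerDl invr_ge0 ler0n.
  rewrite [leRHS](splitr e); apply: (lerD h'); apply: le_trans h _.
  have -> : k * (p * (e / (2 * (k * p + 1)))) = (e / 2) * (k * p) / (k * p + 1).
    by field; rewrite gt_eqF.
  rewrite (ler_pdivrMr _ _ kp1) ler_pM2l; last exact: (divr_gt0 e0).
  by rewrite lerDl.
have [C1 C10 PC] := Sob_poincare oO OM p1 i0 M0.
have cauchyH i e : 0 < e -> exists n0, forall n k, (n0 <= n)%N -> (n0 <= k)%N ->
    energy (fun x => H n x ord0 i - H k x ord0 i) <= e.
  move=> /cauchyD[n0 n0P]; exists n0 => n k n0n n0k; apply: le_trans (n0P _ _ n0n n0k).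
  have := energy_le_dirichlet i (LpvB oO p1 (Hp n) (Hp k)); apply: le_trans.
  rewrite le_eqVlt; apply/orP; left; apply/eqP.
  by apply: eq_Rintegral => x _; rewrite !mxE.
have cauchyv e : 0 < e -> exists n0, forall n k, (n0 <= n)%N -> (n0 <= k)%N ->
    energy (fun x => v n x - v k x) <= e.
  move=> e0; have C11 : 0 < C1 + 1 by rewrite ltr_wpDl.
  have [n0 n0P] := cauchyH i0 _ (divr_gt0 e0 C11).
  exists n0 => n k n0n n0k.
  apply: le_trans (PC _ _ (SobB oO OM p1 (vS n).1 (vS k).1)) _.
  have -> : energy (fun x => (H n x - H k x) ord0 i0) =
      energy (fun x => H n x ord0 i0 - H k x ord0 i0).
    by apply: eq_Rintegral => x _; rewrite !mxE.
  apply: le_trans (ler_wpM2l C10 (n0P _ _ n0n n0k)) _.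
  by rewrite mulrA ler_pdivrMr// mulrC ler_pM2l// lerDl.
have [w wp wv] := Lp_complete mO p0 vp cauchyv.
have /choice[h hP] : forall i, exists h, Lp h /\ forall e, 0 < e -> exists n0, forall n,
    (n0 <= n)%N -> energy (fun x => h x - H n x ord0 i) <= e.
  move=> i; have [h hp hH] := Lp_complete mO p0 (fun n => Hp n i) (cauchyH i).
  by exists h.
pose W x : 'rV[R]_N := \row_i h i x.
have WE i : (fun x => W x ord0 i) = h i by apply/funext => x; rewrite mxE.
have Wp : Lpv W by move=> i; rewrite WE; case: (hP i).
have WH := @denergy_cvg H W.
have {}WH : forall e, 0 < e -> exists n0, forall n, (n0 <= n)%N -> denergy Omega p W (H n) <= e.
  apply: WH => i e e0; have [_ /(_ e e0)[n0 n0P]] := hP i; exists n0 => n n0n.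
  apply: le_trans (n0P n n0n); rewrite le_eqVlt; apply/orP; left; apply/eqP.
  by apply: eq_Rintegral => x _; rewrite mxE.
have both e : 0 < e -> exists n0, forall n, (n0 <= n)%N ->
    energy (fun x => w x - v n x) <= e /\ denergy Omega p W (H n) <= e.
  move=> e0; have [n1 n1P] := wv e e0; have [n2 n2P] := WH e e0.
  exists (maxn n1 n2) => n; rewrite geq_max => /andP[a b].
  by split; [exact: n1P|exact: n2P].
have wS : Sob (@any_test R N) w W.
  apply: (Sob_closed oO OM p1 wp Wp) => e e0; have [n0 /(_ n0 (leqnn _))[a b]] := both e e0.
  by exists (v n0), (H n0); split => //; case: (vS n0).
have psip : Lp psi by exact: (W01p_Lp oO OM p1 psiW).
have wK : le_ae_on Omega psi w.
  apply: (le_ae_closed mO p0 psip wp) => e e0; have [n0 /(_ n0 (leqnn _))[a b]] := both e e0.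
  by exists (v n0); split => //; case: (vS n0).
exists w, W; split => // v' H' vS'; apply: le_trans (mlb _ _ vS').
apply/ler_addgt0Pr => e e0; have e3 : 0 < e / 3 by rewrite divr_gt0.
have [r1 r10 P1] := pairing_small mO p0 q0 pq fq e3.
have [r2 r20 P2] := p_form_small mO p1 pq Wp e3.
have r0 : 0 < Num.min r1 r2 by rewrite lt_min r10.
have m1 : Num.min r1 r2 <= r1 by rewrite ge_min lexx.
have m2 : Num.min r1 r2 <= r2 by rewrite ge_min lexx orbT.
have [n1 n1P] := both _ r0; have [n2 n2P] := harmonic_small e3.
pose n := maxn n1 n2.
have [a b] := n1P n (leq_maxl _ _); have cn := n2P n (leq_maxr _ _).
have B1 := P1 _ (LpB mO p0 wp (vp n)) (le_trans a m1).
have DE : \sum_(i < N) energy (fun x => (H n x - W x) ord0 i) = denergy Omega p W (H n).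
  rewrite denergyC; apply: eq_bigr => i _; apply: eq_Rintegral => x _; by rewrite !mxE.
have B2 : `|p_form Omega p W (fun x => H n x - W x)| <= e / 3.
  by apply: P2; [exact: (LpvB oO p1 (Hp n) Wp)|rewrite DE; exact: le_trans b m2].
have T := dirichlet_tangent Wp (Hp n).
have IE : \int[mu]_(x in Omega) (f x * (w x - v n x)) =
    \int[mu]_(x in Omega) (f x * w x) - \int[mu]_(x in Omega) (f x * v n x).
  have iw := data_integrable oO p1 pq fq wp; have iv := data_integrable oO p1 pq fq (vp n).
  rewrite -(RintegralB mO iw iv).
  by apply: eq_Rintegral => x _; rewrite mulrBr.
have := Jn n; rewrite IE in B1; rewrite /functional.
move: B1 B2 T; rewrite !ler_norml => /andP[B1 _] /andP[B2 _].
move: (dirichlet W) (dirichlet (H n)) (p_form _ _ _ _) (\int[mu]_(x in Omega) (f x * w x))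
  (\int[mu]_(x in Omega) (f x * v n x)) (n.+1%:R^-1) cn B1 B2 =>
  DW DH PF Iw Iv hn cn B1 B2 T J.
have : DW / p <= DH / p - PF.
  rewrite -(ler_pM2l p0) mulrBr !(mulrCA p) divff// !mulr1.
  lra.
lra.
Qed.

End existence.

(** * The variational inequality at a minimizer *)

Section euler_lagrange.
Context {R : realType} {N : nat} (Omega : set 'rV[R]_N) (M : R).
Hypotheses (oO : open Omega) (OM : Omega `<=` cube M) (M0 : 0 < M).
Variables (p q : R).
Hypotheses (p1 : 1 < p) (pq : p^-1 + q^-1 = 1) (i0 : 'I_N).
Variables (f psi : 'rV[R]_N -> R).
Hypothesis (fq : Lp (lebesgue_rV N) Omega q f) (psiW : W01p Omega p psi).
Local Notation mu := (lebesgue_rV N).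
Local Notation Lpv := (Lpv Omega p).
Local Notation gr := (wgrad Omega).
Local Notation admissible := (admissible Omega p psi).
Local Notation functional := (functional Omega p f).
Implicit Types (u v w : 'rV[R]_N -> R) (G H K : 'rV[R]_N -> 'rV[R]_N).

Let mO : measurable Omega. Proof. exact: open_measurable_rV. Qed.
Let p0 : 0 < p. Proof. exact: lt_trans p1. Qed.

(** Dominated convergence: the integrands are at most (|G| + |K|)^p. *)
Lemma p_form_line G K : Lpv G -> Lpv K ->
  p_form Omega p (fun x => G x + n.+1%:R^-1 *: K x) K @[n --> \oo] --> p_form Omega p G K.
Proof.
move=> Gp Kp.
have mF n : measurable_fun Omega
    (fun x => dotrV (pflux p (G x + n.+1%:R^-1 *: K x)) (K x)).
  exact: (integrable_measurable
    (pairing_integrable mO p1 pq (LpvD oO p1 Gp (LpvZ oO p1 _ Kp)) Kp)).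
have mf := integrable_measurable (pairing_integrable mO p1 pq Gp Kp).
have [_ ig] := LpD mO p0 (Lp_enorm mO p1 Gp) (Lp_enorm mO p1 Kp).
apply: (Rintegral_dominated mO mF mf ig) => [n x _|].
  set s := enorm (G x) + enorm (K x).
  have s0 : 0 <= s by rewrite addr_ge0 ?enorm_ge0.
  rewrite (ger0_norm s0) -(mulr_powRB1 s0 p0) mulrC.
  apply: le_trans (dotrV_pflux_le p1 _ _) _.
  apply: ler_pM; [exact: powR_ge0|exact: enorm_ge0| |by rewrite lerDr enorm_ge0].
  apply: powR_le; [by rewrite ltW// subr_gt0|exact: enorm_ge0|].
  apply: le_trans (enormD _ _) _; rewrite lerD2l enormZ ger0_norm ?invr_ge0//.
  by rewrite ler_piMl ?enorm_ge0// invf_le1// ler1n.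
apply: aeW => x _.
pose g (t : R) := dotrV (pflux p (t *: K x + G x)) (K x).
have c : continuous g.
  exact: (continuous_pflux p1 (@continuous_line _ _ (K x) (G x))).
have -> : (fun n : nat => dotrV (pflux p (G x + n.+1%:R^-1 *: K x)) (K x)) =
    (fun n => g (harmonic n)) by apply/funext => n; rewrite /g addrC.
have -> : dotrV (pflux p (G x)) (K x) = g 0 by rewrite /g scale0r add0r.
exact: (@continuous_cvg _ _ _ _ _ _ _ _ (c 0) (@cvg_harmonic R)).
Qed.

(** Moving from w towards v does not decrease the functional.  The tangent
    inequality at the displaced field bounds the increase of the Dirichlet
    integral by the form. *)
Lemma minimizer_pairing w W v H : admissible w W -> admissible v H ->
  (forall v' H', admissible v' H' -> functional w W <= functional v' H') ->
  \int[mu]_(x in Omega) (f x * (v x - w x)) <= p_form Omega p W (fun x => H x - W x).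
Proof.
move=> wS vS minw; have [[wp Wp _] _] := wS; have [[vp Hp _] _] := vS.
pose K x := H x - W x; have Kp : Lpv K by exact: LpvB.
pose d x := v x - w x; have dp : Lp mu Omega p d by exact: LpB.
have L := p_form_line Wp Kp.
(* Each step of size 1/(n+1) gives an upper bound of the left-hand side by the
   form at an intermediate field; let n tend to infinity. *)
rewrite -(cvg_lim (@Rhausdorff R) L); apply: limr_ge; first by apply/cvg_ex; eexists; exact: L.
apply: nearW => n; set t : R := n.+1%:R^-1.
have t0 : 0 < t by rewrite invr_gt0.
have t01 : (0 <= t) && (t <= 1) by rewrite (ltW t0) invf_le1// ler1n.
pose G x := W x + t *: K x.
have Gp : Lpv G by exact: (LpvD oO p1 Wp (LpvZ oO p1 t Kp)).
have := minw _ _ (admissible_segment oO OM p1 wS vS t01).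
have := dirichlet_tangent oO p1 pq Gp Wp.
have -> : (fun x => W x - G x) = (fun x => (- t) *: K x).
  by apply/funext => x; rewrite /G opprD addrA subrr add0r scaleNr.
rewrite (p_formZ mO p1 pq (- t) Gp Kp) /functional -/G.
have -> : \int[mu]_(x in Omega) (f x * (w x + t * (v x - w x))) =
    \int[mu]_(x in Omega) (f x * w x) + t * \int[mu]_(x in Omega) (f x * d x).
  have iw := data_integrable oO p1 pq fq wp; have id_ := data_integrable oO p1 pq fq dp.
  rewrite -(RintegralZl t mO id_) -(RintegralD mO iw (integrable_scale mO t id_)).
  by apply: eq_Rintegral => x _; rewrite mulrDr mulrCA.
rewrite -/(dirichlet Omega p G).
move: (dirichlet Omega p G) (dirichlet Omega p W) (p_form Omega p G K)
  (\int[mu]_(x in Omega) (f x * d x)) (\int[mu]_(x in Omega) (f x * w x)) => DG DW P I J T m.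
rewrite -(ler_pM2l t0) -(ler_pM2l p0).
have : p * (DW / p - J) <= p * (DG / p - (J + t * I)) by rewrite ler_pM2l.
have -> : p * (DW / p - J) = DW - p * J by field; exact: lt0r_neq0.
have -> : p * (DG / p - (J + t * I)) = DG - p * J - p * (t * I) by field; exact: lt0r_neq0.
move: T; rewrite mulNr mulrN; move: (p * (t * P)) (p * (t * I)) (p * J) => a b c; lra.
Qed.

Lemma obstacle_solution_exists : exists w, solves_obstacle_problem Omega p f psi w.
Proof.
have [w [W [wS minw]]] := functional_minimizer oO OM M0 p1 pq i0 fq psiW.
have [wSob psiw] := wS; have [wp Wp _] := wSob; have wW := Sob_W01p oO OM p1 wSob.
exists w; split=> // v [vW psiv].
have vSob := (W01pP oO OM p1 v).1 vW; have [vp Vp _] := vSob.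
have dS := SobB oO OM p1 vSob wSob.
have dW := W01p_Lpv oO OM p1 (Sob_W01p oO OM p1 dS).
rewrite (p_form_eq_ae mO p1 pq (W01p_Lpv oO OM p1 wW) Wp dW (LpvB oO p1 Vp Wp)
  (Sob_wgrad_ae oO OM p1 wSob) (Sob_wgrad_ae oO OM p1 dS)).
exact: (minimizer_pairing wS (conj vSob psiv)).
Qed.

End euler_lagrange.

Theorem proposition4 (R : realType) (N : nat) (Omega : set 'rV[R]_N) (p q : R)
    (psi f u : 'rV[R]_N -> R) :
  (2 <= N)%N ->
  bounded_domain Omega -> piecewise_C1_boundary Omega ->
  1 < p -> p^-1 + q^-1 = 1 ->
  W01p Omega p psi -> Lp_on Omega q f ->
  solves_obstacle_problem Omega p f psi u <->
  lowest_superharmonic_above Omega p f psi u.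
Proof.
move=> N2 [oO _ _ /bounded_sub_cube[M M0 OM]] _ p1 pq psiW.
move=> /(Lp_onP oO _ (conjugate_gt0 p1 pq)) fq.
have i0 : 'I_N by exact: (Ordinal (ltnW N2)).
split; first exact: (solution_lowest oO OM M0 p1 pq i0 fq).
move=> [usup psiu lowu].
have [w sw] := obstacle_solution_exists oO OM M0 p1 pq i0 fq psiW.
have [wsup psiw loww] := solution_lowest oO OM M0 p1 pq i0 fq sw.
apply: (solution_eq_ae oO OM p1 pq fq sw); first by case: usup.
apply: filterS2 (loww _ usup psiu) (lowu _ wsup psiw) => x wu uw Ox.
by apply/eqP; rewrite eq_le wu// uw.
Qed.
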